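(* Let $(G,H,\sigma)$ be a reduced $1$-dimensional Hecke triple such that $$B=\{x\in G\mid\sigma(h)=\sigma(x^{-1}hx)\text{ for all }h\in H\cap xHx^{-1}\}$$ is a subgroup of $G$ and $(B,H)$ is directed. Then $$C^*(\mathcal{H}_\sigma(G,H))=C^*(\mathcal{H}_\sigma(B,H))=p_\sigma C^*(B_\sigma)p_\sigma.$$
   Context: A Hecke pair $(G,H)$ is a group $G$ with a subgroup $H$ such that $[H:H\cap xHx^{-1}]<\infty$ for all $x\in G$. The Hecke topology from $(G,H)$ is the group topology on $G$ with $\{xHx^{-1}\mid x\in G\}$ as neighbourhood subbase at $e$; the pair is reduced if $\bigcap_{x\in G}xHx^{-1}=\{e\}$. The Schlichting completion of a reduced Hecke pair consists of the completion of $G$ in the Hecke topology (locally compact, totally disconnected) and the closure of the subgroup in it (compact open). A $1$-dimensional Hecke triple $(G,H,\sigma)$ is a Hecke pair $(G,H)$ with a unitary character $\sigma:H\to\mathbb{T}$ with finite range; $K=\ker\sigma$; it is reduced if the Hecke pair $(G,K)$ is. Its Schlichting completion $(G_\sigma,H_\sigma,\sigma)$: $(G_\sigma,K_\sigma)$ is the Schlichting completion of $(G,K)$, $H_\sigma$ is the closure of $H$ in $G_\sigma$ (compact open), and $\sigma$ denotes also the unique continuous extension to $H_\sigma$. $\mathcal{H}_\sigma(G,H)$ is the $*$-algebra of functions $f:G\to\mathbb{C}$ with finite support in $H\backslash G/H$ and $f(hxk)=\sigma(h)f(x)\sigma(k)$ for $h,k\in H$, $x\in G$, with $f*g(x)=\sum_{yH\in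 G/H}f(y)g(y^{-1}x)$ and $f^*(x)=\Delta_K(x^{-1})\overline{f(x^{-1})}$, $\Delta_K(x)=[K:K\cap xKx^{-1}]/[K:K\cap x^{-1}Kx]$; $\mathcal{H}_\sigma(B,H)$ is defined likewise with $B$ in place of $G$. $B_\sigma$ is the closure of $B$ in $G_\sigma$; when $B$ is a group it is an open subgroup of $G_\sigma$ containing $H_\sigma$. Haar measure is normalised so that $H_\sigma$ has measure $1$, and $p_\sigma=\chi_{H_\sigma}\sigma$ is a projection in $C_c(B_\sigma)$. $\mathcal{H}_\sigma(G,H)$ is identified with $p_\sigma C_c(B_\sigma)p_\sigma$ (the inverse identification is restriction of functions to $B$, extended by $0$ to $G$). With $B^+=\{x\in B\mid xHx^{-1}\supset H\}$ (a semigroup; $\supset$ allows equality), $(B,H)$ is called directed if $B=\{x^{-1}y\mid x,y\in B^+\}$. $C^*(\mathcal{A})$ denotes the enveloping (largest) $C^*$-completion of a $*$-algebra $\mathcal{A}$; the statement includes its existence. *)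

(* Defs.v *)
From HB Require Import structures.
From mathcomp Require Import all_boot all_order all_algebra.
From mathcomp Require Import all_classical all_reals all_analysis.
From mathcomp Require Import finmap complex.

Set Implicit Arguments.
Unset Strict Implicit.
Unset Printing Implicit Defensive.

Import Order.TTheory GRing.Theory Num.Theory.
Import numFieldNormedType.Exports.

Local Open Scope classical_set_scope.
Local Open Scope ring_scope.

(* R[i] as a normed module over itself; the topology is only attached to the
   regular module R[i]^o. *)
Notation cplx R := ((R[i])^o).

Section HeckePairs.
Variable G : groupType.
Implicit Types (H K M S : set G) (x g : G).

Definition is_subgroup H : Prop :=
  [/\ H 1%g, forall x y, H x -> H y -> H (x * y)%g & forall x, H x -> H x^-1%g].

Definition conj_set x H : set G := [set (x * h * x^-1)%g | h in H].
Definition left_coset x H : set G := [set (x * h)%g | h in H].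
Definition double_coset H x : set G := [set (h * x * k)%g | h in H & k in H].

(* S/H; for a subgroup H contained in a subgroup S. *)
Definition left_cosets S H : set (set G) := [set left_coset x H | x in S].

(* [K : M], with value 0 if the index is infinite. *)
Definition subgroup_index K M : nat := #|` fset_set (left_cosets K M)|%fset.

Definition hecke_pair H : Prop :=
  is_subgroup H /\
  forall x, finite_set (left_cosets H (H `&` conj_set x H)).

(* The neighbourhoods of g in the Hecke topology from (G, K): the conjugates
   of K form a subbase at the identity, and the topology is left invariant. *)
Definition hecke_nbhs K g (U : set G) : Prop :=
  exists s : seq G,
    [set y | forall x, x \in s -> conj_set x K (g^-1 * y)%g] `<=` U.

Definition reduced_pair K : Prop :=
  hecke_pair K /\ \bigcap_(x in setT) conj_set x K = [set 1%g].

Definition positive_part H S : set G :=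
  [set x | S x /\ H `<=` conj_set x H].

Definition directed_pair H S : Prop :=
  S = [set (x^-1 * y)%g | x in positive_part H S & y in positive_part H S].

End HeckePairs.

Section HeckeTriples.
Variables (R : realType) (G : groupType).
Implicit Types (H S : set G) (sigma : G -> cplx R).

(* A character of H is represented by a function on G; its values off H are
   irrelevant. *)
Definition finite_unitary_character H sigma : Prop :=
  [/\ forall h, H h -> `|sigma h| = 1,
      forall h k, H h -> H k -> sigma (h * k)%g = sigma h * sigma k
    & finite_set (sigma @` H)].

Definition hecke_triple H sigma : Prop :=
  hecke_pair H /\ finite_unitary_character H sigma.

Definition char_ker H sigma : set G := [set h | H h /\ sigma h = 1].

Definition reduced_hecke_triple H sigma : Prop :=
  hecke_triple H sigma /\ reduced_pair (char_ker H sigma).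

Definition Bset H sigma : set G :=
  [set x | forall h, H h -> conj_set x H h ->
                     sigma h = sigma (x^-1 * h * x)%g].

End HeckeTriples.

(* The data of a *-algebra: its elements form the subset sa_elt of an ambient
   vector space (here, a space of functions).  That sa_elt is closed under the
   operations is the predicate star_closed, and the remaining axioms hold as
   soon as the elements embed in a C*-algebra, which is_cstar_completion
   requires. *)
Record staralg (R : realType) := StarAlg {
  sa_space :> lmodType R[i];
  sa_elt : set sa_space;
  sa_mul : sa_space -> sa_space -> sa_space;
  sa_star : sa_space -> sa_space
}.

Definition star_closed (R : realType) (A : staralg R) : Prop :=
  [/\ sa_elt (0 : A),
      forall (k : R[i]) (a b : A), sa_elt a -> sa_elt b -> sa_elt (k *: a + b),
      forall a b : A, sa_elt a -> sa_elt b -> sa_elt (sa_mul a b)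
    & forall a : A, sa_elt a -> sa_elt (sa_star a)].

(* Not necessarily unital. *)
Record cstarAlg (R : realType) := CStarAlg {
  cs_space :> completeNormedModType R[i];
  cs_mul : cs_space -> cs_space -> cs_space;
  cs_star : cs_space -> cs_space;
  cs_mulA : associative cs_mul;
  cs_mulPl : forall (k : R[i]) a b c,
    cs_mul (k *: a + b) c = k *: cs_mul a c + cs_mul b c;
  cs_mulPr : forall (k : R[i]) a b c,
    cs_mul a (k *: b + c) = k *: cs_mul a b + cs_mul a c;
  cs_starP : forall (k : R[i]) a b,
    cs_star (k *: a + b) = k^* *: cs_star a + cs_star b;
  cs_starK : involutive cs_star;
  cs_starM : forall a b, cs_star (cs_mul a b) = cs_mul (cs_star b) (cs_star a);
  cs_normM : forall a b, `|cs_mul a b| <= `|a| * `|b|;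
  cs_norm_star : forall a, `|cs_mul (cs_star a) a| = `|a| ^+ 2
}.

Record hilbert (R : realType) := Hilbert {
  hs_space :> completeNormedModType R[i];
  hs_dot : {dot hs_space for @Num.conj R[i]};
  hs_norm : forall x, hs_dot x x = `|x| ^+ 2
}.

Section StarAlgebras.
Variable R : realType.
Implicit Types (A : staralg R) (E : cstarAlg R).

Definition cstar_subalgebra E (S : set E) : Prop :=
  closed S /\ star_closed (@StarAlg R E S (@cs_mul R E) (@cs_star R E)).

(* The values of j off the elements of A are irrelevant. *)
Definition star_hom A E (j : A -> E) : Prop :=
  [/\ forall (k : R[i]) (a b : A), sa_elt a -> sa_elt b ->
        j (k *: a + b) = k *: j a + j b,
      forall a b : A, sa_elt a -> sa_elt b ->
        j (sa_mul a b) = cs_mul (j a) (j b)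
    & forall a : A, sa_elt a -> j (sa_star a) = cs_star (j a)].

Definition star_rep A (V : hilbert R) (pi : A -> {linear V -> V}) : Prop :=
  [/\ forall a : A, sa_elt a -> continuous (pi a),
      forall (k : R[i]) (a b : A) (v : V), sa_elt a -> sa_elt b ->
        pi (k *: a + b) v = k *: pi a v + pi b v,
      forall (a b : A) (v : V), sa_elt a -> sa_elt b ->
        pi (sa_mul a b) v = pi a (pi b v)
    & forall (a : A) (v w : V), sa_elt a ->
        hs_dot V (pi a v) w = hs_dot V v (pi (sa_star a) w)].

(* The C*-subalgebra S of E, with j, is the completion of A in the norm
     a |-> sup { ||pi(a)|| : pi a representation of A in the class reps },
   this supremum being finite and a norm on A.  The last two clauses state
   that `|j a| is the least upper bound of the operator norms ||pi(a)||. *)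
Definition is_cstar_completion A
    (reps : forall V : hilbert R, (A -> {linear V -> V}) -> Prop)
    E (S : set E) (j : A -> E) : Prop :=
  [/\ star_closed A /\ cstar_subalgebra S,
      star_hom j /\ (forall a : A, sa_elt a -> j a = 0 -> a = 0),
      S = closure (j @` sa_elt (s := A)),
      forall (V : hilbert R) (pi : A -> {linear V -> V}), reps V pi ->
        forall (a : A) (v : V), sa_elt a -> `|pi a v| <= `|j a| * `|v|
    & forall (a : A) (M : R[i]), sa_elt a -> 0 <= M ->
        (forall (V : hilbert R) (pi : A -> {linear V -> V}), reps V pi ->
          forall v : V, `|pi a v| <= M * `|v|) ->
        `|j a| <= M].

Definition is_enveloping_cstar A E (S : set E) (j : A -> E) : Prop :=
  is_cstar_completion (@star_rep A) S j.

Definition cstar_corner E (p : E) : set E :=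
  [set cs_mul (cs_mul p a) p | a in setT].

End StarAlgebras.

Section HeckeAlgebra.
Variables (R : realType) (G : groupType).
Variables (S H : set G) (sigma : G -> cplx R).
Local Notation K := (char_ker H sigma).

(* For a subgroup S of G containing H, functions on S are represented by their
   extensions by 0 to G. *)
Definition hecke_elt : set (G -> cplx R) :=
  [set f | [/\ forall x, ~ S x -> f x = 0,
               forall h x k, H h -> H k ->
                 f (h * x * k)%g = sigma h * f x * sigma k
             & finite_set [set double_coset H x | x in [set x | f x != 0]]]].

(* The summand depends only on the coset yH; xget 1 c is an element of c. *)
Definition hecke_mul (f g : G -> cplx R) : G -> cplx R := fun x =>
  \sum_(c \in left_cosets S H) (f (xget 1%g c) * g ((xget 1%g c)^-1 * x)%g).

Definition hecke_Delta (x : G) : cplx R :=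
  (subgroup_index K (K `&` conj_set x K))%:R /
    (subgroup_index K (K `&` conj_set x^-1%g K))%:R.

Definition hecke_star (f : G -> cplx R) : G -> cplx R := fun x =>
  hecke_Delta x^-1%g * (f x^-1%g)^*.

Definition hecke_algebra : staralg R :=
  @StarAlg R (G -> cplx R) hecke_elt hecke_mul hecke_star.

End HeckeAlgebra.

HB.mixin Record isTopologicalGroup G of Group G & Topological G := {
  mulg_continuous : continuous (fun x : G * G => (x.1 * x.2)%g);
  invg_continuous : continuous (fun x : G => x^-1%g)
}.

HB.structure Definition TopologicalGroup :=
  {G of Group G & Topological G & isTopologicalGroup G}.

Notation topGroupType := TopologicalGroup.type.

(* Completeness for the two-sided uniformity. *)
Definition group_complete (L : topGroupType) : Prop :=
  forall F : set_system L, ProperFilter F ->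
    (forall U, nbhs (1%g : L) U ->
       exists2 A, F A & forall x y, A x -> A y ->
         U (x^-1 * y)%g /\ U (x * y^-1)%g) ->
    exists l : L, F --> l.

(* e : G -> L is the completion of G in the Hecke topology from the reduced
   pair (G, K), so that (L, closure (e @` K)) is the Schlichting completion. *)
Definition is_schlichting_completion (G : groupType) (K : set G)
    (L : topGroupType) (e : G -> L) : Prop :=
  [/\ forall x y, e (x * y)%g = (e x * e y)%g,
      injective e,
      forall g (U : set G), hecke_nbhs K g U <->
        exists2 V : set L, nbhs (e g) V & e @^-1` V `<=` U,
      dense (range e)
    & hausdorff_space L /\ group_complete L].

Section GroupAlgebra.
Variables (R : realType) (L : topGroupType).
(* S is an open (hence closed) subgroup of L; C_c(S) is represented by the
   extensions by 0 to L of its elements. *)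
Variable S : set L.
Implicit Types (f g : L -> cplx R) (I : (L -> cplx R) -> cplx R).

Definition Cc : set (L -> cplx R) :=
  [set f | [/\ continuous f, compact (closure [set x | f x != 0])
             & forall x, ~ S x -> f x = 0]].

(* A Haar measure on S, as a left invariant positive linear functional on
   C_c(S) (nonzero by the normalisation imposed where it is used). *)
Definition is_haar I : Prop :=
  [/\ forall (k : R[i]) f g, Cc f -> Cc g -> I (k *: f + g) = k * I f + I g,
      forall f, Cc f -> (forall x, 0 <= f x) -> 0 <= I f
    & forall s f, S s -> Cc f -> I (fun x => f (s * x)%g) = I f].

(* mu (E y) = Delta y * mu E, equivalently
   Delta y * \int f (x y) dx = \int f (x) dx. *)
Definition is_modular_function I (Delta : L -> cplx R) : Prop :=
  forall y, S y -> 0 < Delta y /\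
    forall f, Cc f -> Delta y * I (fun x => f (x * y)%g) = I f.

Definition conv I f g : L -> cplx R := fun x =>
  I (fun y => f y * g (y^-1 * x)%g).

Definition conv_star (Delta : L -> cplx R) f : L -> cplx R := fun x =>
  Delta x^-1%g * (f x^-1%g)^*.

Definition conv_algebra I Delta : staralg R :=
  @StarAlg R (L -> cplx R) Cc (conv I) (conv_star Delta).

Definition L1_rep I Delta (V : hilbert R)
    (pi : conv_algebra I Delta -> {linear V -> V}) : Prop :=
  star_rep pi /\
  forall f (v : V), Cc f -> `|pi f v| <= I (fun x => `|f x|) * `|v|.

(* E, with u : C_c(S) -> E, is the group C*-algebra C*(S): the completion of
   C_c(S) in the supremum of its L^1-norm decreasing *-representations. *)
Definition is_group_cstar I Delta (E : cstarAlg R)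
    (u : conv_algebra I Delta -> E) : Prop :=
  is_cstar_completion (@L1_rep I Delta) setT u.

End GroupAlgebra.

Section Projection.
Variables (R : realType) (G : groupType) (L : topGroupType) (e : G -> L).
Variables (H : set G) (sigma : G -> cplx R).

Definition is_character_extension (sigma' : L -> cplx R) : Prop :=
  {within closure (e @` H), continuous sigma'} /\
  forall h, H h -> sigma' (e h) = sigma h.

Definition proj_fun (sigma' : L -> cplx R) : L -> cplx R := fun x =>
  (\1_(closure (e @` H)) x : R[i]) * sigma' x.

(* C*(A) = u(p) E u(p) for an algebra A of functions on G supported in B,
   compatibly with the identification of A with p C_c(closure (e @` B)) p
   given by restriction to B. *)
Definition envelope_is_corner (B : set G) (I : (L -> cplx R) -> cplx R)
    (p : L -> cplx R) (S' : set G) (E : cstarAlg R) (u : (L -> cplx R) -> E) :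
    Prop :=
  exists j : (G -> cplx R) -> E,
    (forall f, hecke_elt S' H sigma f ->
       exists F, [/\ Cc (closure (e @` B)) F,
         forall x, f x = (\1_B x : R[i]) * conv I (conv I p F) p (e x)
       & j f = u (conv I (conv I p F) p)]) /\
    is_enveloping_cstar (A := hecke_algebra S' H sigma)
      (cstar_corner (u p)) j.

End Projection.

(* Main.v *)
(* Write p for p_sigma.  The inequality to prove is that every *-representation
   rho of the Hecke algebra is bounded by the norm of C*(B_sigma); it follows by
   inducing rho.  Let D be the space of F in C_c(B_sigma) with
   F(xk) = F(x) sigma(k) for k in H_sigma.  For F, F' in D the function F'^* * F
   lies in p C_c(B_sigma) p, and <F, F'> := <rho(F'^* * F) v, v> is a form on D
   on which C_c(B_sigma) acts by convolution.  It is positive by directedness: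
   F lives on finitely many cosets x_i H_sigma, there is y in B^+ with all
   y x_i in B^+, and then the left translate L_y F lies in p C_c(B_sigma) p, so
   F^* * F = (L_y F)^* * (L_y F) is of the form g^* * g with g in the Hecke
   algebra.

   C*-completions are closures of spaces of bounded functions (the matrix
   coefficients of all representations) in the sup norm.  As compact open
   subgroups form a basis of neighbourhoods, functions in C_c are finite sums of
   disjointly supported functions living on single small cosets, which replaces
   Fubini's theorem for convolutions. *)
Require Import Defs.
From HB Require Import structures.
From mathcomp Require Import all_boot all_order all_algebra.
From mathcomp Require Import all_classical all_reals all_analysis.
From mathcomp Require Import complex.
From mathcomp Require Import ring lra.
Import Order.TTheory GRing.Theory Num.Theory.
Import numFieldNormedType.Exports.
Local Open Scope classical_set_scope.
Local Open Scope ring_scope.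
Set Implicit Arguments.
Unset Strict Implicit.
Unset Printing Implicit Defensive.

Local Open Scope complex_scope.

(** * Completions for suprema of functionals *)

(** The bound on [rho] does two jobs: a representation of the Hecke algebra comes with no norm
    estimate, so it is this bound that makes the enveloping norm finite. The opposite inequality is
    restriction of representations of [C_c(B_sigma)] to [p C_c p]. Induction is done for one vector
    [v] at a time, so that the form is scalar valued and no tensor product is formed; the class of
    [p] takes the place of [v], since [F * p = F] and [<F, F> = ||rho(F) v||^2] for [F] in
    [p C_c p]. The translate [L_y F] is left equivariant because [w = y x_i] in [B^+] conjugates [H]
    into itself by [w^-1 H w], and [w] in [B] makes this conjugation preserve [sigma]: on [w H],
    left multiplication by [H] becomes right multiplication. The cases [G] and [B] are handled at
    once by a set [S'] containing [B], because an equivariant function vanishes off [B]. In place of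
    operator-valued integrals, a function living on one coset [yU] acts on a left [U]-invariant [F]
    as a scalar times [L_y]; this yields the [L^1] bound on representations and the associativity of
    convolution. *)

Section RealNorm.
Variables (R : realType) (V : normedModType R[i]).
Implicit Types (x y : V) (k : R[i]).

(** Norms over [R[i]] take values in the partially ordered [R[i]]; passing to [R] makes suprema and
    real arithmetic available. *)
Definition rnorm x : R := complex.Re `|x|.

Lemma rnormE x : (rnorm x)%:C = `|x|.
Proof. by apply: RRe_real; rewrite normr_real. Qed.

Lemma rnorm_ge0 x : 0 <= rnorm x.
Proof. by rewrite -ler0c rnormE normr_ge0. Qed.

Lemma rnorm0 : rnorm 0 = 0.
Proof. by apply: complexI; rewrite rnormE normr0. Qed.

Lemma rnorm0_eq0 x : rnorm x = 0 -> x = 0.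
Proof. by move=> x0; apply/eqP; rewrite -normr_eq0 -rnormE x0. Qed.

Lemma rnormD x y : rnorm (x + y) <= rnorm x + rnorm y.
Proof. by rewrite -lecR rmorphD /= !rnormE ler_normD. Qed.

Lemma rnormN x : rnorm (- x) = rnorm x.
Proof. by apply: complexI; rewrite !rnormE normrN. Qed.

Lemma rnormBC x y : rnorm (x - y) = rnorm (y - x).
Proof. by rewrite -opprB rnormN. Qed.

Lemma rnormB x y z : rnorm (x - z) <= rnorm (x - y) + rnorm (y - z).
Proof. by rewrite -(subrKA y); exact: rnormD. Qed.

Lemma rnorm_le_eq0 x : (forall e : R, 0 < e -> rnorm x <= e) -> x = 0.
Proof.
move=> xe; apply: rnorm0_eq0; apply/eqP; rewrite eq_le rnorm_ge0 andbT.
by apply/ler_addgt0Pl => e e0; rewrite addr0 xe.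
Qed.

End RealNorm.

Section RealNormComplex.
Variable (R : realType).

Lemma rnormZ (V : normedModType R[i]) (k : R[i]) (x : V) :
  rnorm (k *: x) = rnorm (k : cplx R) * rnorm x.
Proof. by apply: complexI; rewrite rmorphM /= !rnormE normrZ. Qed.

Lemma rnormM (x y : cplx R) : rnorm (x * y : cplx R) = rnorm x * rnorm y.
Proof. by apply: complexI; rewrite rmorphM /= !rnormE normrM. Qed.

Lemma rnorm_conj (x : cplx R) : rnorm (x^* : cplx R) = rnorm x.
Proof. by apply: complexI; rewrite !rnormE normcJ. Qed.

Lemma rnorm_real (x : R) : 0 <= x -> rnorm (x%:C : cplx R) = x.
Proof. by move=> x0; apply: complexI; rewrite rnormE ger0_norm // ler0c. Qed.

Lemma Re_le_rnorm (x : cplx R) : `|complex.Re x| <= rnorm x.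
Proof. by rewrite -lecR rnormE normc_ge_Re. Qed.

Lemma Im_le_rnorm (x : cplx R) : `|complex.Im x| <= rnorm x.
Proof.
(* Multiplication by [-i] is isometric and turns the imaginary part into the real part. *)
have <- : complex.Re (- 'i%C * x) = complex.Im x.
  by case: x => a b /=; rewrite !(mul0r, mulN1r, oppr0, opprK, sub0r, add0r).
apply: le_trans (Re_le_rnorm _) _.
by rewrite -lecR !rnormE normrM normrN normc_def /= expr0n expr1n add0r sqrtr1 mul1r.
Qed.

Lemma rnorm_ReIm (x : cplx R) : rnorm x <= `|complex.Re x| + `|complex.Im x|.
Proof.
rewrite -lecR rnormE {1}[x]complexE rmorphD /=; apply: le_trans (ler_normD _ _) _.
have i1 : `|'i%C : R[i]| = 1.
  by rewrite normc_def /= expr0n expr1n add0r sqrtr1.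
by rewrite normrM i1 mul1r !normc_def /= expr0n /= !addr0 !sqrtr_sqr.
Qed.

End RealNormComplex.

(** A vector space of bounded functions as a single parameter, on which the type of its uniform
    closure and the instances of that type depend. *)
Record bddsub (R : realType) (T : Type) := Bddsub {
  bs_set :> (T -> cplx R) -> Prop;
  bs0 : bs_set 0;
  bsP : forall (k : R[i]) a b, bs_set a -> bs_set b -> bs_set (k *: a + b);
  bsb : forall a, bs_set a -> exists M : R, forall t, rnorm (a t) <= M
}.

Section UniformClosure.
Variables (R : realType) (T : Type) (D : bddsub R T).

Definition unif_closure : {pred T -> cplx R} := fun phi =>
  `[< forall e : R, 0 < e ->
      exists2 d, D d & forall t, rnorm (phi t - d t) <= e >].

Lemma ucl_submod : submod_closed unif_closure.
Proof.
split=> [|k a b /asboolP ha /asboolP hb].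
  by apply/asboolP => e e0; exists 0; [exact: bs0 | move=> t; rewrite subrr rnorm0 ltW].
apply/asboolP => e e0.
have k0 : 0 < rnorm (k : cplx R) + 1 by rewrite ltr_wpDl // rnorm_ge0.
have [|d Dd hd] := ha (e / 2 / (rnorm (k : cplx R) + 1)).
  by rewrite !divr_gt0.
have [|d' Dd' hd'] := hb (e / 2); first by rewrite divr_gt0.
exists (k *: d + d'); first exact: bsP.
move=> t; rewrite !fctE.
have -> : (k *: a t + b t) - (k *: d t + d' t) = k *: (a t - d t) + (b t - d' t).
  by rewrite scalerBr opprD addrACA.
apply: le_trans (rnormD _ _) _; rewrite [leRHS](splitr e) lerD // rnormZ.
have := hd t; rewrite ler_pdivlMr // mulrDr mulr1.
have := rnorm_ge0 (a t - d t); have := rnorm_ge0 (k : cplx R); nra.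
Qed.

HB.instance Definition _ := GRing.isSubmodClosed.Build R[i] (T -> cplx R) unif_closure ucl_submod.

Record unif_closure_type := UclType { ucl_val : T -> cplx R; _ : ucl_val \in unif_closure }.

HB.instance Definition _ := [isSub for ucl_val].
HB.instance Definition _ := gen_eqMixin unif_closure_type.
HB.instance Definition _ := gen_choiceMixin unif_closure_type.
HB.instance Definition _ := [SubChoice_isSubLmodule of unif_closure_type by <:].

End UniformClosure.

Section UclNorm.
Variables (R : realType) (T : Type) (D : bddsub R T).
Local Notation Y := (unif_closure_type D).
Implicit Types (y : Y).

Lemma ucl_bounded y : exists M : R, forall t, rnorm (val y t) <= M.
Proof.
case: y => f /= /asboolP /(_ _ ltr01)[d Dd fd].
have [M dM] := bsb Dd; exists (1 + M) => t.
by rewrite -[f t](subrK (d t)); apply: le_trans (rnormD _ _) _; rewrite lerD.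
Qed.

(** For empty [T] the supremum is that of the empty set, for which [sup] returns 0, as it should;
    the next lemmas treat this case apart. *)
Definition ucl_rnorm y : R := sup [set rnorm (val y t) | t in setT].

Lemma ucl_rnorm_ub y t : rnorm (val y t) <= ucl_rnorm y.
Proof.
apply: sup_upper_bound; last by exists t.
split; first by exists (rnorm (val y t)); exists t.
by have [M yM] := ucl_bounded y; exists M => _ [s _ <-].
Qed.

Lemma ucl_rnorm_le y (M : R) :
  0 <= M -> (forall t, rnorm (val y t) <= M) -> ucl_rnorm y <= M.
Proof.
move=> M0 yM; rewrite /ucl_rnorm.
have [->|/set0P ne] := eqVneq [set rnorm (val y t) | t in setT] set0.
  by rewrite sup0.
by apply: ge_sup => // _ [t _ <-].
Qed.

Lemma ucl_rnorm_ge0 y : 0 <= ucl_rnorm y.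
Proof.
rewrite /ucl_rnorm.
have [->|/set0P[r [t _ _]]] := eqVneq [set rnorm (val y t) | t in setT] set0.
  by rewrite sup0.
exact: le_trans (rnorm_ge0 _) (ucl_rnorm_ub y t).
Qed.

Definition ucl_norm y : R[i] := (ucl_rnorm y)%:C.

Lemma ucl_normD y y' : ucl_norm (y + y') <= ucl_norm y + ucl_norm y'.
Proof.
rewrite /ucl_norm -rmorphD lecR; apply: ucl_rnorm_le => [|t].
  by rewrite addr_ge0 // ucl_rnorm_ge0.
by apply: le_trans (rnormD _ _) _; rewrite lerD // ucl_rnorm_ub.
Qed.

Lemma ucl_rnormZ (k : R[i]) y : ucl_rnorm (k *: y) <= rnorm (k : cplx R) * ucl_rnorm y.
Proof.
apply: ucl_rnorm_le => [|t]; first by rewrite mulr_ge0 ?rnorm_ge0 ?ucl_rnorm_ge0.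
rewrite -[val (k *: y) t]/(k *: (val y t)) rnormZ ler_wpM2l ?rnorm_ge0 //.
exact: ucl_rnorm_ub.
Qed.

Lemma ucl_normZ (k : R[i]) y : ucl_norm (k *: y) = `|k| * ucl_norm y.
Proof.
rewrite /ucl_norm -[`|k|](rnormE (k : cplx R)) -rmorphM; congr (_ %:C).
apply/eqP; rewrite eq_le ucl_rnormZ /=.
have [->|k0] := eqVneq k 0; first by rewrite rnorm0 mul0r ucl_rnorm_ge0.
have kp : 0 < rnorm (k : cplx R).
  by rewrite lt_neqAle rnorm_ge0 andbT; apply: contraNN k0 => /eqP/esym/rnorm0_eq0 ->.
rewrite mulrC -ler_pdivlMr // mulrC.
(* The reverse inequality is the one already known, applied to [k^-1] and [k *: y]. *)
have := ucl_rnormZ k^-1 (k *: y); rewrite scalerA mulVf // scale1r.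
suff -> : rnorm (k^-1 : cplx R) = (rnorm (k : cplx R))^-1 by [].
by apply: (mulfI (lt0r_neq0 kp)); rewrite divff ?lt0r_neq0 // -rnormM divff //
  (rnorm_real (x := 1)).
Qed.

Lemma ucl_norm0_eq0 y : ucl_norm y = 0 -> y = 0.
Proof.
move=> /complexI y0; apply/val_inj/funext => t; apply: rnorm0_eq0.
by apply/eqP; rewrite eq_le rnorm_ge0 andbT -y0 ucl_rnorm_ub.
Qed.

HB.instance Definition _ := Lmodule_isNormed.Build R[i] (unif_closure_type D)
  ucl_normD ucl_normZ ucl_norm0_eq0.

Lemma rnorm_ucl y : rnorm y = ucl_rnorm y.
Proof. by []. Qed.

(** The value at [t] is read through a real 1-Lipschitz function, in practice the real or the
    imaginary part, so that completeness of [R] applies. *)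
Lemma cauchy_eval (F : set_system Y) (FF : ProperFilter F) (t : T) (g : cplx R -> R) :
  (forall z z' : cplx R, `|g z - g z'| <= rnorm (z - z')) -> cauchy F ->
  exists l : R, forall e : R, 0 < e -> F [set y | `|l - g (val y t)| <= e].
Proof.
move=> gL /cauchy_ballP Fc.
have : cauchy ((fun y : Y => g (val y t)) @ F).
  apply/cauchy_ballP => e e0; have := Fc (e%:C); rewrite ltcR => /(_ e0).
  case=> -[A B] [/= FA FB] AB; exists ([set g (val y t) | y in A], [set g (val y t) | y in B]).
    split => /=; first by apply: filterS FA => y Ay; exists y.
    by apply: filterS FB => y By; exists y.
  move=> [_ _] [/= [y Ay <-] [y' By' <-]].
  have : `|y - y'| < _ := AB (y, y') (conj Ay By'); rewrite -rnormE ltcR => yy'.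
  apply: le_lt_trans yy'; apply: le_trans (gL _ _) _.
  by rewrite rnorm_ucl; exact: (ucl_rnorm_ub (y - y')).
move=> /(@R_complete R _ _)/cvg_ex[l Fl]; exists l => e e0.
by move/cvgrPdist_le : Fl => /(_ e e0).
Qed.

(** Pointwise limits exist by [cauchy_eval]; the Cauchy property makes the convergence uniform,
    because the comparison element [y'] may depend on [t] while the bound for [y] does not. A
    uniform limit of uniform limits from [D] is again one. *)
Lemma ucl_complete (F : set_system Y) : ProperFilter F -> cauchy F -> cvg F.
Proof.
move=> FF Fc.
have [f hf] : exists f : T -> cplx R, forall t (e : R), 0 < e ->
    F [set y | rnorm (f t - val y t) <= e].
  suff /choice[f hf] : forall t, exists z : cplx R, forall e : R, 0 < e ->
      F [set y | rnorm (z - val y t) <= e] by exists f.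
  move=> t.
  have [|a ha] := @cauchy_eval F FF t (@complex.Re R) _ Fc.
    by move=> x y; rewrite -raddfB; exact: Re_le_rnorm.
  have [|b hb] := @cauchy_eval F FF t (@complex.Im R) _ Fc.
    by move=> x y; rewrite -raddfB; exact: Im_le_rnorm.
  exists (a +i* b) => e e0; have e20 : 0 < e / 2 by rewrite divr_gt0.
  apply: filterS2 (ha _ e20) (hb _ e20) => y /= ya yb.
  apply: le_trans (rnorm_ReIm _) _; rewrite [leRHS](splitr e) lerD //.
    by case: (val y t) ya => ? ?.
  by case: (val y t) yb => ? ?.
have Fe (e : R) : 0 < e -> F [set y | forall t, rnorm (f t - val y t) <= e].
  move=> e0; have e20 : 0 < e / 2 by rewrite divr_gt0.
  move/cauchy_ballP : Fc => /(_ (e / 2)%:C); rewrite ltcR => /(_ e20).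
  case=> -[A B] [/= FA FB] AB; apply: filterS FA => y Ay t.
  have [y' [By' hy']] := filter_ex (filterI FB (hf t _ e20)).
  apply: le_trans (rnormB _ (val y' t) _) _; rewrite [leRHS](splitr e) lerD //.
  have : `|y - y'| < _ := AB (y, y') (conj Ay By'); rewrite -rnormE ltcR => yy'.
  rewrite rnormBC; apply: le_trans (ltW yy').
  by rewrite rnorm_ucl; exact: (ucl_rnorm_ub (y - y')).
have fD : f \in unif_closure D.
  apply/asboolP => e e0; have e20 : 0 < e / 2 by rewrite divr_gt0.
  have [[g gD] /= hg] := filter_ex (Fe _ e20).
  move/asboolP: (gD) => /(_ _ e20)[d Dd gd]; exists d => // t.
  by apply: le_trans (rnormB _ (g t) _) _; rewrite [leRHS](splitr e) lerD.
apply/cvg_ex; exists (UclType fD : Y); apply/cvgrPdist_le => e e0.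
have eE : e = (complex.Re e)%:C by rewrite RRe_real // gtr0_real.
rewrite eE in e0 *; rewrite ltcR in e0.
apply: filterS (Fe _ e0) => y hy.
rewrite -[`|_|]rnormE lecR rnorm_ucl; apply: ucl_rnorm_le; first exact: ltW.
exact: hy.
Qed.

HB.instance Definition _ := Uniform_isComplete.Build (unif_closure_type D) ucl_complete.

End UclNorm.

Section Completion.
Variables (R : realType) (T : Type) (X : lmodType R[i]) (D : set X).
Variable ev : X -> T -> cplx R.
Hypothesis D0 : D 0.
Hypothesis DP : forall (k : R[i]) a b, D a -> D b -> D (k *: a + b).
Hypothesis evP : forall (k : R[i]) a b t, D a -> D b ->
  ev (k *: a + b) t = k * ev a t + ev b t.
Hypothesis evb : forall a, D a -> exists M : R, forall t, rnorm (ev a t) <= M.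

(** Representing [x] by the function [ev x] avoids a quotient by null vectors: two elements with the
    same values have the same image. The last two clauses say that the norm of [j x] is the supremum
    of the values of [ev x]. *)
Lemma uniform_completion :
  exists (Y : completeNormedModType R[i]) (j : X -> Y),
  [/\ forall (k : R[i]) a b, D a -> D b -> j (k *: a + b) = k *: j a + j b,
      forall y (e : R), 0 < e -> exists2 x, D x & rnorm (y - j x) <= e,
      forall x t, D x -> rnorm (ev x t) <= rnorm (j x)
    & forall x (M : R), D x -> 0 <= M -> (forall t, rnorm (ev x t) <= M) ->
      rnorm (j x) <= M].
Proof.
have ev0 : ev 0 = 0.
  apply/funext => t; have := evP 1 t D0 D0.
  by rewrite scaler0 add0r mul1r => /(congr1 (fun z => z - ev 0 t)); rewrite subrr addrK.
have S0 : (ev @` D) 0 by exists 0.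
have SP (k : R[i]) a b : (ev @` D) a -> (ev @` D) b -> (ev @` D) (k *: a + b).
  move=> [a' Da <-] [b' Db <-]; exists (k *: a' + b'); first exact: DP.
  by apply/funext => t; rewrite evP.
have Sb a : (ev @` D) a -> exists M : R, forall t, rnorm (a t) <= M.
  by move=> [a' Da <-]; exact: evb.
pose S : bddsub R T := Bddsub S0 SP Sb.
have evS x : D x -> ev x \in unif_closure S.
  move=> Dx; apply/asboolP => e e0; exists (ev x); first by exists x.
  by move=> t; rewrite subrr rnorm0 ltW.
pose j x : unif_closure_type S := match pselect (D x) with left h => UclType (evS x h) | right _ => 0 end.
have jE x : D x -> val (j x) = ev x by rewrite /j; case: pselect.
exists (unif_closure_type S : completeNormedModType R[i]), j; split.
- move=> k a b Da Db; apply: val_inj; rewrite jE; last exact: DP.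
  apply/funext => t; rewrite evP //.
  by rewrite -[RHS]/(k * val (j a) t + val (j b) t) !jE.
- move=> [y yS] e e0; move/asboolP: (yS) => /(_ e e0)[_ [x Dx <-] yx].
  exists x => //; rewrite rnorm_ucl; apply: ucl_rnorm_le; first exact: ltW.
  by move=> t; rewrite -[val (_ - j x) t]/(y t - val (j x) t) jE.
- by move=> x t Dx; rewrite rnorm_ucl -(jE x Dx); exact: ucl_rnorm_ub.
- move=> x M Dx M0 xM; rewrite rnorm_ucl; apply: ucl_rnorm_le => // t.
  by rewrite jE.
Qed.
End Completion.

(** * Extension of Lipschitz maps and of identities from a dense image *)

Section DenseExtension.
Variables (R : realType) (X : Type) (D : set X) (Y : normedModType R[i]).
Variable j : X -> Y.
Hypothesis dense_j : forall y (e : R), 0 < e -> exists2 x, D x & rnorm (y - j x) <= e.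

(** The map [f] is defined on [X], not on the image of [j]; the Lipschitz bound forces it to factor
    through [j]. The value at [y] is the limit of the filter generated by the values of [f] at the
    points whose images are close to [y], and it is characterised by having a common approximant
    with [y] at every precision. *)
Lemma dense_extension (Z : completeNormedModType R[i]) (f : X -> Z) (C : R) :
  0 <= C ->
  (forall x x', D x -> D x' -> rnorm (f x - f x') <= C * rnorm (j x - j x')) ->
  exists g : Y -> Z, (forall x, D x -> g (j x) = f x) /\
    forall y y', rnorm (g y - g y') <= C * rnorm (y - y').
Proof.
move=> C0 fC.
have /choice[g hg] : forall y, exists z : Z, forall e : R, 0 < e ->
    exists x, [/\ D x, rnorm (y - j x) <= e & rnorm (z - f x) <= e].
  move=> y.
  pose B (e : R) := [set f x | x in [set x | D x /\ rnorm (y - j x) <= e]].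
  have Bex e : 0 < e -> B e !=set0.
    by move=> e0; have [x Dx yx] := dense_j y e0; exists (f x); exists x.
  pose F := filter_from [set e : R | 0 < e] B.
  have FF : ProperFilter F.
    apply: filter_from_proper; last by move=> e; exact: Bex.
    apply: filter_from_filter; first by exists 1; rewrite /= ltr01.
    move=> e e' /= e0 e'0; exists (Num.min e e'); first by rewrite /= lt_min e0.
    by move=> _ [x [Dx]] + <-; rewrite le_min => /andP[h h']; split; exists x.
  have : cauchy F.
    apply/cauchyP => e e0.
    have eE : e = (complex.Re e)%:C by rewrite RRe_real // gtr0_real.
    rewrite eE ltcR in e0; set e' := complex.Re e in eE e0.
    (* Two approximants of [y] at this distance have values at most [2 C e' / (3 (C + 1)) < e']
       apart; the [+ 1] covers [C = 0]. *)
    have d0 : 0 < e' / 3 / (C + 1) by rewrite !divr_gt0 // ltr_wpDl.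
    have [x Dx yx] := dense_j y d0.
    exists (f x); exists (e' / 3 / (C + 1)) => //= _ [x' [Dx' yx'] <-].
    rewrite -ball_normE /ball_ /= -rnormE eE ltcR.
    apply: le_lt_trans (fC _ _ Dx Dx') _.
    have : rnorm (j x - j x') <= rnorm (j x - y) + rnorm (y - j x') := rnormB _ _ _.
    rewrite [rnorm (j x - y)]rnormBC.
    move: yx yx'; rewrite !ler_pdivlMr ?ltr_wpDl //.
    have := rnorm_ge0 (j x - j x').
    move: (rnorm (j x - j x')) (rnorm (y - j x)) (rnorm (y - j x')) => p q r; nra.
  move=> /cauchy_cvg/cvg_ex[z Fz]; exists z => e e0.
  have /Fz [d d0 dB] : nbhs z [set w | rnorm (z - w) <= e].
    apply: (@filterS _ _ _ (ball z e%:C)); last by apply: nbhsx_ballx; rewrite ltcR.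
    by move=> w; rewrite -ball_normE /ball_ /= -rnormE ltcR => /ltW.
  have m0 : 0 < Num.min d e by rewrite lt_min; apply/andP.
  have [x Dx yx] := dense_j y m0; exists x; move: yx; rewrite le_min => /andP[xd xe].
  by split => //; apply: dB; exists x.
exists g; split=> [x Dx|y y'].
  apply/eqP; rewrite -subr_eq0; apply/eqP/rnorm_le_eq0 => e e0.
  have d0 : 0 < e / (C + 1) by rewrite !divr_gt0 // ltr_wpDl.
  have [x' [Dx' xx' gx']] := hg (j x) _ d0.
  apply: le_trans (rnormB _ (f x') _) _.
  have := fC _ _ Dx' Dx; rewrite [rnorm (j x' - _)]rnormBC.
  move: xx' gx'; rewrite !ler_pdivlMr ?ltr_wpDl //.
  have := rnorm_ge0 (j x - j x'); have := rnorm_ge0 (g (j x) - f x').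
  move: (rnorm (j x - j x')) (rnorm (g _ - _)) (rnorm (f x' - f x)) => p q r; nra.
apply/ler_addgt0Pl => e e0.
have d0 : 0 < e / (2 * (C + 1)) by rewrite !divr_gt0 // mulr_gt0 // ltr_wpDl.
have [x [Dx yx gx]] := hg y _ d0; have [x' [Dx' yx' gx']] := hg y' _ d0.
have := fC _ _ Dx Dx'.
have := rnormB (j x) y (j x'); have := rnormB y y' (j x').
have := rnormB (g y) (f x) (g y'); have := rnormB (f x) (f x') (g y').
move: yx gx yx' gx'; rewrite [rnorm (j x - y)]rnormBC [rnorm (f x' - g y')]rnormBC.
rewrite !ler_pdivlMr ?mulr_gt0 ?ltr_wpDl //.
have := rnorm_ge0 (j x - j x').
move: (rnorm (j x - j x')) (rnorm (y - j x)) (rnorm (g y - f x)) (rnorm (y' - j x')) (rnorm (g y' - f x')) (rnorm (f x - g y')) (rnorm (f x - f x')) (rnorm (g y - g y')) (rnorm (y - j x')) (rnorm (y - y')).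
move=> p a b c d f1 f2 g1 f3 g2; nra.
Qed.
End DenseExtension.

Section Lipschitz.
Variables (R : realType).

(** The form of continuity in which identities are moved from a dense image to a completion, one
    variable at a time, by [dense_eq]; the closure lemmas below make the side conditions
    mechanical. *)
Definition lipschitz_map (Y Z : normedModType R[i]) (f : Y -> Z) : Prop :=
  exists2 C : R, 0 <= C & forall y y', rnorm (f y - f y') <= C * rnorm (y - y').

Lemma lip_id (Y : normedModType R[i]) : lipschitz_map (fun y : Y => y).
Proof. by exists 1 => // y y'; rewrite mul1r. Qed.

Lemma lip_cst (Y Z : normedModType R[i]) (z : Z) : lipschitz_map (fun _ : Y => z).
Proof. by exists 0 => // y y'; rewrite subrr rnorm0 mul0r. Qed.

Lemma lip_comp (X Y Z : normedModType R[i]) (f : Y -> Z) (g : X -> Y) :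
  lipschitz_map f -> lipschitz_map g -> lipschitz_map (fun x => f (g x)).
Proof.
move=> [C C0 fC] [C' C'0 gC]; exists (C * C'); first exact: mulr_ge0.
by move=> y y'; apply: le_trans (fC _ _) _; rewrite -mulrA ler_wpM2l.
Qed.

Lemma lipD (Y Z : normedModType R[i]) (f g : Y -> Z) :
  lipschitz_map f -> lipschitz_map g -> lipschitz_map (fun y => f y + g y).
Proof.
move=> [C C0 fC] [C' C'0 gC]; exists (C + C'); first exact: addr_ge0.
move=> y y'; rewrite opprD addrACA mulrDl.
by apply: le_trans (rnormD _ _) _; rewrite lerD.
Qed.

Lemma lipZ (Y Z : normedModType R[i]) (k : R[i]) (f : Y -> Z) :
  lipschitz_map f -> lipschitz_map (fun y => k *: f y).
Proof.
move=> [C C0 fC]; exists (rnorm (k : cplx R) * C).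
  by rewrite mulr_ge0 // rnorm_ge0.
by move=> y y'; rewrite -scalerBr rnormZ -mulrA ler_wpM2l // rnorm_ge0.
Qed.

Lemma nbhs_rnorm (Y : normedModType R[i]) (y : Y) (B : set Y) : nbhs y B ->
  exists2 e : R, 0 < e & forall z, rnorm (y - z) <= e -> B z.
Proof.
move=> /nbhs_ballP[e /= e0 eB].
have eE : e = (complex.Re e)%:C by rewrite RRe_real // gtr0_real.
rewrite eE ltcR in e0; exists (complex.Re e / 2); first by rewrite divr_gt0.
move=> z yz; apply: eB; rewrite -ball_normE /ball_ /= -rnormE eE ltcR.
by apply: le_lt_trans yz _; rewrite ltr_pdivrMr // ltr_pMr // ltr1n.
Qed.

Lemma lip_continuous (Y Z : normedModType R[i]) (f : Y -> Z) :
  lipschitz_map f -> continuous f.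
Proof.
move=> [C C0 fC] y; apply/cvgrPdist_le => e e0.
have eE : e = (complex.Re e)%:C by rewrite RRe_real // gtr0_real.
rewrite eE ltcR in e0; have C1 : 0 < C + 1 by rewrite ltr_wpDl.
have d0 : 0 < (complex.Re e / (C + 1))%:C by rewrite ltcR divr_gt0.
near=> y'.
rewrite eE -rnormE lecR; apply: le_trans (fC _ _) _.
have : `|y - y'| <= (complex.Re e / (C + 1))%:C by near: y'; exact: cvgr_dist_le.
rewrite -rnormE lecR ler_pdivlMr //.
have := rnorm_ge0 (y - y'); nra.
Unshelve. all: by end_near. Qed.

Lemma dense_eq (X : Type) (D : set X) (Y Z : normedModType R[i]) (j : X -> Y)
    (f g : Y -> Z) :
  (forall y (e : R), 0 < e -> exists2 x, D x & rnorm (y - j x) <= e) ->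
  lipschitz_map f -> lipschitz_map g ->
  (forall x, D x -> f (j x) = g (j x)) -> forall y, f y = g y.
Proof.
move=> dj [C C0 fC] [C' C'0 gC] fg y; apply/eqP; rewrite -subr_eq0; apply/eqP.
apply: rnorm_le_eq0 => e e0.
have C1 : 0 < C + C' + 1 by rewrite ltr_wpDl // addr_ge0.
have [x Dx] := dj y (e / (C + C' + 1)) (divr_gt0 e0 C1).
rewrite ler_pdivlMr // => yx.
apply: le_trans (rnormB _ (f (j x)) _) _; rewrite {2}fg //.
apply: le_trans (lerD (fC _ _) (gC _ _)) _; rewrite [rnorm (j x - y)]rnormBC.
have := rnorm_ge0 (y - j x); nra.
Qed.

End Lipschitz.

Section BilinearExtension.
Variables (R : realType) (X X' : Type) (D : set X) (D' : set X').
Variables (Y Y' : normedModType R[i]) (j : X -> Y) (j' : X' -> Y').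
Hypothesis jd : forall y (e : R), 0 < e -> exists2 x, D x & rnorm (y - j x) <= e.
Hypothesis jd' : forall y (e : R), 0 < e -> exists2 x, D' x & rnorm (y - j' x) <= e.

(** For fixed [a] in [D] the second variable is extended, giving [L a]; then [L a y] is shown to be
    Lipschitz in [j a] with constant [||y||], and the first variable is extended. Only Lipschitz
    bounds are asked for, so products and sesquilinear forms are both covered. *)
Lemma bilinear_extension (Z : completeNormedModType R[i]) (f : X -> X' -> Z) :
  (forall a x x', D a -> D' x -> D' x' ->
    rnorm (f a x - f a x') <= rnorm (j a) * rnorm (j' x - j' x')) ->
  (forall a a' x, D a -> D a' -> D' x ->
    rnorm (f a x - f a' x) <= rnorm (j' x) * rnorm (j a - j a')) ->
  exists m : Y -> Y' -> Z,
  [/\ forall a x, D a -> D' x -> m (j a) (j' x) = f a x,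
      forall y z z', rnorm (m z y - m z' y) <= rnorm y * rnorm (z - z')
    & forall z y y', rnorm (m z y - m z y') <= rnorm z * rnorm (y - y')].
Proof.
move=> f1 f2.
have /choice[L hL] : forall a, exists g : Y' -> Z, D a ->
    (forall x, D' x -> g (j' x) = f a x) /\
    (forall y y', rnorm (g y - g y') <= rnorm (j a) * rnorm (y - y')).
  move=> a; have [Da|nDa] := pselect (D a); last by exists (fun _ => 0).
  have [x x' Dx Dx'|g hg] :=
    @dense_extension R X' D' Y' j' jd' Z (f a) _ (rnorm_ge0 (j a)); first exact: f1.
  by exists g => _.
have LB a a' y : D a -> D a' -> rnorm (L a y - L a' y) <= rnorm y * rnorm (j a - j a').
  move=> Da Da'; apply/ler_addgt0Pl => e e0.
  (* Replacing [y] by [j' x] costs [||j a|| + ||j a'||] for the two outer terms and [||j a - j a'||]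
     for the middle one, each times [||y - j' x||]. *)
  pose c := rnorm (j a) + rnorm (j a') + rnorm (j a - j a') + 1.
  have c0 : 0 < c by rewrite ltr_wpDl // !addr_ge0 // rnorm_ge0.
  have [x Dx] := jd' y (divr_gt0 e0 c0); rewrite ler_pdivlMr // /c.
  have [h1 h2] := hL _ Da; have [h1' h2'] := hL _ Da'.
  have := h2 y (j' x); have := h2' (j' x) y; have := f2 _ _ _ Da Da' Dx.
  rewrite -h1 // -h1' //.
  have := rnormB (L a y) (L a (j' x)) (L a' y).
  have := rnormB (L a (j' x)) (L a' (j' x)) (L a' y).
  have := rnormB (j' x) y 0; rewrite !subr0 [rnorm (j' x - y)]rnormBC.
  have := rnorm_ge0 (y - j' x); have := rnorm_ge0 (j a - j a').
  move: (rnorm (y - j' x)) (rnorm (j a - j a')) => p q.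
  move: (rnorm (L a y - L a (j' x))) (rnorm (L a (j' x) - L a' (j' x))) => r1 r2.
  move: (rnorm (L a' (j' x) - L a' y)) (rnorm (L a y - L a' y)) (rnorm (L a (j' x) - L a' y)) => r3 r4 r5.
  move: (rnorm (j' x)) (rnorm y) (rnorm (j a)) (rnorm (j a')) => n1 n2 n3 n4; nra.
have /choice[M hM] : forall y, exists g : Y -> Z,
    (forall a, D a -> g (j a) = L a y) /\
    (forall z z', rnorm (g z - g z') <= rnorm y * rnorm (z - z')).
  by move=> y; apply: (dense_extension jd) => [|a a' Da Da']; [exact: rnorm_ge0|exact: LB].
have mjr a y y' : D a -> rnorm (M y (j a) - M y' (j a)) <= rnorm (j a) * rnorm (y - y').
  move=> Da; have [-> //] := hM y; have [-> //] := hM y'.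
  by have [_] := hL a Da.
exists (fun z y => M y z); split=> [a x Da Dx|y z z'|z y y'].
- by have [-> //] := hM (j' x); have [->] := hL a Da.
- by have [_] := hM y.
apply/ler_addgt0Pl => e e0.
pose c := rnorm y + rnorm y' + rnorm (y - y') + 1.
have c0 : 0 < c by rewrite ltr_wpDl // !addr_ge0 // rnorm_ge0.
have [a Da] := jd z (divr_gt0 e0 c0); rewrite ler_pdivlMr // /c.
have [_ hy] := hM y; have [_ hy'] := hM y'.
have := hy z (j a); have := hy' (j a) z; have := mjr _ y y' Da.
have := rnormB (M y z) (M y (j a)) (M y' z).
have := rnormB (M y (j a)) (M y' (j a)) (M y' z).
have := rnormB (j a) z 0; rewrite !subr0 [rnorm (j a - z)]rnormBC.
have := rnorm_ge0 (z - j a); have := rnorm_ge0 (y - y').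
move: (rnorm (z - j a)) (rnorm (y - y')) => p q.
move: (rnorm (M y z - M y (j a))) (rnorm (M y (j a) - M y' (j a))) => r1 r2.
move: (rnorm (M y' (j a) - M y' z)) (rnorm (M y z - M y' z)) (rnorm (M y (j a) - M y' z)) => r3 r4 r5.
move: (rnorm (j a)) (rnorm z) (rnorm y) (rnorm y') => n1 n2 n3 n4; nra.
Qed.
End BilinearExtension.

Section Conj.
Variable R : realType.
Implicit Types u v : R[i].
Lemma conjcD u v : ((u + v)^* = u^* + v^*)%R. Proof. exact: rmorphD. Qed.
Lemma conjcM u v : ((u * v)^* = u^* * v^*)%R. Proof. exact: rmorphM. Qed.
Lemma conjcN u : ((- u)^* = - u^*)%R. Proof. exact: rmorphN. Qed.
Lemma rcD (a b : R) : (a + b)%:C = a%:C + b%:C. Proof. exact: rmorphD. Qed.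
Lemma rcN (a : R) : (- a)%:C = - a%:C. Proof. exact: rmorphN. Qed.
Lemma rcM (a b : R) : (a * b)%:C = a%:C * b%:C. Proof. exact: rmorphM. Qed.
Lemma rcX (a : R) n : (a ^+ n)%:C = a%:C ^+ n. Proof. exact: rmorphXn. Qed.
Lemma conj_real (t : R) : ((t%:C)^* = t%:C)%R. Proof. exact: conjc_real. Qed.
End Conj.

(** * Hilbert spaces and C*-completions *)

Section CauchySchwarz.
Variables (R : realType) (X : lmodType R[i]) (D : set X) (q : X -> X -> R[i]).
Hypothesis DP : forall (k : R[i]) a b, D a -> D b -> D (k *: a + b).
Hypothesis qP : forall (k : R[i]) a b c, D a -> D b -> D c ->
  q (k *: a + b) c = k * q a c + q b c.
Hypothesis qC : forall a b, D a -> D b -> q a b = ((q b a)^*)%R.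
Hypothesis q_ge0 : forall a, D a -> 0 <= q a a.

(** The form is nonnegative at [x - t q(x, y) y] for every real [t], which is a quadratic inequality
    in [t] with [n = |q(x, y)|^2]. As the form is only semidefinite, [q(y, y) = 0] needs its own
    choice of [t]. *)
Lemma form_CauchySchwarz x y : D x -> D y ->
  rnorm (q x y : cplx R) ^+ 2 <= complex.Re (q x x) * complex.Re (q y y).
Proof.
move=> Dx Dy.
have qE a : D a -> q a a = (complex.Re (q a a))%:C.
  by move=> Da; rewrite RRe_real // ger0_real // q_ge0.
set c := q x y; set a := complex.Re (q x x); set b := complex.Re (q y y).
have cc : c * (c^*)%R = (rnorm (c : cplx R) ^+ 2)%:C by rewrite rmorphXn /= rnormE normCK.
set n := rnorm _ ^+ 2 in cc *.
have n0 : 0 <= n by exact: sqr_ge0.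
clearbody n.
have a0 : 0 <= a by rewrite -ler0c -qE ?q_ge0.
have b0 : 0 <= b by rewrite -ler0c -qE ?q_ge0.
have H (t : R) : 0 <= a - (t * n + t * n) + t ^+ 2 * n * b.
  have Dz : D ((- (t%:C * c)) *: y + x) by exact: DP.
  have := q_ge0 Dz; rewrite qP // (qC Dy Dz) (qC Dx Dz) !qP //.
  rewrite (qC Dy Dx) -/c (qE _ Dx) (qE _ Dy) -/a -/b.
  rewrite !(conjcD, conjcM, conjcN, conjCK, conj_real).
  have -> : (- (t%:C * c) * (- (t%:C * c^*) * b%:C + c^*) +
     (- (t%:C * c^*) * c + a%:C))%R = (a - (t * n + t * n) + t ^+ 2 * n * b)%:C.
    rewrite !(rcD, rcN, rcM, rcX) -cc.
    clearbody c; move: (t%:C) (a%:C) (b%:C) (c^*)%R => t1 a1 b1 c1. ring.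
  by rewrite ler0c.
have [b00|b00] := eqVneq b 0.
  have [-> |nN0] := eqVneq n 0; first by rewrite mulr_ge0.
  have np : 0 < n by rewrite lt_neqAle eq_sym nN0.
  (* With [b = 0] this [t] gives the value [- a - 2 < 0]. *)
  have := H ((a + 1) / n); rewrite b00 mulr0 addr0 divfK //; lra.
have bp : 0 < b by rewrite lt_neqAle eq_sym b00.
(* The minimum of the quadratic polynomial is attained at [t = 1 / b]. *)
have := H b^-1; rewrite exprVn expr2 invfM.
have -> : a - (b^-1 * n + b^-1 * n) + b^-1 * b^-1 * n * b = (a * b - n) / b by field.
by rewrite pmulr_lge0 ?invr_gt0 // subr_ge0.
Qed.

End CauchySchwarz.

Section Hilbert.
Variables (R : realType) (V : hilbert R).
Local Notation dot := (hs_dot V).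

Lemma dotP (k : R[i]) (a b c : V) : dot (k *: a + b) c = k * dot a c + dot b c.
Proof. by rewrite linearPl. Qed.

Lemma dotC (a b : V) : dot a b = ((dot b a)^*)%R.
Proof. by rewrite hermC /= expr0 mul1r. Qed.

Lemma dot0l (c : V) : dot 0 c = 0.
Proof. by have := dotP (-1) 0 0 c; rewrite scaler0 addr0 mulN1r addNr. Qed.

Lemma dotZl (k : R[i]) (a c : V) : dot (k *: a) c = k * dot a c.
Proof. by rewrite -[k *: a]addr0 dotP dot0l addr0. Qed.

Lemma dotZr (k : R[i]) (a c : V) : dot a (k *: c) = (k^*)%R * dot a c.
Proof. by rewrite dotC dotZl conjcM -dotC. Qed.

Lemma dot_rnorm (v : V) : dot v v = (rnorm v ^+ 2)%:C.
Proof. by rewrite hs_norm rmorphXn /= rnormE. Qed.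

Lemma dot_CS (v w : V) : rnorm (dot v w : cplx R) <= rnorm v * rnorm w.
Proof.
have := @form_CauchySchwarz R V setT dot (fun _ _ _ _ _ => I) (fun k a b c _ _ _ => dotP k a b c)
  (fun a b _ _ => dotC a b) _ v w I I.
rewrite !dot_rnorm /= -exprMn ler_pXn2r ?nnegrE ?mulr_ge0 ?rnorm_ge0 //; apply.
by move=> a _; rewrite dot_rnorm ler0c sqr_ge0.
Qed.

Lemma dot_inj (v w : V) : (forall x, dot v x = dot w x) -> v = w.
Proof.
move=> vw; apply/eqP; rewrite -subr_eq0; apply/eqP/rnorm0_eq0.
have : rnorm (v - w) ^+ 2 = 0.
  apply: complexI; rewrite -dot_rnorm {1}(_ : v - w = (-1) *: w + v).
    by rewrite dotP vw mulN1r addNr.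
  by rewrite scaleN1r addrC.
by move/eqP; rewrite sqrf_eq0 => /eqP.
Qed.

End Hilbert.

(** * The C*-completion for a class of representations *)

Section CstarCompletion.
Variables (R : realType) (A : staralg R).
Variable reps : forall V : hilbert R, (A -> {linear V -> V}) -> Prop.
Local Notation D := (sa_elt (s := A)).
Hypothesis hA : star_closed A.
Hypothesis hrep : forall (V : hilbert R) (pi : A -> {linear V -> V}), reps pi -> star_rep pi.

Definition rep_bound (a : A) (M : R) : Prop :=
  forall (V : hilbert R) (pi : A -> {linear V -> V}), reps pi ->
  forall v, rnorm (pi a v) <= M * rnorm v.

Hypothesis hbd : forall a, D a -> exists M, rep_bound a M.

(* By Cauchy-Schwarz the norm of an operator is the supremum of its matrix
   coefficients at vectors of norm at most 1. *)
Definition matrix_coef : Type :=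
  {l : A -> cplx R | exists (V : hilbert R) (pi : A -> {linear V -> V}) (v w : V),
    [/\ reps pi, rnorm v <= 1, rnorm w <= 1 & forall a, l a = hs_dot V (pi a v) w]}.

Let D0 : D 0. Proof. by case: hA. Qed.
Let DP (k : R[i]) a b : D a -> D b -> D (k *: a + b). Proof. by case: hA => _ + _ _; apply. Qed.
Let DM a b : D a -> D b -> D (sa_mul a b). Proof. by case: hA => _ _ + _; apply. Qed.
Let DS a : D a -> D (sa_star a). Proof. by case: hA => _ _ _; apply. Qed.

Lemma rep_bound_completion :
  exists (Y : completeNormedModType R[i]) (j : A -> Y),
  [/\ forall (k : R[i]) a b, D a -> D b -> j (k *: a + b) = k *: j a + j b,
      forall y (e : R), 0 < e -> exists2 x, D x & rnorm (y - j x) <= e,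
      forall x, D x -> rep_bound x (rnorm (j x))
    & forall x (M : R), D x -> 0 <= M -> rep_bound x M -> rnorm (j x) <= M].
Proof.
have [k a b t Da Db|a Da|Y [j [jP jd jub jlub]]] := @uniform_completion R matrix_coef A D
  (fun a l => sval l a) D0 DP.
- case: t => l [V [pi [v [w [hpi v1 w1 lE]]]]] /=; rewrite !lE.
  by have [_ piP _ _] := hrep hpi; rewrite piP // dotP.
(* [M] may be negative when all representations in the class act on the zero space, hence the
   maximum with 0. *)
- have [M hM] := hbd Da; exists (Num.max M 0) => -[l [V [pi [v [w [hpi v1 w1 lE]]]]]] /=.
  rewrite lE; apply: le_trans (dot_CS _ _) _.
  have := hM _ _ hpi v; have := rnorm_ge0 v; have := rnorm_ge0 w.
  have := rnorm_ge0 (pi a v).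
  have : M <= Num.max M 0 by rewrite le_max lexx.
  have : 0 <= Num.max M 0 by rewrite le_max lexx orbT.
  move: (Num.max M 0) => M' h1 h2 h3 h4 h5 h6.
  have : rnorm (pi a v) <= M' by nra.
  nra.
exists Y, j; split=> // [x Dx V pi hpi v|x M Dx M0 hM]; last first.
  apply: jlub => // -[l [V [pi [v [w [hpi v1 w1 lE]]]]]] /=.
  rewrite lE; apply: le_trans (dot_CS _ _) _.
  have := hM _ _ hpi v; have := rnorm_ge0 v; have := rnorm_ge0 w.
  have := rnorm_ge0 (pi x v) => h3 h4 h5 h6.
  have : rnorm (pi x v) <= M by nra.
  nra.
have [v0|vN0] := eqVneq (rnorm v) 0.
  by rewrite (rnorm0_eq0 v0) linear0 !rnorm0 mulr0.
have [w0|wN0] := eqVneq (rnorm (pi x v)) 0.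
  by rewrite w0 mulr_ge0 // rnorm_ge0.
have vp : 0 < rnorm v by rewrite lt_neqAle rnorm_ge0 andbT eq_sym.
have wp : 0 < rnorm (pi x v) by rewrite lt_neqAle rnorm_ge0 andbT eq_sym.
(* At the normalised vectors [v] and [pi x v] the coefficient of [x] is exactly
   [||pi x v|| / ||v||]. *)
pose l a : cplx R := hs_dot V (pi a ((rnorm v)^-1%:C *: v)) ((rnorm (pi x v))^-1%:C *: pi x v).
have hl : exists (V : hilbert R) (pi : A -> {linear V -> V}) (v w : V),
    [/\ reps pi, rnorm v <= 1, rnorm w <= 1 & forall a, l a = hs_dot V (pi a v) w].
  exists V, pi, ((rnorm v)^-1%:C *: v), ((rnorm (pi x v))^-1%:C *: pi x v).
  by split=> //; rewrite rnormZ rnorm_real ?invr_ge0 ?rnorm_ge0 // mulVf.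
have := jub x (exist _ l hl) Dx; rewrite /= /l.
have -> : hs_dot V (pi x ((rnorm v)^-1%:C *: v)) ((rnorm (pi x v))^-1%:C *: pi x v) =
    (rnorm (pi x v) / rnorm v)%:C.
  rewrite [pi x (_ *: v)]linearZ_LR dotZl dotZr conj_real dot_rnorm -!rcM.
  by congr (_%:C); field; rewrite vN0.
by rewrite rnorm_real ?divr_ge0 ?rnorm_ge0 // ler_pdivrMr.
Qed.

(** The laws of a *-algebra are not read off from [A], which is only closed under the operations;
    they hold in every representation of the class, hence after applying [j]. Product and involution
    extend by density, and each law then passes to the completion variable by variable. *)
Lemma cstar_completion :
  exists (E : cstarAlg R) (u : A -> E),
  [/\ star_hom u, setT = closure (u @` D),
      forall x, D x -> rep_bound x (rnorm (u x))
    & forall x (M : R), D x -> 0 <= M -> rep_bound x M -> rnorm (u x) <= M].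
Proof.
have [Y [j [jP jd jub jlub]]] := rep_bound_completion.
have jZ (k : R[i]) a : D a -> j (k *: a) = k *: j a.
  move=> Da; rewrite -[k *: a]addr0 jP //.
  suff -> : j 0 = 0 by rewrite addr0.
  have := jP 1 0 0 D0 D0; rewrite scaler0 addr0 scale1r.
  by move/(congr1 (fun z => z - j 0)); rewrite subrr addrK.
have jB a b : D a -> D b -> j (a - b) = j a - j b.
  by move=> Da Db; rewrite addrC -[- b]scaleN1r jP // scaleN1r addrC.
have DB a b : D a -> D b -> D (a - b).
  by move=> Da Db; rewrite addrC -[- b]scaleN1r; exact: DP.
have j_eq a b : D a -> D b ->
    (forall (V : hilbert R) (pi : A -> {linear V -> V}), reps pi -> forall v, pi a v = pi b v) ->
    j a = j b.
  move=> Da Db ab; apply/eqP; rewrite -subr_eq0 -jB //; apply/eqP/rnorm0_eq0/eqP.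
  rewrite eq_le rnorm_ge0 andbT; apply: jlub => [||V pi hpi v] //; first exact: DB.
  have [_ piP _ _] := hrep hpi.
  by rewrite addrC -[- b]scaleN1r piP // ab // scaleN1r addNr rnorm0 mul0r.
have jM a b : D a -> D b -> rnorm (j (sa_mul a b)) <= rnorm (j a) * rnorm (j b).
  move=> Da Db; apply: jlub => [||V pi hpi v]; first exact: DM.
    by rewrite mulr_ge0 ?rnorm_ge0.
  have [_ _ piM _] := hrep hpi; rewrite piM //.
  apply: le_trans (jub _ Da _ _ hpi _) _; rewrite -mulrA ler_wpM2l ?rnorm_ge0 //.
  exact: jub.
have jS a : D a -> rnorm (j (sa_star a)) <= rnorm (j a).
  move=> Da; apply: jlub => [||V pi hpi v]; [exact: DS|exact: rnorm_ge0|].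
  have [_ _ _ piS] := hrep hpi.
  have [->|w0] := eqVneq (rnorm (pi (sa_star a) v)) 0; first by rewrite mulr_ge0 ?rnorm_ge0.
  have wp : 0 < rnorm (pi (sa_star a) v) by rewrite lt_neqAle rnorm_ge0 andbT eq_sym.
  rewrite -(ler_pM2r wp) -expr2 -[leLHS]rnorm_real ?sqr_ge0 // -dot_rnorm.
  rewrite dotC -piS // rnorm_conj.
  apply: le_trans (dot_CS _ _) _.
  have := jub _ Da _ _ hpi (pi (sa_star a) v); have := rnorm_ge0 v; nra.
(* In each representation [||pi(a) v||^2 = <pi(a^* a) v, v>], which is at most
   [||j(a^* a)|| ||v||^2]. *)
have jC a : D a -> rnorm (j a) ^+ 2 <= rnorm (j (sa_mul (sa_star a) a)).
  move=> Da; have Dsa := DS Da; have Dm := DM Dsa Da.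
  rewrite -ler_sqrt ?rnorm_ge0 // sqrtr_sqr ger0_norm ?rnorm_ge0 //.
  apply: jlub => [//| |V pi hpi v]; first exact: sqrtr_ge0.
  have [_ _ piM piS] := hrep hpi.
  rewrite -(@ler_pXn2r _ 2) ?nnegrE ?mulr_ge0 ?rnorm_ge0 ?sqrtr_ge0 //.
  rewrite exprMn sqr_sqrtr ?rnorm_ge0 // -[leLHS]rnorm_real ?sqr_ge0 // -dot_rnorm.
  rewrite piS // -piM //; apply: le_trans (dot_CS _ _) _.
  have := jub _ Dm _ _ hpi v; have := rnorm_ge0 v; nra.
have jM3 a b c : D a -> D b -> D c -> j (sa_mul a (sa_mul b c)) = j (sa_mul (sa_mul a b) c).
  move=> Da Db Dc; have Dab := DM Da Db; have Dbc := DM Db Dc.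
  apply: j_eq => [||V pi hpi v]; [exact: DM|exact: DM|].
  by have [_ _ piM _] := hrep hpi; rewrite !piM.
have jMPl (k : R[i]) a b c : D a -> D b -> D c ->
    j (sa_mul (k *: a + b) c) = k *: j (sa_mul a c) + j (sa_mul b c).
  move=> Da Db Dc; have Dab := DP k Da Db; have Dac := DM Da Dc; have Dbc := DM Db Dc.
  rewrite -jP //; apply: j_eq => [||V pi hpi v]; [exact: DM|exact: DP|].
  by have [_ piP piM _] := hrep hpi; rewrite piM // !piP // !piM.
have jMPr (k : R[i]) a b c : D a -> D b -> D c ->
    j (sa_mul a (k *: b + c)) = k *: j (sa_mul a b) + j (sa_mul a c).
  move=> Da Db Dc; have Dab := DP k Db Dc; have Dac := DM Da Dc; have Dbc := DM Da Db.
  rewrite -jP //; apply: j_eq => [||V pi hpi v]; [exact: DM|exact: DP|].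
  by have [_ piP piM _] := hrep hpi; rewrite piM // !piP // !piM // linearP.
have star_ext a b : D a -> D b ->
    (forall (V : hilbert R) (pi : A -> {linear V -> V}), reps pi -> forall v w,
      hs_dot V (pi a v) w = hs_dot V (pi b v) w) -> j a = j b.
  by move=> Da Db ab; apply: j_eq => // V pi hpi v; apply: dot_inj => w; exact: ab.
have jSP (k : R[i]) a b : D a -> D b ->
    j (sa_star (k *: a + b)) = (k^*)%R *: j (sa_star a) + j (sa_star b).
  move=> Da Db; have Dab := DP k Da Db; have Dsa := DS Da; have Dsb := DS Db.
  rewrite -jP //; apply: star_ext => [||V pi hpi v w]; [exact: DS|exact: DP|].
  have [_ piP _ piS] := hrep hpi.
  rewrite dotC -piS // !piP // !dotP conjcD conjcM (piS a) // (piS b) //.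
  by rewrite -!(dotC _ w).
have jSM a b : D a -> D b -> j (sa_star (sa_mul a b)) = j (sa_mul (sa_star b) (sa_star a)).
  move=> Da Db; have Dab := DM Da Db; have Dsa := DS Da; have Dsb := DS Db.
  apply: star_ext => [||V pi hpi v w]; [exact: DS|exact: DM|].
  have [_ _ piM piS] := hrep hpi.
  by rewrite dotC -piS // !piM // piS // piS // -dotC.
have jSK a : D a -> j (sa_star (sa_star a)) = j a.
  move=> Da; have Dsa := DS Da; apply: star_ext => [||V pi hpi v w] //; first exact: DS.
  have [_ _ _ piS] := hrep hpi.
  by rewrite dotC -piS // dotC conjCK piS.
have j0 : j 0 = 0 by rewrite -(subrr 0) jB // subrr.
have [a x x' Da Dx Dx'|a a' x Da Da' Dx|m [mj mL mR]] :=
    @bilinear_extension R A A D D Y Y j j jd jd Y (fun a b => j (sa_mul a b)).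
- rewrite -(jB x x') //; have -> : j (sa_mul a x) - j (sa_mul a x') = j (sa_mul a (x - x')).
    by rewrite addrC -[- j _]scaleN1r -jMPr // scaleN1r addrC.
  by apply: jM => //; exact: DB.
- rewrite -(jB a a') //; have -> : j (sa_mul a x) - j (sa_mul a' x) = j (sa_mul (a - a') x).
    by rewrite addrC -[- j _]scaleN1r -jMPl // scaleN1r addrC.
  by rewrite mulrC; apply: jM => //; exact: DB.
have mLl y : lipschitz_map (m^~ y) by exists (rnorm y); [exact: rnorm_ge0|exact: mL].
have mRl z : lipschitz_map (m z) by exists (rnorm z); [exact: rnorm_ge0|exact: mR].
have m0 z : m z 0 = 0.
  have h : m (j 0) 0 = 0.
    rewrite -{1}j0 mj //; apply/rnorm0_eq0/eqP.
    by rewrite eq_le rnorm_ge0 andbT (le_trans (jM _ _ D0 D0)) // j0 rnorm0 mul0r.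
  have := mL 0 z (j 0); rewrite h subr0 rnorm0 mul0r => mz.
  by apply/rnorm0_eq0/eqP; rewrite eq_le mz rnorm_ge0.
have normM z y : rnorm (m z y) <= rnorm z * rnorm y.
  by have := mR z y 0; rewrite m0 !subr0.
have mA : associative m.
  move=> x y z; apply: (dense_eq (f := fun x => m x (m y z)) (g := fun x => m (m x y) z) jd) => [//||a Da].
    exact: (lip_comp (mLl z)).
  apply: (dense_eq (f := fun y => m (j a) (m y z)) (g := fun y => m (m (j a) y) z) jd) => [||b Db].
  - exact: (lip_comp (mRl (j a))).
  - exact: (lip_comp (mLl z)).
  apply: (dense_eq (f := fun z => m (j a) (m (j b) z)) (g := fun z => m (m (j a) (j b)) z) jd) => [||c Dc].
  - exact: (lip_comp (mRl (j a))).
  - exact: mRl.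
  rewrite !mj //; [exact: jM3|exact: DM|exact: DM].
have mPl (k : R[i]) a b c : m (k *: a + b) c = k *: m a c + m b c.
  apply: (dense_eq (f := fun a => m (k *: a + b) c) (g := fun a => k *: m a c + m b c) jd) => [||x Dx].
  - by apply: (lip_comp (mLl c)); apply: lipD; [apply: lipZ; exact: lip_id|exact: lip_cst].
  - by apply: lipD; [apply: lipZ|exact: lip_cst].
  apply: (dense_eq (f := fun b => m (k *: j x + b) c) (g := fun b => k *: m (j x) c + m b c) jd) => [||y Dy].
  - by apply: (lip_comp (mLl c)); apply: lipD; [exact: lip_cst|exact: lip_id].
  - by apply: lipD; [exact: lip_cst|].
  apply: (dense_eq (f := fun c => m (k *: j x + j y) c) (g := fun c => k *: m (j x) c + m (j y) c) jd) => [||z Dz].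
  - exact: mRl.
  - by apply: lipD => //; exact: lipZ.
  by rewrite -jP // !mj //; [exact: jMPl|exact: DP].
have mPr (k : R[i]) a b c : m a (k *: b + c) = k *: m a b + m a c.
  apply: (dense_eq (f := fun a => m a (k *: b + c)) (g := fun a => k *: m a b + m a c) jd) => [||x Dx].
  - exact: mLl.
  - by apply: lipD => //; exact: lipZ.
  apply: (dense_eq (f := fun b => m (j x) (k *: b + c)) (g := fun b => k *: m (j x) b + m (j x) c) jd) => [||y Dy].
  - by apply: (lip_comp (mRl (j x))); apply: lipD; [apply: lipZ; exact: lip_id|exact: lip_cst].
  - by apply: lipD; [apply: lipZ|exact: lip_cst].
  apply: (dense_eq (f := fun c => m (j x) (k *: j y + c)) (g := fun c => k *: m (j x) (j y) + m (j x) c) jd) => [||z Dz].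
  - by apply: (lip_comp (mRl (j x))); apply: lipD; [exact: lip_cst|exact: lip_id].
  - by apply: lipD; [exact: lip_cst|].
  by rewrite -jP // !mj //; [exact: jMPr|exact: DP].
have [x x' Dx Dx'|s [sj sL]] := @dense_extension R A D Y j jd Y (fun x => j (sa_star x)) 1 ler01.
  rewrite mul1r -(jB x x') //; have -> : j (sa_star x) - j (sa_star x') = j (sa_star (x - x')).
    rewrite -[x - x']addrC -[- x']scaleN1r jSP // addrC; congr (_ + _).
    by rewrite conjcN conjC1 scaleN1r.
  by apply: jS; exact: DB.
have sLl : lipschitz_map s by exists 1.
have s0 : s 0 = 0.
  rewrite -{1}j0 sj //; apply/rnorm0_eq0/eqP; rewrite eq_le rnorm_ge0 andbT.
  by rewrite (le_trans (jS _ D0)) // j0 rnorm0.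
have norms y : rnorm (s y) <= rnorm y by have := sL y 0; rewrite s0 !subr0 mul1r.
have sP (k : R[i]) a b : s (k *: a + b) = (k^*)%R *: s a + s b.
  apply: (dense_eq (f := fun a => s (k *: a + b)) (g := fun a => (k^*)%R *: s a + s b) jd) => [||x Dx].
  - by apply: (lip_comp sLl); apply: lipD; [apply: lipZ; exact: lip_id|exact: lip_cst].
  - by apply: lipD; [apply: lipZ|exact: lip_cst].
  apply: (dense_eq (f := fun b => s (k *: j x + b)) (g := fun b => (k^*)%R *: s (j x) + s b) jd) => [||y Dy].
  - by apply: (lip_comp sLl); apply: lipD; [exact: lip_cst|exact: lip_id].
  - by apply: lipD; [exact: lip_cst|].
  by rewrite -jP // !sj //; [exact: jSP|exact: DP].
have sK : involutive s.
  apply: (dense_eq jd) => [||x Dx]; [exact: lip_comp|exact: lip_id|].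
  by rewrite !sj //; [exact: jSK|exact: DS].
have sM a b : s (m a b) = m (s b) (s a).
  apply: (dense_eq (f := fun a => s (m a b)) (g := fun a => m (s b) (s a)) jd) => [||x Dx].
  - exact: (lip_comp sLl).
  - exact: (lip_comp (mRl (s b))).
  apply: (dense_eq (f := fun b => s (m (j x) b)) (g := fun b => m (s b) (s (j x))) jd) => [||y Dy].
  - exact: (lip_comp sLl).
  - exact: (lip_comp (mLl _) sLl).
  rewrite mj // !sj //; last exact: DM.
  by rewrite mj //; [exact: jSM|exact: DS|exact: DS].
have normS a : rnorm (m (s a) a) = rnorm a ^+ 2.
  apply/eqP; rewrite eq_le; apply/andP; split.
    by rewrite (le_trans (normM _ _)) // expr2 ler_wpM2r // rnorm_ge0.
  apply/ler_addgt0Pl => e e0.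
  (* For an approximant at distance [p <= 1], the triangle inequalities leave an error of at most
     [4 ||a|| p + 4 p^2]. *)
  have c0 : 0 < 4 * rnorm a + 4 by have := rnorm_ge0 a; lra.
  have d0 : 0 < Num.min 1 (e / (4 * rnorm a + 4)) by rewrite lt_min ltr01 divr_gt0.
  have [x Dx] := jd a _ d0; rewrite le_min ler_pdivlMr // => /andP[].
  have Dsx := DS Dx.
  have : rnorm (j x) ^+ 2 <= rnorm (m (s (j x)) (j x)) by rewrite sj // mj //; exact: jC.
  have := rnormB (m (s (j x)) (j x)) (m (s a) (j x)) 0.
  have := rnormB (m (s a) (j x)) (m (s a) a) 0; rewrite !subr0.
  have := mL (j x) (s (j x)) (s a); have := mR (s a) (j x) a; have := norms a.
  have := sL (j x) a; rewrite mul1r [rnorm (j x - a)]rnormBC.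
  have := rnormB a (j x) 0; have := rnormB (j x) a 0; rewrite !subr0 [rnorm (j x - a)]rnormBC.
  have := rnorm_ge0 (a - j x); have := rnorm_ge0 (j x); have := rnorm_ge0 a; have := rnorm_ge0 (s a).
  move: (rnorm (a - j x)) (rnorm (j x)) (rnorm a) (rnorm (s a)) => p q n sn.
  move: (rnorm (m (s (j x)) (j x))) (rnorm (m (s (j x)) (j x) - m (s a) (j x))) (rnorm (m (s a) (j x))) => r1 r2 r3.
  move: (rnorm (m (s a) (j x) - m (s a) a)) (rnorm (m (s a) a)) (rnorm (s (j x) - s a)) => r4 P r6.
  move=> sn0 n0 q0 p0 h1 h2 h3 h4 h5 h6 h7 h8 h9 p1 h10.
  have h11 : r2 <= q * p by apply: le_trans h6 _; rewrite ler_wpM2l.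
  have h12 : r4 <= n * p by apply: le_trans h5 _; rewrite ler_wpM2r.
  nra.
have nM a b : `|m a b| <= `|a| * `|b| by rewrite -!rnormE -rcM lecR.
have nS a : `|m (s a) a| = `|a| ^+ 2 by rewrite -!rnormE normS rcX.
exists (CStarAlg mA mPl mPr sP sK sM nM nS), j; split=> //.
- by split=> // [a b Da Db|a Da]; rewrite /= ?mj ?sj.
- apply/seteqP; split=> // y _ B /nbhs_rnorm[e e0 eB].
  by have [x Dx yx] := jd y e e0; exists (j x); split; [exists x|exact: eB].
Qed.
End CstarCompletion.

Section ComplexComplete.
Variable R : realType.

Lemma lipschitz_cauchy (V : normedModType R[i]) (F : set_system V) (FF : ProperFilter F)
    (g : V -> R) :
  (forall x y, `|g x - g y| <= rnorm (x - y)) -> cauchy F ->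
  exists l : R, forall e : R, 0 < e -> F [set y | `|l - g y| <= e].
Proof.
move=> gL /cauchy_ballP Fc.
have : cauchy (g @ F).
  apply/cauchy_ballP => e e0; have := Fc (e%:C); rewrite ltcR => /(_ e0).
  case=> -[A B] [/= FA FB] AB; exists (g @` A, g @` B).
    split => /=; first by apply: filterS FA => y Ay; exists y.
    by apply: filterS FB => y By; exists y.
  move=> [_ _] [/= [y Ay <-] [y' By' <-]].
  have : ball y e%:C y' := AB (y, y') (conj Ay By').
  rewrite -ball_normE /ball_ /= -rnormE ltcR.
  by apply: le_lt_trans; exact: gL.
move=> /(@R_complete R _ _)/cvg_ex[l Fl]; exists l => e e0.
by move/cvgrPdist_le : Fl => /(_ e e0).
Qed.

Lemma complex_complete (F : set_system (cplx R)) : ProperFilter F -> cauchy F -> cvg F.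
Proof.
move=> FF Fc.
have [|a ha] := @lipschitz_cauchy _ F FF (@complex.Re R) _ Fc.
  by move=> x y; rewrite -raddfB; exact: Re_le_rnorm.
have [|b hb] := @lipschitz_cauchy _ F FF (@complex.Im R) _ Fc.
  by move=> x y; rewrite -raddfB; exact: Im_le_rnorm.
apply/cvg_ex; exists (a +i* b : cplx R); apply/cvgrPdist_le => e e0.
have eE : e = (complex.Re e)%:C by rewrite RRe_real // gtr0_real.
rewrite eE ltcR in e0 *; have e20 : 0 < complex.Re e / 2 by rewrite divr_gt0.
apply: filterS2 (ha _ e20) (hb _ e20) => -[c d] /= ca db.
rewrite -rnormE lecR; apply: le_trans (rnorm_ReIm _) _.
by rewrite [leRHS](splitr (complex.Re e)) lerD.
Qed.

(** Allows the scalars as target of [bilinear_extension] when a form is extended to a completion. *)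
Definition complex_completeNormedMod : completeNormedModType R[i] :=
  HB.pack (R[i]^o) (Uniform_isComplete.Build (R[i]^o) complex_complete).

Lemma lip_conj (V : normedModType R[i]) (f : V -> cplx R) :
  lipschitz_map f -> lipschitz_map (fun x => (f x)^*%R : cplx R).
Proof.
move=> [C C0 fC]; exists C => // y y'.
have -> : ((f y)^* - (f y')^* = (f y - f y')^*)%R by rewrite conjcD conjcN.
by rewrite rnorm_conj.
Qed.
End ComplexComplete.

Section MakeHilbert.
Variables (R : realType) (V : completeNormedModType R[i]) (d : V -> V -> R[i]).
Hypothesis dP : forall (k : R[i]) a b c, d (k *: a + b) c = k * d a c + d b c.
Hypothesis dC : forall a b, d a b = (d b a)^*%R.
Hypothesis dN : forall a, d a a = `|a| ^+ 2.

(** Taking the three laws as arguments gives the form a head constant from which the instances below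
    recover their proofs. *)
Definition hilbert_dot of (forall (k : R[i]) a b c, d (k *: a + b) c = k * d a c + d b c)
  & (forall a b, d a b = (d b a)^*%R) & (forall a, d a a = `|a| ^+ 2) := d.

Let dotf := hilbert_dot dP dC dN.

Fact dot_bilinear : bilinear_for
  (GRing.mul : GRing.Scale.law R[i] R[i]) (@Num.conj R[i] \; *%R : GRing.Scale.law R[i] R[i]) dotf.
Proof.
split=> [c k a b|c k a b] /=; first exact: dP.
by rewrite /dotf /hilbert_dot dC dP conjcD conjcM -!dC.
Qed.
HB.instance Definition _ := bilinear_isBilinear.Build _ _ _ _ _ _ dotf dot_bilinear.

Fact dot_hermitian a b : dotf a b = (-1) ^+ false * (dotf b a)^*%R.
Proof. by rewrite expr0 mul1r; exact: dC. Qed.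
HB.instance Definition _ := isHermitianSesquilinear.Build _ _ _ _ dotf dot_hermitian.

Fact dot_pos a : a != 0 -> 0 < dotf a a.
Proof. by rewrite /dotf /hilbert_dot dN => a0; rewrite exprn_gt0 // normr_gt0. Qed.
HB.instance Definition _ := isDotProduct.Build _ _ dotf dot_pos.

Definition make_hilbert : hilbert R :=
  @Hilbert R V (dotf : {dot V for @Num.conj R[i]}) dN.
End MakeHilbert.

Section HilbertCompletion.
Variables (R : realType) (X : lmodType R[i]) (D : set X) (q : X -> X -> R[i]).
Hypothesis D0 : D 0.
Hypothesis DP : forall (k : R[i]) a b, D a -> D b -> D (k *: a + b).
Hypothesis qP : forall (k : R[i]) a b c, D a -> D b -> D c ->
  q (k *: a + b) c = k * q a c + q b c.
Hypothesis qC : forall a b, D a -> D b -> q a b = ((q b a)^*)%R.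
Hypothesis q_ge0 : forall a, D a -> 0 <= q a a.

(** A vector [a] is represented by the function [h |-> q a h] on the unit ball of the seminorm. By
    Cauchy-Schwarz, with equality at a multiple of [a], its sup norm is the square root of [q a a];
    null vectors thereby go to 0. *)
Lemma hilbert_completion :
  exists (V : hilbert R) (j : X -> V),
  [/\ forall (k : R[i]) a b, D a -> D b -> j (k *: a + b) = k *: j a + j b,
      forall y (e : R), 0 < e -> exists2 x, D x & rnorm (y - j x) <= e
    & forall a b, D a -> D b -> hs_dot V (j a) (j b) = q a b].
Proof.
pose n a := Num.sqrt (complex.Re (q a a)).
have n_ge0 a : 0 <= n a by exact: sqrtr_ge0.
have qE a : D a -> q a a = (complex.Re (q a a))%:C.
  by move=> Da; rewrite RRe_real // ger0_real // q_ge0.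
have n2 a : D a -> n a ^+ 2 = complex.Re (q a a).
  by move=> Da; rewrite sqr_sqrtr // -ler0c -qE // q_ge0.
have nE a : D a -> q a a = (n a ^+ 2)%:C by move=> Da; rewrite n2 // -qE.
have CS a b : D a -> D b -> rnorm (q a b : cplx R) <= n a * n b.
  move=> Da Db; rewrite -(@ler_pXn2r _ 2) ?nnegrE ?mulr_ge0 ?rnorm_ge0 // exprMn.
  by rewrite !n2 //; exact: (form_CauchySchwarz DP qP qC q_ge0).
have q0l b : D b -> q 0 b = 0.
  by move=> Db; have := qP (-1) D0 D0 Db; rewrite scaler0 addr0 mulN1r addNr.
have qZl (k : R[i]) a b : D a -> D b -> q (k *: a) b = k * q a b.
  by move=> Da Db; rewrite -[k *: a]addr0 qP // q0l // addr0.
have DZ (k : R[i]) a : D a -> D (k *: a) by move=> Da; rewrite -[_ *: _]addr0; exact: DP.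
pose T := {h : X | D h /\ n h <= 1}.
have [k a b [h [Dh h1]] Da Db|a Da|Y [j [jP jd jub jlub]]] :=
    @uniform_completion R T X D (fun a h => q a (sval h)) D0 DP.
- exact: qP.
- exists (n a) => -[h [Dh h1]] /=; apply: le_trans (CS _ _ Da Dh) _.
  by rewrite ler_piMr.
have jn a : D a -> rnorm (j a) = n a.
  move=> Da; apply/eqP; rewrite eq_le; apply/andP; split.
    by apply: jlub => // -[h [Dh h1]] /=; rewrite (le_trans (CS _ _ Da Dh)) // ler_piMr.
  have [->|na0] := eqVneq (n a) 0; first exact: rnorm_ge0.
  have na : 0 < n a by rewrite lt_neqAle eq_sym na0 n_ge0.
  have Dh := DZ (n a)^-1%:C _ Da.
  have qh : q ((n a)^-1%:C *: a) ((n a)^-1%:C *: a) = 1.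
    by rewrite qZl // qC // qZl // conjcM conj_real -qC // nE // -!rcM; congr (_%:C); field.
  have h1 : n ((n a)^-1%:C *: a) <= 1 by rewrite /n qh sqrtr1.
  have := jub a (exist _ _ (conj Dh h1)) Da; rewrite /= qC // qZl //.
  rewrite rnorm_conj nE // -rcM rnorm_real ?mulr_ge0 ?invr_ge0 ?sqr_ge0 //.
  by rewrite expr2 mulKf.
have jB a b : D a -> D b -> j (a - b) = j a - j b.
  by move=> Da Db; rewrite addrC -[- b]scaleN1r jP // scaleN1r addrC.
have DB a b : D a -> D b -> D (a - b).
  by move=> Da Db; rewrite addrC -[- b]scaleN1r; exact: DP.
have qBl a b c : D a -> D b -> D c -> q a c - q b c = q (a - b) c.
  by move=> Da Db Dc; rewrite [a - b]addrC -[- b]scaleN1r qP // mulN1r addrC.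
have [a x x' Da Dx Dx'|a a' x Da Da' Dx|d [dj dL dR]] :=
    @bilinear_extension R X X D D Y Y j j jd jd (complex_completeNormedMod R) q.
- rewrite (qC Da Dx) (qC Da Dx').
  have -> : ((q x a)^* - (q x' a)^* = (q x a - q x' a)^*)%R by rewrite conjcD conjcN.
  rewrite rnorm_conj qBl // -jB // !jn // 1?mulrC; try exact: DB.
  by apply: CS => //; exact: DB.
- rewrite qBl // -jB // !jn // 1?mulrC; try exact: DB.
  by apply: CS => //; exact: DB.
have dLl y : lipschitz_map (d^~ y) by exists (rnorm y); [exact: rnorm_ge0|exact: dL].
have dRl z : lipschitz_map (d z) by exists (rnorm z); [exact: rnorm_ge0|exact: dR].
have dP (k : R[i]) a b c : d (k *: a + b) c = k * d a c + d b c.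
  apply: (dense_eq (f := fun a => d (k *: a + b) c) (g := fun a => k *: d a c + d b c) jd) => [||x Dx].
  - by apply: (lip_comp (dLl c)); apply: lipD; [apply: lipZ; exact: lip_id|exact: lip_cst].
  - by apply: lipD; [apply: lipZ|exact: lip_cst].
  apply: (dense_eq (f := fun b => d (k *: j x + b) c) (g := fun b => k *: d (j x) c + d b c) jd) => [||y Dy].
  - by apply: (lip_comp (dLl c)); apply: lipD; [exact: lip_cst|exact: lip_id].
  - by apply: lipD; [exact: lip_cst|].
  apply: (dense_eq (f := fun c => d (k *: j x + j y) c) (g := fun c => k *: d (j x) c + d (j y) c) jd) => [||z Dz].
  - exact: dRl.
  - by apply: lipD => //; exact: lipZ.
  by rewrite -jP // !dj //; [exact: qP|exact: DP].
have dC a b : d a b = (d b a)^*%R.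
  apply: (dense_eq (f := fun a => d a b) (g := fun a => (d b a)^*%R : cplx R) jd) => [||x Dx].
  - exact: dLl.
  - exact: lip_conj.
  apply: (dense_eq (f := fun b => d (j x) b) (g := fun b => (d b (j x))^*%R : cplx R) jd) => [||y Dy].
  - exact: dRl.
  - exact: lip_conj.
  by rewrite !dj // qC.
have dN a : d a a = `|a| ^+ 2.
  rewrite -rnormE -rcX; apply/eqP; rewrite -subr_eq0; apply/eqP.
  apply: (@rnorm_le_eq0 R (cplx R)) => e e0.
  have c0 : 0 < 4 * rnorm a + 4 by have := rnorm_ge0 a; lra.
  have d0 : 0 < Num.min 1 (e / (4 * rnorm a + 4)) by rewrite lt_min ltr01 divr_gt0.
  have [x Dx] := jd a _ d0; rewrite le_min ler_pdivlMr // => /andP[].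
  have := rnormB (d a a : cplx R) (d (j x) a) ((rnorm a ^+ 2)%:C).
  have := rnormB (d (j x) a : cplx R) (d (j x) (j x)) ((rnorm a ^+ 2)%:C).
  have -> : rnorm (d (j x) (j x) - (rnorm a ^+ 2)%:C : cplx R) = `|rnorm (j x) ^+ 2 - rnorm a ^+ 2|.
    rewrite dj // nE // -jn // -rcN -rcD; apply: complexI.
    by rewrite rnormE normc_def /= expr0n addr0 sqrtr_sqr.
  have := dL a a (j x); have := dR (j x) a (j x).
  have := rnormB a (j x) 0; have := rnormB (j x) a 0; rewrite !subr0 [rnorm (j x - a)]rnormBC.
  have := rnorm_ge0 (a - j x); have := rnorm_ge0 (j x); have := rnorm_ge0 a.
  move: (rnorm (a - j x)) (rnorm (j x)) (rnorm a) => p t m.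
  move: (rnorm (d a a - d (j x) a)) (rnorm (d (j x) a - d (j x) (j x))) => r1 r2.
  move: (rnorm (d (j x) a - _)) (rnorm (d a a - _)) => r3 r4.
  move=> m0 t0 p0 h1 h2 h3 h4 h5 h6 p1 pe.
  have : `|t ^+ 2 - m ^+ 2| <= p * (t + m).
    by rewrite subr_sqr normrM [`|t + m|]ger0_norm ?addr_ge0 // ler_wpM2r ?addr_ge0 // ler_norml; lra.
  nra.
by exists (make_hilbert dP dC dN), j; split.
Qed.
End HilbertCompletion.

(** * Integration on groups with a basis of compact open subgroups *)

Definition group_simp (G : groupType) := (@invgM G, @invgK G, @invg1 G, @mulg1 G, @mul1g G,
  @mulgA G, @mulgV G, @mulVg G, @mulgK G, @mulgVK G).

Lemma compact_cover_pt (T : topologicalType) (t : T) (A : set T) :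
  compact A -> cover_compact A.
Proof.
pose T' : ptopologicalType := HB.pack (Topological.sort T) (Topological.class T) (isPointed.Build T t).
by move=> cA; have : @compact T' A := cA; rewrite (compact_cover T').
Qed.

Section TopGroup.
Variable L : topGroupType.
Implicit Types (x y z : L) (U V S C : set L).

Lemma mulg_near x y V : nbhs (x * y)%g V ->
  exists2 W : set L * set L, nbhs x W.1 /\ nbhs y W.2 &
    forall a b, W.1 a -> W.2 b -> V (a * b)%g.
Proof.
move=> Vxy; have [[A B] [/= Ax By] AB] := @mulg_continuous L (x, y) V Vxy.
by exists (A, B) => // a b Aa Bb; exact: (AB (a, b)).
Qed.

Lemma mulgl_continuous x : continuous (fun y => (x * y)%g).
Proof.
move=> y V /mulg_near[[A B] [/= Ax By] AB]; apply: filterS By => b; apply: AB.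
exact: nbhs_singleton.
Qed.

Lemma mulgr_continuous x : continuous (fun y => (y * x)%g).
Proof.
move=> y V /mulg_near[[A B] [/= Ax By] AB]; apply: filterS Ax => a Aa; apply: AB => //.
exact: nbhs_singleton.
Qed.

Lemma nbhs_mull x y V : nbhs (x * y)%g V -> nbhs y [set z | V (x * z)%g].
Proof. exact: mulgl_continuous. Qed.

Lemma nbhs_coset x V : nbhs (1%g : L) V -> nbhs x [set y | V (x^-1 * y)%g].
Proof. by move=> V1; apply: nbhs_mull; rewrite mulVg. Qed.

Lemma sub1 S : is_subgroup S -> S 1%g. Proof. by case. Qed.
Lemma subM S x y : is_subgroup S -> S x -> S y -> S (x * y)%g.
Proof. by move=> [_ h _]; exact: h. Qed.
Lemma subV S x : is_subgroup S -> S x -> S x^-1%g.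
Proof. by move=> [_ _ h]; exact: h. Qed.
Lemma subMl S x y : is_subgroup S -> S x -> S (x * y)%g <-> S y.
Proof.
move=> hS Sx; split=> [Sxy|]; last exact: subM.
by rewrite -(mulKg x y); apply: subM => //; exact: subV.
Qed.
Lemma subMr S x y : is_subgroup S -> S y -> S (x * y)%g <-> S x.
Proof.
move=> hS Sy; split=> [Sxy|Sx]; last exact: subM.
by rewrite -(mulgK y x); apply: subM => //; exact: subV.
Qed.
Lemma subVE S x : is_subgroup S -> S x^-1%g <-> S x.
Proof. by move=> hS; split=> [/(subV hS)|]; [rewrite invgK|exact: subV]. Qed.

Lemma coset_sym U x y : is_subgroup U -> U (x^-1 * y)%g -> U (y^-1 * x)%g.
Proof. by move=> hU /(subV hU); rewrite invgM invgK. Qed.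

Lemma coset_trans U x y z : is_subgroup U ->
  U (x^-1 * y)%g -> U (y^-1 * z)%g -> U (x^-1 * z)%g.
Proof. by move=> hU h /(subM hU h); rewrite mulgA mulgK. Qed.

Lemma nbhs1_subgroup_open U : is_subgroup U -> nbhs (1%g : L) U -> open U.
Proof.
move=> hU U1; rewrite openE => x Ux; apply: filterS (nbhs_coset x U1) => y /= h.
by have := subM hU Ux h; rewrite mulVKg.
Qed.

Lemma open_coset U x : is_subgroup U -> open U -> open [set y | U (x^-1 * y)%g].
Proof.
move=> hU oU; rewrite openE => y Uy.
have U1 : nbhs (1%g : L) U by apply: open_nbhs_nbhs; split => //; exact: sub1.
by apply: filterS (nbhs_coset y U1) => z; exact: coset_trans.
Qed.

Lemma closed_coset U x : is_subgroup U -> open U -> closed [set y | U (x^-1 * y)%g].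
Proof.
move=> hU oU y cy /=.
have U1 : nbhs (1%g : L) U by apply: open_nbhs_nbhs; split => //; exact: sub1.
have [z [/= xz yz]] := cy _ (nbhs_coset y U1).
by apply: (coset_trans (y := z)) => //; exact: coset_sym.
Qed.

Lemma open_subgroup_closed U : is_subgroup U -> open U -> closed U.
Proof.
move=> hU oU; suff -> : U = [set y | U (1^-1 * y)%g] by exact: closed_coset.
by apply/seteqP; split=> y /=; rewrite invg1 mul1g.
Qed.

Lemma closure_subgroup S : is_subgroup S -> is_subgroup (closure S).
Proof.
move=> hS; split=> [|x y cx cy V /mulg_near[[A B] [/= Ax By] AB]|x cx V Vx].
- by apply: subset_closure; exact: sub1.
- have [a [Sa Aa]] := cx _ Ax; have [b [Sb Bb]] := cy _ By.
  by exists (a * b)%g; split; [exact: subM|exact: AB].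
- have [y [Sy Vy]] := cx _ (@invg_continuous L x _ Vx).
  by exists y^-1%g; split; [exact: subV|].
Qed.

Definition cosub U : Prop := [/\ is_subgroup U, open U & compact U].

Lemma cosub_nbhs U : cosub U -> nbhs (1%g : L) U.
Proof. by case=> hU oU _; apply: open_nbhs_nbhs; split => //; exact: sub1. Qed.

Lemma cosubI U V : cosub U -> cosub V -> cosub (U `&` V).
Proof.
move=> [hU oU cU] [hV oV cV]; split; last 2 first.
- exact: openI.
- apply: (subclosed_compact _ cU); last exact: subIsetl.
  by apply: closedI; exact: open_subgroup_closed.
- split; first by split; exact: sub1.
  + by move=> x y [Ux Vx] [Uy Vy]; split; exact: subM.
  + by move=> x [Ux Vx]; split; exact: subV.
Qed.

Lemma cosub_open_subgroupI U S : cosub U -> is_subgroup S -> open S -> cosub (U `&` S).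
Proof.
move=> [hU oU cU] hV oV; split; last 2 first.
- exact: openI.
- apply: (subclosed_compact _ cU); last exact: subIsetl.
  by apply: closedI; exact: open_subgroup_closed.
- split; first by split; exact: sub1.
  + by move=> x y [Ux Vx] [Uy Vy]; split; exact: subM.
  + by move=> x [Ux Vx]; split; exact: subV.
Qed.

Definition conj_by x U : set L := [set y | U (x^-1 * y * x)%g].

Lemma conj_bycont x : continuous (fun y => (x^-1 * y * x)%g).
Proof.
move=> y; apply: (@continuous_comp _ _ _ (fun y => (x^-1 * y)%g) (fun y => (y * x)%g)).
  exact: mulgl_continuous.
exact: mulgr_continuous.
Qed.

Lemma cosub_conj x U : cosub U -> cosub (conj_by x U).
Proof.
move=> [hU oU cU]; split; last 2 first.
- by move: (x) => x'; apply: open_comp => // y _; exact: conj_bycont.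
- have -> : conj_by x U = (fun y => (x^-1^-1 * y * x^-1)%g) @` U.
    apply/seteqP; split=> [y Uy|_ [y Uy <-]]; last by rewrite /conj_by /= !group_simp.
    by exists (x^-1 * y * x)%g => //; rewrite !group_simp.
  apply: continuous_compact => //; apply: continuous_subspaceT; exact: conj_bycont.
- split=> [|y z|y]; rewrite /conj_by /=.
  + by rewrite !group_simp; exact: sub1.
  + by move=> Uy Uz; have := subM hU Uy Uz; rewrite !group_simp.
  + by move=> /(subV hU); rewrite !group_simp.
Qed.

Lemma coset_compact x U : compact U -> compact [set y | U (x^-1 * y)%g].
Proof.
move=> cU; have -> : [set y | U (x^-1 * y)%g] = (fun y => (x * y)%g) @` U.
  apply/seteqP; split=> [y Uy|_ [y Uy <-]] /=; last by rewrite mulKg.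
  by exists (x^-1 * y)%g => //; rewrite mulVKg.
by apply: continuous_compact => //; apply: continuous_subspaceT; exact: mulgl_continuous.
Qed.

Definition cosets (U : set L) (s : seq L) : set L :=
  [set x | exists2 y, y \in s & U (y^-1 * x)%g].

Lemma compact_cosets_cover C U : compact C -> cosub U ->
  exists2 s : seq L, (forall y, y \in s -> C y) & C `<=` cosets U s.
Proof.
move=> cptC cU; have cC := compact_cover_pt (1%g : L) cptC.
have [i _|x Cx|D' D'C CD'] := cC L C (fun x => [set y | U (x^-1 * y)%g]).
- by case: cU => hU oU _; exact: open_coset.
- by exists x => //=; rewrite mulVg; case: cU => hU _ _; exact: sub1.
- exists (finmap.enum_fset D') => [y yD|x Cx]; first by have := D'C y yD; rewrite inE.
  by have [y yD xy] := CD' x Cx; exists y.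
Qed.

Lemma cosets_cons U y s : cosets U (y :: s) = [set x | U (y^-1 * x)%g] `|` cosets U s.
Proof.
apply/seteqP; split=> [x [z]|x [h|[z zs h]]].
- by rewrite inE => /predU1P[->|zs] h; [left|right; exists z].
- by exists y => //; rewrite mem_head.
- by exists z => //; rewrite inE zs orbT.
Qed.

Lemma cosets_nil U : cosets U [::] = set0.
Proof. by apply/seteqP; split=> x // [y]. Qed.

Lemma compact_cosets U s : cosub U -> compact (cosets U s).
Proof.
move=> cU; elim: s => [|y s ih]; first by rewrite cosets_nil; exact: compact0.
rewrite cosets_cons; apply: compactU => //; apply: coset_compact.
by case: cU.
Qed.

Lemma clopen_cosets U s : cosub U -> open (cosets U s) /\ closed (cosets U s).
Proof.
move=> [hU oU _]; elim: s => [|y s [ih1 ih2]].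
  by rewrite cosets_nil; split; [exact: open0|exact: closed0].
by rewrite cosets_cons; split; [apply: openU|apply: closedU] => //;
  [exact: open_coset|exact: closed_coset].
Qed.

End TopGroup.

Section ComplexContinuous.
Variables (R : realType) (T : topologicalType).
Implicit Types f g : T -> cplx R.

Lemma fcontP f :
  continuous f <-> forall x (e : R), 0 < e -> nbhs x [set y | rnorm (f x - f y) <= e].
Proof.
split=> [fc x e e0|h x].
  have /cvgrPdist_le/(_ e%:C) := fc x; rewrite ltcR => /(_ e0).
  by apply: filterS => y; rewrite -rnormE lecR.
apply/cvgrPdist_le => e e0.
have eE : e = (complex.Re e)%:C by rewrite RRe_real // gtr0_real.
rewrite eE ltcR in e0; near=> y; rewrite eE -rnormE lecR.
by near: y; exact: h.
Unshelve. all: by end_near. Qed.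

Lemma continuous_fM f g : continuous f -> continuous g -> continuous (fun x => f x * g x : cplx R).
Proof. by move=> fc gc x; apply: cvgM; [exact: fc|exact: gc]. Qed.

Lemma continuous_fP (k : R[i]) f g : continuous f -> continuous g -> continuous (k *: f + g).
Proof. by move=> fc gc x; apply: cvgD; [apply: cvgZr; exact: fc|exact: gc]. Qed.

Lemma continuous_conj f : continuous f -> continuous (fun x => (f x)^*%R : cplx R).
Proof.
move=> /fcontP fc; apply/fcontP => x e e0; apply: filterS (fc x e e0) => y /=.
have -> : ((f x)^* - (f y)^* = (f x - f y)^*)%R by rewrite conjcD conjcN.
by rewrite rnorm_conj.
Qed.

Lemma continuous_rc (g : T -> R) (f : T -> cplx R) : continuous f ->
  (forall x y, `|g x - g y| <= rnorm (f x - f y)) -> continuous (fun x => (g x)%:C : cplx R).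
Proof.
move=> /fcontP fc gf; apply/fcontP => x e e0; apply: filterS (fc x e e0) => y /=.
apply: le_trans; rewrite -rcN -rcD.
suff -> : rnorm ((g x - g y)%:C : cplx R) = `|g x - g y| by exact: gf.
by apply: complexI; rewrite rnormE normc_def /= expr0n addr0 sqrtr_sqr.
Qed.

Lemma continuous_rnorm f : continuous f -> continuous (fun x => (rnorm (f x))%:C : cplx R).
Proof.
move=> fc; apply: (continuous_rc fc) => x y.
rewrite ler_norml; have := rnormB (f x) (f y) 0; have := rnormB (f y) (f x) 0.
by rewrite !subr0 [rnorm (f y - f x)]rnormBC; lra.
Qed.

Lemma continuous_indic (A : set T) : open A -> closed A -> continuous (fun x => \1_A x : cplx R).
Proof.
move=> oA cA; apply/fcontP => x e e0.
have [Ax|nAx] := pselect (A x).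
  have : nbhs x A by exact: open_nbhs_nbhs.
  by apply: filterS => y Ay; rewrite /= !indicE !mem_set // subrr rnorm0 ltW.
have : nbhs x (~` A) by apply: open_nbhs_nbhs; split => //; exact: closed_openC.
by apply: filterS => y nAy; rewrite /= !indicE !memNset // subrr rnorm0 ltW.
Qed.

End ComplexContinuous.

Lemma indicT (R : realType) (T : Type) (A : set T) x : A x -> (\1_A x : R[i]) = 1.
Proof. by move=> Ax; rewrite indicE mem_set. Qed.
Lemma indicF (R : realType) (T : Type) (A : set T) x : ~ A x -> (\1_A x : R[i]) = 0.
Proof. by move=> Ax; rewrite indicE memNset. Qed.

(** What the integration theory uses, free of Hecke pairs; [hsN] stands in for the normalisation of
    the measure. *)
Record haar_setting (R : realType) (L : topGroupType) (S : set L)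
    (I : (L -> cplx R) -> cplx R) : Prop := HaarSetting {
  hsS : is_subgroup S;
  hsO : open S;
  hsH : hausdorff_space L;
  hsT : forall V, nbhs (1%g : L) V -> exists U, cosub U /\ U `<=` V;
  hsI : is_haar S I;
  hsN : exists f, Cc S f /\ I f <> 0
}.

Section CompactSupport.
Variables (R : realType) (L : topGroupType) (S : set L) (I : (L -> cplx R) -> cplx R).
Hypothesis h : haar_setting S I.
Local Notation Cc := (@Cc R L S).
Let hS := hsS h.

Lemma cosub_small V : nbhs (1%g : L) V -> exists U, [/\ cosub U, U `<=` V & U `<=` S].
Proof.
move=> /(hsT h)[U [cU UV]]; exists (U `&` S); split; last 2 first.
- by move=> x [/UV].
- by move=> x [].
by apply: cosub_open_subgroupI => //; exact: hsO h.
Qed.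

Lemma Cc_cont f : Cc f -> continuous f. Proof. by case. Qed.

Lemma Cc_out f x : Cc f -> ~ S x -> f x = 0. Proof. by case=> _ _; apply. Qed.

Lemma Cc_in f x : Cc f -> f x <> 0 -> S x.
Proof. by move=> [_ _ fS] fx; apply: contrapT => /fS. Qed.

Lemma Cc_intro f C : continuous f -> compact C -> C `<=` S ->
  (forall x, f x <> 0 -> C x) -> Cc f.
Proof.
move=> fc cC CS fC; split=> //; last by move=> x nS; apply: contrapT => /fC/CS.
apply: (subclosed_compact _ cC); first exact: closed_closure.
rewrite [X in _ `<=` X](_ : C = closure C); last first.
  by apply/closure_id; apply: compact_closed => //; exact: hsH h.
by apply: closure_subset => x /eqP; exact: fC.
Qed.

Lemma Cc_support f : Cc f -> exists C, [/\ compact C, C `<=` S & forall x, f x <> 0 -> C x].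
Proof.
move=> [fc cC fS]; exists (closure [set x | f x != 0]); split=> //.
  rewrite [X in _ `<=` X](_ : S = closure S); last first.
    by apply/closure_id; apply: open_subgroup_closed; [exact: hS|exact: hsO h].
  by apply: closure_subset => x /eqP fx; apply: contrapT => /fS.
by move=> x /eqP fx; apply: subset_closure.
Qed.

Lemma Cc0 : Cc 0.
Proof.
apply: (@Cc_intro _ set0) => //; last exact: compact0.
by move=> x; exact: cvg_cst.
Qed.

Lemma CcP (k : R[i]) f g : Cc f -> Cc g -> Cc (k *: f + g).
Proof.
move=> Cf Cg; have [C [cC CS fC]] := Cc_support Cf; have [C' [cC' CS' gC]] := Cc_support Cg.
apply: (@Cc_intro _ (C `|` C')).
- by apply: continuous_fP; exact: Cc_cont.
- exact: compactU.
- by move=> x []; auto.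
- move=> x; rewrite !fctE; have [->|fx] := pselect (f x = 0); last by left; exact: fC.
  have [->|gx] := pselect (g x = 0); last by right; exact: gC.
  by rewrite scaler0 addr0.
Qed.

Lemma CcZ (k : R[i]) f : Cc f -> Cc (k *: f).
Proof. by move=> Cf; rewrite -[_ *: _]addr0; apply: CcP => //; exact: Cc0. Qed.

Lemma CcB f g : Cc f -> Cc g -> Cc (f - g).
Proof. by move=> Cf Cg; rewrite addrC -scaleN1r; exact: CcP. Qed.

Lemma CcMl (phi f : L -> cplx R) : continuous phi -> Cc f -> Cc (fun x => phi x * f x).
Proof.
move=> pc Cf; have [C [cC CS fC]] := Cc_support Cf.
apply: (Cc_intro (continuous_fM pc (Cc_cont Cf)) cC CS) => x.
by have [->|fx _] := pselect (f x = 0); [rewrite mulr0|exact: fC].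
Qed.

Lemma CcMr (f phi : L -> cplx R) : Cc f -> continuous phi -> Cc (fun x => f x * phi x).
Proof.
move=> Cf pc; rewrite (_ : (fun x => _) = (fun x => phi x * f x)); first exact: CcMl.
by apply/funext => x; rewrite mulrC.
Qed.

Lemma Cc_conj f : Cc f -> Cc (fun x => (f x)^*%R).
Proof.
move=> Cf; have [C [cC CS fC]] := Cc_support Cf.
apply: (@Cc_intro _ C) => // [|x]; first by apply: continuous_conj; exact: Cc_cont.
have [->|fx _] := pselect (f x = 0); last exact: fC.
by rewrite conjC0.
Qed.

Lemma Cc_rnorm f : Cc f -> Cc (fun x => (rnorm (f x))%:C).
Proof.
move=> Cf; have [C [cC CS fC]] := Cc_support Cf.
apply: (@Cc_intro _ C) => // [|x]; first by apply: continuous_rnorm; exact: Cc_cont.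
by have [->|fx _] := pselect (f x = 0); [rewrite rnorm0|exact: fC].
Qed.

Lemma Cc_comp f (phi psi : L -> L) : continuous phi -> continuous psi ->
  (forall x, psi (phi x) = x) -> (forall x, S x -> S (psi x)) -> Cc f ->
  Cc (fun x => f (phi x)).
Proof.
move=> pc qc pK pS Cf; have [C [cC CS fC]] := Cc_support Cf.
apply: (@Cc_intro _ (psi @` C)).
- by move=> x; apply: continuous_comp; [exact: pc|exact: (Cc_cont Cf)].
- by apply: continuous_compact => //; apply: continuous_subspaceT.
- by move=> _ [x /CS Sx <-]; exact: pS.
- by move=> x /fC Cx; exists (phi x).
Qed.

Lemma Cc_lshift y f : S y -> Cc f -> Cc (fun x => f (y * x)%g).
Proof.
move=> Sy; apply: (@Cc_comp _ _ (fun x => (y^-1 * x)%g)).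
- exact: mulgl_continuous.
- exact: mulgl_continuous.
- by move=> x; rewrite mulKg.
- by move=> x; apply: (subM hS); exact: (subV hS).
Qed.

Lemma Cc_rshift y f : S y -> Cc f -> Cc (fun x => f (x * y)%g).
Proof.
move=> Sy; apply: (@Cc_comp _ _ (fun x => (x * y^-1)%g)).
- exact: mulgr_continuous.
- exact: mulgr_continuous.
- by move=> x; rewrite mulgK.
- by move=> x Sx; apply: (subM hS) => //; exact: (subV hS).
Qed.

Lemma Cc_inv f : Cc f -> Cc (fun x => f x^-1%g).
Proof.
apply: (@Cc_comp _ _ (fun x => x^-1%g)).
- exact: invg_continuous.
- exact: invg_continuous.
- by move=> x; rewrite invgK.
- by move=> x; exact: (subV hS).
Qed.

Lemma Cc_indic A : open A -> closed A -> compact A -> A `<=` S -> Cc (fun x => \1_A x).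
Proof.
move=> oA cA kA AS; apply: (@Cc_intro _ A) => // [|x]; first exact: continuous_indic.
by move=> nx; apply: contrapT => nA; apply: nx; rewrite indicF.
Qed.

Lemma sub_cosets U s : U `<=` S -> (forall y, y \in s -> S y) -> cosets U s `<=` S.
Proof. by move=> US sS x [y /sS Sy /US Sxy]; rewrite -(mulVKg y x); exact: (subM hS). Qed.

Lemma Cc_cosets U s : cosub U -> U `<=` S -> (forall y, y \in s -> S y) ->
  Cc (fun x => \1_(cosets U s) x).
Proof.
move=> cU US sS; have [oA cA] := clopen_cosets s cU.
by apply: Cc_indic => //; [exact: compact_cosets|exact: sub_cosets].
Qed.

Lemma Cc_cover f U : Cc f -> cosub U -> exists2 s : seq L,
  (forall y, y \in s -> S y) & forall x, f x <> 0 -> cosets U s x.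
Proof.
move=> /Cc_support[C [cC CS fC]] cU; have [s sC Cs] := compact_cosets_cover cC cU.
by exists s => [y /sC/CS|x /fC/Cs].
Qed.

Lemma compact_envelope C : compact C -> C `<=` S ->
  exists A, [/\ C `<=` A, A `<=` S & Cc (fun x => \1_A x)].
Proof.
move=> cC CS; have [|U [cU _ US]] := @cosub_small setT; first exact: filterT.
have [s sC Cs] := compact_cosets_cover cC cU.
have sS y : y \in s -> S y by move=> /sC/CS.
by exists (cosets U s); split=> //; [exact: sub_cosets|exact: Cc_cosets].
Qed.

Lemma Cc_coset_indic U y : cosub U -> U `<=` S -> S y ->
  Cc (fun x => \1_[set x | U (y^-1 * x)%g] x).
Proof.
move=> cU US Sy; have [hU oU kU] := cU; apply: Cc_indic.
- exact: open_coset.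
- exact: closed_coset.
- exact: coset_compact.
- by move=> x /= /US Sx; rewrite -(mulVKg y x); exact: (subM hS).
Qed.

Lemma Cc_cosub_indic U : cosub U -> U `<=` S -> Cc (fun x => \1_U x).
Proof.
move=> [hU oU kU] US; apply: Cc_indic => //; exact: open_subgroup_closed.
Qed.

(** The support is covered by finitely many cosets [yU], and multiplication by the indicator of a
    clopen coset stays in [C_c]. The summands are kept disjointly supported because the [L^1] norm
    is additive only then. *)
Lemma Cc_ind U (P : (L -> cplx R) -> Prop) : cosub U -> U `<=` S ->
  (forall y f, S y -> Cc f -> (forall x, f x <> 0 -> U (y^-1 * x)%g) -> P f) ->
  (forall f g, Cc f -> Cc g -> (forall x, f x = 0 \/ g x = 0) -> P f -> P g -> P (f + g)) ->
  forall f, Cc f -> P f.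
Proof.
move=> cU US P1 PD f Cf; have [s] := Cc_cover Cf cU.
have [hU oU _] := cU.
elim: s f Cf => [|y s ih] f Cf sS fs.
  apply: (P1 1%g) => //; first exact: sub1.
  by move=> x /fs; rewrite cosets_nil.
have Sy : S y by apply: sS; rewrite mem_head.
pose A := [set x | U (y^-1 * x)%g].
have oA : open A by exact: open_coset.
have cA : closed A by exact: closed_coset.
pose f1 x : cplx R := \1_A x * f x; pose f2 x : cplx R := \1_(~` A) x * f x.
have fE : f = f1 + f2.
  apply/funext => x; rewrite !fctE /f1 /f2.
  have [Ax|nAx] := pselect (A x).
    by rewrite indicT // indicF /= ?mul1r ?mul0r ?addr0 // => /(_ Ax).
  by rewrite indicF // indicT /= ?mul1r ?mul0r ?add0r.
have C1 : Cc f1 by apply: CcMl => //; exact: continuous_indic.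
have C2 : Cc f2.
  by apply: CcMl => //; apply: continuous_indic; [exact: closed_openC|exact: open_closedC].
rewrite fE; apply: PD => //.
- move=> x; rewrite /f1 /f2; have [Ax|nAx] := pselect (A x).
    by right; rewrite indicF ?mul0r // => /(_ Ax).
  by left; rewrite indicF // mul0r.
- apply: (P1 y) => // x; rewrite /f1 => nz; apply: contrapT => nA.
  by apply: nz; rewrite indicF // mul0r.
- apply: ih => // [z zs|x]; first by apply: sS; rewrite inE zs orbT.
  rewrite /f2 => nz.
  have nA : ~ A x by move=> Ax; apply: nz; rewrite indicF ?mul0r // => /(_ Ax).
  have fx : f x <> 0 by move=> fx; apply: nz; rewrite fx mulr0.
  by have := fs x fx; rewrite cosets_cons => -[].
Qed.

(** Finitely many cosets [y W y] cover the support and [U] is the intersection of these subgroups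
    [W y]; being subgroups, they need not be shrunk for [x] and [x u] to lie in one coset. If only
    [x u] is in the support, the estimate is applied at [x u] with [u^-1]. *)
Lemma Cc_unif_r f (e : R) : Cc f -> 0 < e -> exists U,
  [/\ cosub U, U `<=` S & forall x u, U u -> rnorm (f (x * u)%g - f x) <= e].
Proof.
move=> Cf e0; have [C [cC CS fC]] := Cc_support Cf; have /fcontP fc := Cc_cont Cf.
have e20 : 0 < e / 2 by rewrite divr_gt0.
have /choice[W hW] : forall x, exists U, [/\ cosub U, U `<=` S &
    forall u, U u -> rnorm (f x - f (x * u)%g) <= e / 2].
  move=> x; have := fc x _ e20; rewrite -{1}[x]mulg1 => /nbhs_mull/cosub_small[U [cU UV US]].
  by exists U; split => // u /UV.
have [i _|x Cx|D' D'C CD'] := compact_cover_pt (1%g : L) cC (D := C)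
   (f := fun x => [set y | W x (x^-1 * y)%g]).
- by have [[hU oU _] _ _] := hW i; exact: open_coset.
- by exists x => //=; rewrite mulVg; have [[hU _ _] _ _] := hW x; exact: sub1.
have [U0 [cU0 _ U0S]] := @cosub_small setT filterT.
have [U [cU US UW]] : exists U, [/\ cosub U, U `<=` S &
    forall y, y \in finmap.enum_fset D' -> U `<=` W y].
  elim: (finmap.enum_fset D') => [|y s [U [cU US UW]]]; first by exists U0.
  have [cW WS _] := hW y; exists (U `&` W y); split; first exact: cosubI.
    by move=> x [/US].
  by move=> z; rewrite inE => /predU1P[-> x []|/UW UWz x [/UWz]].
have key x u : C x -> U u -> rnorm (f (x * u)%g - f x) <= e.
  move=> Cx Uu; have [y yD /= xy] := CD' x Cx; have Wu := UW y yD u Uu.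
  have [[hU _ _] _ hy] := hW y.
  have := hy _ (subM hU xy Wu); have := hy _ xy; rewrite !mulgA mulgV mul1g => h1 h2.
  have := rnormB (f (x * u)%g) (f y) (f x); rewrite [rnorm (f (x * u)%g - f y)]rnormBC.
  lra.
exists U; split=> // x u Uu.
have [Cx|nCx] := pselect (C x); first exact: key.
have [Cxu|nCxu] := pselect (C (x * u)%g).
  have hU : is_subgroup U by case: cU.
  by have := key _ _ Cxu (subV hU Uu); rewrite mulgK rnormBC.
have f0 z : ~ C z -> f z = 0 by move=> nC; apply: contrapT => /fC.
by rewrite !f0 // subrr rnorm0 ltW.
Qed.

Lemma Cc_unif_l f (e : R) : Cc f -> 0 < e -> exists U,
  [/\ cosub U, U `<=` S & forall x u, U u -> rnorm (f (u * x)%g - f x) <= e].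
Proof.
move=> Cf e0; have [U [cU US hU]] := Cc_unif_r (Cc_inv Cf) e0; exists U; split=> // x u Uu.
have hsU : is_subgroup U by case: cU.
by have := hU x^-1%g u^-1%g (subV hsU Uu); rewrite invgM !invgK.
Qed.

Lemma continuous_unif_r (f : L -> cplx R) :
  (forall e : R, 0 < e -> exists U,
    cosub U /\ forall x u, U u -> rnorm (f (x * u)%g - f x) <= e) -> continuous f.
Proof.
move=> hf; apply/fcontP => x e e0; have [U [cU fU]] := hf e e0.
apply: filterS (nbhs_coset x (cosub_nbhs cU)) => y /= /(fU x).
by rewrite mulVKg rnormBC.
Qed.

End CompactSupport.


Opaque Cc.

(** * Estimates for the Haar functional *)

Section Haar.
Variables (R : realType) (L : topGroupType) (S : set L) (I : (L -> cplx R) -> cplx R).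
Hypothesis h : haar_setting S I.
Local Notation Cc := (@Cc R L S).
Implicit Types (f g : L -> cplx R).
Let hS := hsS h.

Definition L1norm f : R := complex.Re (I (fun x => (rnorm (f x))%:C)).
Definition haar_mu (A : set L) : R := complex.Re (I (fun x => \1_A x)).

Lemma I_lin (k : R[i]) f g : Cc f -> Cc g -> I (k *: f + g) = k * I f + I g.
Proof. by case: (hsI h) => + _ _; apply. Qed.

Lemma I_pos f : Cc f -> (forall x, 0 <= f x) -> 0 <= I f.
Proof. by case: (hsI h) => _ + _; apply. Qed.

Lemma I_left s f : S s -> Cc f -> I (fun x => f (s * x)%g) = I f.
Proof. by case: (hsI h) => _ _; apply. Qed.

Lemma I0 : I 0 = 0.
Proof.
have := I_lin (-1) (Cc0 h) (Cc0 h).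
by rewrite scaler0 addr0 mulN1r addNr.
Qed.

Lemma ID f g : Cc f -> Cc g -> I (f + g) = I f + I g.
Proof. by move=> Cf Cg; have := I_lin 1 Cf Cg; rewrite scale1r mul1r. Qed.

Lemma IZ (k : R[i]) f : Cc f -> I (k *: f) = k * I f.
Proof. by move=> Cf; have := I_lin k Cf (Cc0 h); rewrite I0 !addr0. Qed.

Lemma IB f g : Cc f -> Cc g -> I (f - g) = I f - I g.
Proof.
by move=> Cf Cg; have := I_lin (-1) Cg Cf; rewrite scaleN1r mulN1r addrC => ->; rewrite addrC.
Qed.

Lemma I_le (f g : L -> R) : Cc (fun x => (f x)%:C) -> Cc (fun x => (g x)%:C) ->
  (forall x, f x <= g x) -> I (fun x => (f x)%:C) <= I (fun x => (g x)%:C).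
Proof.
move=> Cf Cg fg; rewrite -subr_ge0 -IB //; apply: I_pos => [|x]; first exact: (CcB h).
by rewrite !fctE -rcN -rcD ler0c subr_ge0.
Qed.

(** Nonnegative elements of [R[i]] are real, so [I |f|] and [I |f| - I f] are real, and with them
    [I f]. *)
Lemma I_real (f : L -> R) : Cc (fun x => (f x)%:C) ->
  I (fun x => (f x)%:C) = (complex.Re (I (fun x => (f x)%:C)))%:C.
Proof.
move=> Cf; have Cn := Cc_rnorm h Cf.
pose n x := rnorm ((f x)%:C : cplx R).
have I1 : 0 <= I (fun x => (n x)%:C).
  by apply: I_pos => // x; rewrite ler0c rnorm_ge0.
have I2 : I (fun x => (f x)%:C) <= I (fun x => (n x)%:C).
  by apply: I_le => // x; apply: le_trans (ler_norm _) (Re_le_rnorm ((f x)%:C : cplx R)).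
rewrite RRe_real //; move: (ger0_real I1) I2; rewrite -subr_ge0 => r1 /ger0_real r2.
by rewrite -[X in X \is _](subKr (I (fun x => (n x)%:C))) realB.
Qed.

Lemma Cc_Re f : Cc f -> Cc (fun x => (complex.Re (f x))%:C).
Proof.
move=> Cf; have [C [cC CS fC]] := Cc_support h Cf.
apply: (Cc_intro h (continuous_rc (Cc_cont Cf) _) cC CS) => [x y|x].
  by rewrite -raddfB; exact: Re_le_rnorm.
by have [->|fx _] := pselect (f x = 0); [|exact: fC].
Qed.

Lemma Cc_Im f : Cc f -> Cc (fun x => (complex.Im (f x))%:C).
Proof.
move=> Cf; have [C [cC CS fC]] := Cc_support h Cf.
apply: (Cc_intro h (continuous_rc (Cc_cont Cf) _) cC CS) => [x y|x].
  by rewrite -raddfB; exact: Im_le_rnorm.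
by have [->|fx _] := pselect (f x = 0); [|exact: fC].
Qed.

Lemma I_ReIm f : Cc f ->
  I f = (complex.Re (I (fun x => (complex.Re (f x))%:C)))%:C +
        'i%C * (complex.Re (I (fun x => (complex.Im (f x))%:C)))%:C.
Proof.
move=> Cf; have Cr := Cc_Re Cf; have Ci := Cc_Im Cf.
rewrite -!I_real // addrC -I_lin //; congr I; apply/funext => x.
by rewrite !fctE [in LHS](complexE (f x)) addrC.
Qed.

Lemma I_conj f : Cc f -> I (fun x => (f x)^*%R) = (I f)^*%R.
Proof.
move=> Cf; have Cr := Cc_Re Cf; have Ci := Cc_Im Cf.
have -> : (fun x => (f x)^*%R) = (- 'i%C) *: (fun x => (complex.Im (f x))%:C : cplx R) +
    (fun x => (complex.Re (f x))%:C : cplx R).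
  apply/funext => x; rewrite !fctE; case: (f x) => a b /=.
  by rewrite /GRing.scale /=; simpc.
rewrite I_lin // [in RHS](I_ReIm Cf) conjcD conjcM !conj_real -!I_real // addrC.
by congr (_ + _ * _); simpc.
Qed.

Lemma L1norm_ge0 f : Cc f -> 0 <= L1norm f.
Proof.
move=> Cf; rewrite -ler0c -I_real; last exact: (Cc_rnorm h).
by apply: I_pos => [|x]; [exact: (Cc_rnorm h)|rewrite ler0c rnorm_ge0].
Qed.

(** Multiplication by a unimodular [c] with [c I(f) = |I(f)|] reduces the claim to the real part of
    [c f], which is at most [|f|]. *)
Lemma I_norm f : Cc f -> rnorm (I f) <= L1norm f.
Proof.
move=> Cf; have [->|z0] := eqVneq (I f) 0; first by rewrite rnorm0 L1norm_ge0.
pose c := (I f)^*%R / (rnorm (I f))%:C.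
have n0 : (rnorm (I f))%:C != 0 :> R[i] by rewrite rnormE normr_eq0.
have cn : `|c| = 1.
  by rewrite /c rnormE normrM normfV norm_conjC normr_id divff // -rnormE.
have cE : I (c *: f) = (rnorm (I f))%:C.
  rewrite IZ // /c mulrAC [_^*%R * _]mulrC -normCK -rnormE.
  by rewrite expr2 mulfK.
have Cg : Cc (c *: f) by exact: (CcZ h).
have := I_ReIm Cg; rewrite cE => /(congr1 (@complex.Re R)).
rewrite raddfD /= !(mul0r, mul1r, subr0, sub0r, oppr0, addr0) => ->.
rewrite -lecR -!I_real; [|exact: (Cc_rnorm h)|exact: Cc_Re].
apply: I_le => [||x]; [exact: Cc_Re|exact: (Cc_rnorm h)|].
apply: le_trans (ler_norm _) _; apply: le_trans (Re_le_rnorm _) _.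
by rewrite fctE rnormZ -[rnorm c]/(complex.Re `|c|) cn mul1r.
Qed.

Lemma L1norm_disjoint f g : Cc f -> Cc g -> (forall x, f x = 0 \/ g x = 0) ->
  L1norm (f + g) = L1norm f + L1norm g.
Proof.
move=> Cf Cg fg; rewrite /L1norm -raddfD -ID; try exact: (Cc_rnorm h).
congr (complex.Re (I _)); apply/funext => x; rewrite !fctE -rcD.
by case: (fg x) => ->; rewrite rnorm0 ?add0r ?addr0.
Qed.

Lemma I_indic A : Cc (fun x => \1_A x) -> I (fun x => \1_A x) = (haar_mu A)%:C.
Proof.
move=> CA; rewrite /haar_mu.
have E : (fun x => \1_A x : cplx R) = (fun x => (\1_A x : R)%:C).
  by apply/funext => x; rewrite !indicE; case: (_ \in _).
by rewrite E -I_real // -E.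
Qed.

Lemma haar_mu_ge0 A : Cc (fun x => \1_A x) -> 0 <= haar_mu A.
Proof.
by move=> CA; rewrite -ler0c -I_indic //; apply: I_pos.
Qed.

Lemma L1norm_bound f A (e : R) : Cc f -> Cc (fun x => \1_A x) ->
  (forall x, f x <> 0 -> A x) -> (forall x, rnorm (f x) <= e) -> L1norm f <= e * haar_mu A.
Proof.
move=> Cf CA fA fe.
rewrite -lecR rcM -I_indic // -IZ // -I_real; last exact: (Cc_rnorm h).
have E : e%:C *: (fun x => \1_A x : cplx R) = (fun x => (e * \1_A x)%:C).
  apply/funext => x; rewrite fctE !indicE rcM; case: (_ \in _) => //.
rewrite E; apply: I_le => [||x]; first exact: (Cc_rnorm h).
  by rewrite -E; exact: (CcZ h).
have [fx|fx] := pselect (f x = 0); last by rewrite indicE mem_set ?mulr1 //; exact: fA.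
by rewrite fx rnorm0 indicE mulr_ge0 // ?ler0n // (le_trans (rnorm_ge0 _) (fe x)).
Qed.

Lemma I_bound f A (e : R) : Cc f -> Cc (fun x => \1_A x) ->
  (forall x, f x <> 0 -> A x) -> (forall x, rnorm (f x) <= e) -> rnorm (I f) <= e * haar_mu A.
Proof. by move=> Cf CA fA fe; exact: le_trans (I_norm Cf) (L1norm_bound Cf CA fA fe). Qed.

Lemma Cc_bounded f : Cc f -> exists2 M : R, 0 <= M & forall x, rnorm (f x) <= M.
Proof.
move=> Cf; have [U [cU US fU]] := Cc_unif_r h Cf ltr01.
have [s _ fs] := Cc_cover h Cf cU.
suff [M M0 fM] : exists2 M : R, 0 <= M & forall y, y \in s -> rnorm (f y) <= M.
  exists (M + 1) => [|x]; first by rewrite addr_ge0.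
  have [->|fx] := pselect (f x = 0); first by rewrite rnorm0 addr_ge0.
  have [y /fM yM yx] := fs x fx; have := fU y _ yx; rewrite mulVKg.
  by have := rnormB (f x) (f y) 0; rewrite !subr0; lra.
elim: s {fs} => [|y s [M M0 fM]]; first by exists 0.
exists (M + rnorm (f y)); first by rewrite addr_ge0 // rnorm_ge0.
move=> z; rewrite inE => /predU1P[->|/fM]; first by rewrite lerDr.
by move/le_trans; apply; rewrite lerDl rnorm_ge0.
Qed.

Lemma haar_mu_coset U y : cosub U -> U `<=` S -> S y ->
  haar_mu [set x | U (y^-1 * x)%g] = haar_mu U.
Proof.
move=> cU US Sy; rewrite /haar_mu -[in RHS](@I_left y^-1%g (fun x => \1_U x)).
- by [].
- exact: subV.
- exact: (Cc_cosub_indic h).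
Qed.

(** If [U] had measure 0, so would its cosets; by [Cc_ind] the functional would vanish on [C_c],
    against [hsN]. *)
Lemma haar_mu_gt0 U : cosub U -> U `<=` S -> 0 < haar_mu U.
Proof.
move=> cU US; rewrite lt_neqAle haar_mu_ge0 ?andbT; last exact: (Cc_cosub_indic h).
apply/negP => /eqP/esym mu0; have [f [Cf nz]] := hsN h; apply: nz; move: f Cf.
apply: (Cc_ind h cU US) => [y f Sy Cf fU|f g Cf Cg fg If Ig]; last by rewrite ID // If Ig addr0.
have [M M0 fM] := Cc_bounded Cf; apply: rnorm0_eq0; apply/eqP.
rewrite eq_le rnorm_ge0 andbT.
have := I_bound Cf (Cc_coset_indic h cU US Sy) fU fM.
by rewrite haar_mu_coset // mu0 mulr0.
Qed.

(** Where [f x] is positive, [f] is at least [f x / 2] on a coset of a compact open subgroup, which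
    has positive measure. *)
Lemma I_eq0 f : Cc f -> (forall x, 0 <= f x) -> I f = 0 -> f = 0.
Proof.
move=> Cf f0 If; apply/funext => x; apply: contrapT => fx.
have fE y : f y = (complex.Re (f y))%:C by rewrite RRe_real // ger0_real.
have e0 : 0 < complex.Re (f x) / 2.
  rewrite divr_gt0 // lt_neqAle -ler0c -fE f0 andbT; apply/eqP => e.
  by apply: fx; rewrite fE -e.
have [U [cU US fU]] := Cc_unif_r h Cf e0.
have Sx : S x by exact: (Cc_in Cf).
have CA := Cc_coset_indic h cU US Sx.
pose A := [set y | U (x^-1 * y)%g].
have E : (complex.Re (f x) / 2)%:C *: (fun y => \1_A y : cplx R) =
    (fun y => (complex.Re (f x) / 2 * \1_A y)%:C).
  by move: (_ / 2) => e; apply/funext => y; rewrite fctE !indicE rcM; case: (_ \in _).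
have : I ((complex.Re (f x) / 2)%:C *: (fun y => \1_A y : cplx R)) <= I f.
  rewrite E (funext fE); apply: I_le => [||y].
  - by rewrite -E; exact: (CcZ h).
  - by rewrite -(funext fE).
  have [Ay|nAy] := pselect (A y).
    rewrite indicE mem_set // mulr1; have := fU x _ Ay; rewrite mulVKg => h1.
    have := Re_le_rnorm (f y - f x); rewrite raddfB ler_norml; lra.
  by rewrite indicE memNset // mulr0 -ler0c -fE.
rewrite IZ // I_indic // haar_mu_coset // -rcM If -[X in _ <= X]/((0 : R)%:C) lecR leNgt.
by rewrite mulr_gt0 // haar_mu_gt0.
Qed.

End Haar.

(** * Convolution *)

Section Convolution.
Variables (R : realType) (L : topGroupType) (S : set L) (I : (L -> cplx R) -> cplx R).
Hypothesis h : haar_setting S I.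
Local Notation Cc := (@Cc R L S).
Local Notation conv := (Defs.conv I).
Let hS := hsS h.
Implicit Types (f g : L -> cplx R) (U : set L).

Definition lsh (y : L) f : L -> cplx R := fun x => f (y^-1 * x)%g.

Definition left_inv U f : Prop := forall u x, U u -> f (u * x)%g = f x.

Lemma lshM y z f : lsh y (lsh z f) = lsh (y * z)%g f.
Proof. by apply/funext => x; rewrite /lsh !group_simp. Qed.

Lemma Cc_lsh y f : S y -> Cc f -> Cc (lsh y f).
Proof. by move=> Sy; apply: (Cc_lshift h); exact: (subV hS). Qed.

Lemma I_lsh y f : S y -> Cc f -> I (lsh y f) = I f.
Proof. by move=> Sy; apply: (I_left h); exact: (subV hS). Qed.

Lemma left_inv_lsh U y f : left_inv U f -> left_inv (conj_by y U) (lsh y f).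
Proof.
move=> fU u x; rewrite /conj_by /lsh /= => Uu.
by rewrite -(fU _ (y^-1 * x)%g Uu) !group_simp.
Qed.

Lemma inv_mul_continuous x : continuous (fun y : L => (y^-1 * x)%g).
Proof.
move=> y; apply: (@continuous_comp _ _ _ (fun y : L => y^-1%g) (fun y => (y * x)%g)).
  exact: invg_continuous.
exact: mulgr_continuous.
Qed.

Lemma inv_mul_comp g x : continuous g -> continuous (fun y => g (y^-1 * x)%g).
Proof.
move=> gc y.
by apply: (@continuous_comp _ _ _ (fun y : L => (y^-1 * x)%g) g); [exact: inv_mul_continuous|exact: gc].
Qed.

Lemma conv_integrand f g x : Cc f -> continuous g -> Cc (fun y => f y * g (y^-1 * x)%g).
Proof.
by move=> Cf gc; apply: (CcMr h Cf); exact: inv_mul_comp.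
Qed.

Lemma conv_linl (k : R[i]) f f' g : Cc f -> Cc f' -> continuous g ->
  conv (k *: f + f') g = k *: conv f g + conv f' g.
Proof.
move=> Cf Cf' gc; apply/funext => x.
apply: (etrans _ (I_lin h k (conv_integrand x Cf gc) (conv_integrand x Cf' gc))).
by congr I; apply/funext => y; rewrite !fctE mulrDl scalerAl.
Qed.

Lemma conv_linr (k : R[i]) f g g' : Cc f -> continuous g -> continuous g' ->
  conv f (k *: g + g') = k *: conv f g + conv f g'.
Proof.
move=> Cf gc gc'; apply/funext => x.
apply: (etrans _ (I_lin h k (conv_integrand x Cf gc) (conv_integrand x Cf gc'))).
by congr I; apply/funext => y; rewrite !fctE mulrDr -scalerAr.
Qed.

Lemma I_mul_bound f (phi : L -> cplx R) (e : R) : Cc f -> continuous phi ->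
  (forall x, rnorm (phi x) <= e) -> rnorm (I (fun x => f x * phi x)) <= e * L1norm I f.
Proof.
move=> Cf pc pe; have Cfp := CcMr h Cf pc.
apply: le_trans (I_norm h Cfp) _; rewrite -lecR rcM.
have Cn := Cc_rnorm h Cf; have Cn' := Cc_rnorm h Cfp.
rewrite /L1norm -(I_real h Cn') -(I_real h Cn) -(IZ h _ Cn).
have E : e%:C *: (fun x => (rnorm (f x))%:C : cplx R) = (fun x => (e * rnorm (f x))%:C).
  by apply/funext => x; rewrite fctE rcM.
have Ce := CcZ h e%:C Cn; rewrite E in Ce *; apply: (I_le h Cn' Ce) => x.
by rewrite rnormM mulrC ler_wpM2r // rnorm_ge0.
Qed.

(** Uniform continuity passes from [g] to the convolution at the cost of the factor [||f||_1]; the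
    support lies in the product of the two compact supports. *)
Lemma Cc_conv f g : Cc f -> Cc g -> Cc (conv f g).
Proof.
move=> Cf Cg; have gc := Cc_cont Cg.
have [C [cC CS fC]] := Cc_support h Cf; have [C' [cC' CS' gC]] := Cc_support h Cg.
apply: (@Cc_intro _ _ _ _ h _ ((fun z : L * L => (z.1 * z.2)%g) @` (C `*` C'))).
- apply: continuous_unif_r => e e0.
  have n0 : 0 < L1norm I f + 1 by rewrite ltr_wpDl // (L1norm_ge0 h).
  have [U [cU US gU]] := Cc_unif_r h Cg (divr_gt0 e0 n0); exists U; split=> // x u Uu.
  rewrite /Defs.conv -(IB h); try exact: conv_integrand.
  have -> : (fun y => f y * g (y^-1 * (x * u))%g) - (fun y => f y * g (y^-1 * x)%g) =
      (fun y => f y * (g (y^-1 * (x * u))%g - g (y^-1 * x)%g)) :> (L -> cplx R).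
    by apply/funext => y; rewrite !fctE mulrBr.
  pose phi y : cplx R := g (y^-1 * (x * u))%g - g (y^-1 * x)%g.
  have phic : continuous phi.
    by move=> y; apply: cvgB; exact: inv_mul_comp.
  have phie y : rnorm (phi y) <= e / (L1norm I f + 1) by rewrite /phi mulgA; exact: gU.
  apply: le_trans (I_mul_bound Cf phic phie) _.
  by rewrite mulrAC ler_pdivrMr // ler_wpM2l ?ltW //; lra.
- apply: continuous_compact; last exact: compact_setX.
  by apply: continuous_subspaceT; exact: mulg_continuous.
- by move=> _ [[a b] /= [/CS Sa /CS' Sb] <-]; exact: (subM hS).
- move=> x nz; apply: contrapT => nC; apply: nz; rewrite /Defs.conv.
  rewrite (_ : (fun y => _) = 0) ?(I0 h) //; apply/funext => y.
  have [->|fy] := pselect (f y = 0); first by rewrite mul0r.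
  have [->|gy] := pselect (g (y^-1 * x)%g = 0); first by rewrite mulr0.
  by case: nC; exists (y, (y^-1 * x)%g) => /=; [split; [exact: fC|exact: gC]|rewrite mulVKg].
Qed.

Lemma conv_lmul k (c : cplx R) f g : S k -> Cc f -> continuous g ->
  (forall x, f (k * x)%g = c * f x) -> forall x, conv f g (k * x)%g = c * conv f g x.
Proof.
move=> Sk Cf gc fk x; rewrite /Defs.conv -(I_left h Sk); last exact: conv_integrand.
rewrite -(IZ h); last exact: conv_integrand.
by congr I; apply/funext => y; rewrite fctE !group_simp fk scalerAl.
Qed.

Lemma conv_rmul k (c : cplx R) f g : Cc f -> continuous g ->
  (forall x, g (x * k)%g = g x * c) -> forall x, conv f g (x * k)%g = conv f g x * c.
Proof.
move=> Cf gc gk x; rewrite /Defs.conv mulrC -(IZ h); last exact: conv_integrand.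
by congr I; apply/funext => y; rewrite fctE mulgA gk mulrA mulrC.
Qed.

(** On the support of [f] the element [z^-1 y] is in [U], and [z^-1 x = (z^-1 y)(y^-1 x)]; so [g]
    takes the value [g (y^-1 x)] throughout and leaves the integral. *)
Lemma conv_single U y f g : continuous g -> left_inv U g -> Cc f ->
  (forall x, f x <> 0 -> U (y^-1 * x)%g) -> is_subgroup U -> conv f g = I f *: lsh y g.
Proof.
move=> gc gU Cf fU hU; apply/funext => x.
apply: (etrans _ (mulrC (lsh y g x : R[i]) (I f))).
apply: (etrans _ (IZ h (lsh y g x) Cf)); congr I; apply/funext => z; rewrite fctE.
have [->|fz] := pselect (f z = 0); first by rewrite mul0r scaler0.
apply: (etrans _ (mulrC (f z : R[i]) (lsh y g x))); congr (_ * _); rewrite /lsh.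
by rewrite -(gU _ (z^-1 * x)%g (fU z fz)) !group_simp.
Qed.

(* On a function f living on a coset yU, conv f g is close to (I f) L_y g when g
   is nearly left U-invariant. *)
Lemma I_conv f g : Cc f -> Cc g -> I (conv f g) = I f * I g.
Proof.
move=> Cf Cg; have gc := Cc_cont Cg.
have [U0 [cU0 _ U0S]] := @cosub_small _ _ _ _ h setT filterT.
have [C [cC CS gC]] := Cc_support h Cg.
have hU0 : is_subgroup U0 by case: cU0.
(* For [f] on a coset [yU] with [U] inside [U0], both [f * g] and [L_y g] live on [yA], whose
   measure does not depend on [U] or [y]. *)
have [A [CA AS Ai]] : exists A, [/\ (fun z : L * L => (z.1 * z.2)%g) @` (U0 `*` C) `<=` A, A `<=` S &
    Cc (fun x => \1_A x)].
  apply: (compact_envelope h); last by move=> _ [[a b] /= [/U0S Sa /CS Sb] <-]; exact: (subM hS).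
  apply: continuous_compact; first by apply: continuous_subspaceT; exact: mulg_continuous.
  by apply: compact_setX => //; case: cU0.
apply/eqP; rewrite -subr_eq0; apply/eqP/rnorm_le_eq0 => e e0.
pose M := haar_mu I A * L1norm I f + 1.
have M0 : 0 < M by rewrite ltr_wpDl // mulr_ge0 ?(haar_mu_ge0 h) ?(L1norm_ge0 h).
pose d := e / M; have d0 : 0 < d by rewrite divr_gt0.
(* The factor [||f||_1] makes the right side additive over disjointly supported [f], as [Cc_ind]
   requires; a bound with a fixed constant would grow with the number of cosets. *)
suff H : rnorm (I (conv f g) - I f * I g) <= d * haar_mu I A * L1norm I f.
  apply: le_trans H _; rewrite /d -mulrA mulrAC ler_pdivrMr //.
  by apply: ler_wpM2l; [exact: ltW|rewrite /M lerDl].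
have [U1 [cU1 US1 gU1]] := Cc_unif_l h Cg d0.
pose U := U0 `&` U1; have cU : cosub U by exact: cosubI.
have US : U `<=` S by move=> x [/U0S].
clearbody d; clear M M0; move: f Cf.
apply: (Cc_ind h cU US) => [y f Sy Cf fU|f1 f2 C1 C2 f12 H1 H2]; last first.
  have := conv_linl 1 C1 C2 gc; rewrite !scale1r => ->.
  rewrite (ID h (Cc_conv C1 Cg) (Cc_conv C2 Cg)) (ID h C1 C2).
  rewrite (L1norm_disjoint h C1 C2 f12) mulrDl opprD addrACA mulrDr.
  by apply: le_trans (rnormD _ _) _; rewrite lerD.
have Cl := Cc_lsh Sy Cg.
have Cfg := Cc_conv Cf Cg; have Cz := CcZ h (I f) Cl.
rewrite -(I_lsh Sy Cg) -(IZ h _ Cl) -(IB h Cfg Cz).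
have SA x : [set z | A (y^-1 * z)%g] x -> S x.
  by move=> /= /AS SyA; rewrite -(mulVKg y x); exact: (subM hS).
have Ay : Cc (fun x => \1_[set z | A (y^-1 * z)%g] x) := Cc_lsh Sy Ai.
have -> : haar_mu I A = haar_mu I [set z | A (y^-1 * z)%g].
  by rewrite /haar_mu -(I_lsh Sy Ai).
rewrite -mulrA [haar_mu _ _ * _]mulrC mulrA.
apply: (I_bound h (CcB h Cfg Cz) Ay).
- move=> x /= nz; apply: contrapT => nA; apply: nz; rewrite !fctE.
  have g0 u : U u -> g (u^-1 * (y^-1 * x))%g = 0.
    move=> [Uu _]; apply: contrapT => /gC Cu; apply: nA; apply: CA.
    by exists (u, (u^-1 * (y^-1 * x))%g) => //=; rewrite mulVKg.
  have -> : lsh y g x = 0.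
    have U1' : U 1%g by case: cU => hU _ _; exact: sub1.
    by have := g0 1%g U1'; rewrite invg1 mul1g.
  rewrite scaler0 subr0 /Defs.conv (_ : (fun z => _) = 0) ?(I0 h) //; apply/funext => z.
  have [->|fz] := pselect (f z = 0); first by rewrite mul0r.
  by have := g0 _ (fU z fz); rewrite !group_simp => ->; rewrite mulr0.
- move=> x; rewrite !fctE [I f *: _]mulrC /Defs.conv -(IZ h _ Cf).
  rewrite -(IB h (conv_integrand x Cf gc) (CcZ h (lsh y g x) Cf)).
  pose V := [set z | U (y^-1 * z)%g].
  have [hU oU _] := cU.
  have cV : continuous (fun z => \1_V z : cplx R).
    by apply: continuous_indic; [exact: open_coset|exact: closed_coset].
  have -> : (fun z => f z * g (z^-1 * x)%g) - lsh y g x *: f =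
     (fun z => f z * (\1_V z * (g (z^-1 * x)%g - lsh y g x))) :> (L -> cplx R).
    apply/funext => z; rewrite !fctE.
    have [->|fz] := pselect (f z = 0); first by rewrite !mul0r scaler0 subr0.
    by rewrite indicT ?mul1r ?mulrBr; [rewrite [lsh y g x *: _]mulrC|exact: fU].
  apply: (I_mul_bound Cf).
  + apply: (continuous_fM cV) => z; apply: cvgB; last exact: cvg_cst.
    exact: inv_mul_comp.
  + move=> z; have [Vz|nV] := pselect (V z); last by rewrite indicF // mul0r rnorm0 ltW.
    rewrite indicT // mul1r /lsh.
    have [_ Uz] := subV hU Vz.
    by have := gU1 (y^-1 * x)%g _ Uz; rewrite !group_simp.
Qed.

(* Left U-invariance of k reduces the claim to g living on a coset zU, for which
   conv g k = (I g) L_z k. *)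
Lemma conv_assoc U f g k : cosub U -> U `<=` S -> Cc f -> Cc g -> Cc k -> left_inv U k ->
  conv (conv f g) k = conv f (conv g k).
Proof.
move=> cU US Cf Cg Ck kU; have kc := Cc_cont Ck; have hU : is_subgroup U by case: cU.
move: g Cg f Cf; apply: (Cc_ind h cU US) => [z g Sz Cg gU|g1 g2 C1 C2 _ H1 H2 f Cf]; last first.
  have := conv_linl 1 C1 C2 kc; rewrite !scale1r => ->.
  have := conv_linr 1 Cf (Cc_cont C1) (Cc_cont C2); rewrite !scale1r => ->.
  have [C1k C2k] : Cc (conv g1 k) /\ Cc (conv g2 k) by split; exact: Cc_conv.
  have := conv_linr 1 Cf (Cc_cont C1k) (Cc_cont C2k); rewrite !scale1r => ->.
  have := conv_linl 1 (Cc_conv Cf C1) (Cc_conv Cf C2) kc; rewrite !scale1r => ->.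
  by rewrite H1 // H2.
rewrite (conv_single kc kU Cg gU hU).
(* [L_z k] is left invariant under [z U z^-1], so [f] has to be cut along cosets of this conjugate;
   then [f * g] lives on the single coset [yzU]. *)
pose U' := conj_by z U; have cU' : cosub U' by exact: cosub_conj.
have hU' : is_subgroup U' by case: cU'.
have US' : U' `<=` S.
  move=> x /US Sx; rewrite -(mulgK z x); apply: (subM hS) (subV hS Sz).
  by rewrite -(mulVKg z (x * z)%g); apply: (subM hS Sz); rewrite mulgA.
have kl : left_inv U' (lsh z k) by exact: left_inv_lsh.
have Cl := Cc_lsh Sz Ck; have lc := Cc_cont Cl.
apply: (Cc_ind h cU' US') => [y f Sy Cf fU|f1 f2 C1 C2 _ H1 H2]; last first.
  have := conv_linl 1 C1 C2 (Cc_cont Cg); rewrite !scale1r => ->.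
  have := conv_linl 1 (Cc_conv C1 Cg) (Cc_conv C2 Cg) kc; rewrite !scale1r => ->.
  have := conv_linl 1 C1 C2 (Cc_cont (CcZ h (I g) Cl)); rewrite !scale1r => ->.
  by rewrite H1 H2.
have fgU x : conv f g x <> 0 -> U ((y * z)^-1 * x)%g.
  move=> nz; apply: contrapT => nU; apply: nz; rewrite /Defs.conv.
  rewrite (_ : (fun w => _) = 0) ?(I0 h) //; apply/funext => w.
  have [->|/fU fw] := pselect (f w = 0); first by rewrite mul0r.
  have [->|/gU gw] := pselect (g (w^-1 * x)%g = 0); first by rewrite mulr0.
  by case: nU; move: (subM hU fw gw); rewrite !group_simp.
rewrite (conv_single kc kU (Cc_conv Cf Cg) fgU hU) I_conv //.
have := conv_linr (I g) Cf lc (Cc_cont (Cc0 h)); rewrite addr0 => ->.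
rewrite (conv_single lc kl Cf fU hU') lshM scalerA mulrC.
suff -> : conv f 0 = 0 by rewrite addr0.
apply/funext => x; rewrite /Defs.conv (_ : (fun w => _) = 0) ?(I0 h) //.
by apply/funext => w; rewrite mulr0.
Qed.

End Convolution.

(** * The modular function and the involution *)

Section Modular.
Variables (R : realType) (L : topGroupType) (S : set L) (I : (L -> cplx R) -> cplx R).
Variable Delta : L -> cplx R.
Hypothesis h : haar_setting S I.
Hypothesis hD : is_modular_function S I Delta.
Local Notation Cc := (@Cc R L S).
Local Notation conv := (Defs.conv I).
Local Notation star := (conv_star Delta).
Let hS := hsS h.
Implicit Types (f g : L -> cplx R) (U : set L).

Lemma Delta_gt0 y : S y -> 0 < Delta y. Proof. by move=> /hD[]. Qed.

Lemma Delta_neq0 y : S y -> Delta y != 0.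
Proof. by move=> /Delta_gt0 d; rewrite gt_eqF. Qed.

Lemma modularE y f : S y -> Cc f -> Delta y * I (fun x => f (x * y)%g) = I f.
Proof. by move=> /hD[_]; apply. Qed.

Lemma Delta_conj y : S y -> (Delta y)^*%R = Delta y.
Proof. by move=> /Delta_gt0 d; apply: conj_Creal; rewrite gtr0_real. Qed.

(** The defining identity for [y], [z] and [yz] is used on translates of [g(x) = f(x (yz)^-1)];
    translation of [g] by [yz] returns [f], and [I f], being nonzero, cancels. *)
Lemma DeltaM y z : S y -> S z -> Delta (y * z)%g = Delta y * Delta z.
Proof.
move=> Sy Sz; have Syz := subM hS Sy Sz; have Syz' := subV hS Syz.
have [f [Cf nz]] := hsN h; have Cg := Cc_rshift h Syz' Cf.
pose g x := f (x * (y * z)^-1)%g.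
have e1 := modularE Syz Cg; have e2 := modularE Sz Cg.
have e3 := modularE Sy (Cc_rshift h Sz Cg).
have E : (fun x => f (x * (y * z) * (y * z)^-1)%g) = f.
  by apply/funext => x; rewrite mulgK.
rewrite /= E in e1; rewrite /= in e2.
have E' : (fun x => f (x * y * z * (y * z)^-1)%g) = f.
  by apply/funext => x; rewrite !group_simp.
rewrite /= E' in e3; apply: (mulIf (x := (I f : R[i]))); first exact/eqP.
by rewrite -mulrA mulrCA e3 e2 e1.
Qed.

(** The indicator of [U] is unchanged by right translation by [u], and its integral is positive. *)
Lemma Delta_cosub U u : cosub U -> U `<=` S -> U u -> Delta u = 1.
Proof.
move=> cU US Uu; have hU : is_subgroup U by case: cU.
have Ci := @Cc_cosub_indic R _ _ _ h U cU US.
have := modularE (US _ Uu) Ci.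
have -> : (fun x => \1_U (x * u)%g) = (fun x => \1_U x) :> (L -> cplx R).
  apply/funext => x; have [Ux|nU] := pselect (U x).
    by rewrite !indicT //; exact: subM.
  by rewrite !indicF // => /(subMr _ hU Uu).
rewrite (I_indic h) // => e; apply: (mulIf (x := (haar_mu I U)%:C : R[i])).
  by rewrite gt_eqF // ltcR; exact: (haar_mu_gt0 h).
by rewrite mul1r.
Qed.

Lemma exists_cosub : exists U : set L, cosub U /\ U `<=` S.
Proof. by have [U [cU _ US]] := @cosub_small _ _ _ _ h setT filterT; exists U. Qed.

Lemma Delta1 : Delta 1%g = 1.
Proof.
have [U [cU US]] := exists_cosub; apply: (Delta_cosub cU US).
by case: cU => hU _ _; exact: sub1.
Qed.

Lemma DeltaV y : S y -> Delta y^-1%g = (Delta y)^-1.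
Proof.
move=> Sy; apply: (mulfI (Delta_neq0 Sy)); rewrite -DeltaM ?mulgV ?Delta1 //.
  by apply/esym/divff; exact: Delta_neq0.
exact: (subV hS).
Qed.

Lemma star_out f x : Cc f -> ~ S x -> star f x = 0.
Proof.
move=> Cf nS; rewrite /conv_star (Cc_out Cf) ?conjC0 ?mulr0 //.
by move/(subV hS); rewrite invgK.
Qed.

(** By [Delta_cosub] the modular function is constant on cosets of a compact open subgroup. Hence it
    is bounded on the compact support and unaffected by small translations, and continuity reduces
    to that of [f]. *)
Lemma Cc_star f : Cc f -> Cc (star f).
Proof.
move=> Cf; have Ci := Cc_conj h (Cc_inv h Cf).
have [U [cU US]] := exists_cosub; have [C [cC CS fC]] := Cc_support h Ci.
have hU : is_subgroup U by case: cU.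
apply: (@Cc_intro _ _ _ _ h _ C) => // [|x nz]; last first.
  by apply: fC => /= e; apply: nz; rewrite /conv_star e mulr0.
apply: continuous_unif_r => e e0.
have [M M0 DM] : exists2 M : R, 0 <= M & forall x, C x -> rnorm (Delta x^-1%g) <= M.
  have [s sC Cs] := compact_cosets_cover cC cU.
  suff [M M0 hM] : exists2 M : R, 0 <= M & forall y, y \in s -> rnorm (Delta y^-1%g) <= M.
    exists M => // x Cx; have [y ys yx] := Cs x Cx.
    have Sy : S y by apply: CS; exact: sC.
    rewrite -(mulVKg y x) invgM DeltaM; last 2 first.
    - by apply: (subV hS); exact: US.
    - exact: (subV hS).
    rewrite (Delta_cosub cU US (subV hU yx)) mul1r; exact: hM.
  elim: s {sC Cs} => [|y s [M M0 hM]]; first by exists 0.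
  exists (M + rnorm (Delta y^-1%g)); first by rewrite addr_ge0 // rnorm_ge0.
  move=> z; rewrite inE => /predU1P[->|/hM]; first by rewrite lerDr.
  by move/le_trans; apply; rewrite lerDl rnorm_ge0.
have M1 : 0 < M + 1 by rewrite ltr_wpDl.
have [V [cV VS fV]] := Cc_unif_r h Ci (divr_gt0 e0 M1).
exists (U `&` V); split; first exact: cosubI.
have key x u : C x -> U u -> V u -> rnorm (star f (x * u)%g - star f x) <= e.
  move=> Cx Uu Vu; rewrite /conv_star.
  have -> : Delta (x * u)^-1%g = Delta x^-1%g.
    rewrite invgM DeltaM; last 2 first.
    - by apply: (subV hS); exact: US.
    - by apply: (subV hS); exact: CS.
    by rewrite (Delta_cosub cU US (subV hU Uu)) mul1r.
  rewrite -mulrBr rnormM; have := fV x u Vu; have := DM x Cx; rewrite ler_pdivlMr //.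
  have := rnorm_ge0 (Delta x^-1%g).
  have := rnorm_ge0 ((f (x * u)^-1%g)^*%R - (f x^-1%g)^*%R : cplx R).
  move: (rnorm (_ - _)) (rnorm (Delta _)) => a b; nra.
move=> x u [Uu Vu]; have [Cx|nCx] := pselect (C x); first exact: key.
have hV : is_subgroup V by case: cV.
have [Cxu|nCxu] := pselect (C (x * u)%g).
  by have := key _ _ Cxu (subV hU Uu) (subV hV Vu); rewrite mulgK rnormBC.
have f0 z : ~ C z -> star f z = 0.
  move=> nC; rewrite /conv_star [X in _ * X](_ : _ = 0) ?mulr0 //.
  by apply: contrapT => /fC.
by rewrite !f0 // subrr rnorm0 ltW.
Qed.

Lemma starK f : Cc f -> star (star f) = f.
Proof.
move=> Cf; apply/funext => x; have [Sx|nS] := pselect (S x); last first.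
  by rewrite star_out ?(Cc_out Cf) //; exact: Cc_star.
have Sx' := subV hS Sx.
by rewrite /conv_star invgK conjcM conjCK Delta_conj // mulrA DeltaV // mulVf ?mul1r // Delta_neq0.
Qed.

Lemma star_conv f g : Cc f -> Cc g -> star (conv f g) = conv (star g) (star f).
Proof.
move=> Cf Cg; apply/funext => x; have [Sx|nS] := pselect (S x); last first.
  rewrite star_out //; last exact: (Cc_conv h).
  by rewrite (Cc_out (Cc_conv h (Cc_star Cg) (Cc_star Cf))).
have Sx' := subV hS Sx; have gc := Cc_cont Cg.
have Ci := conv_integrand h x^-1%g Cf gc.
rewrite /conv_star /Defs.conv -(I_conj h Ci) -(IZ h _ (Cc_conj h Ci)).
have Cj := CcZ h (Delta x^-1%g) (Cc_conj h Ci).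
rewrite -(I_left h Sx' Cj); congr I; apply/funext => y; rewrite !fctE.
rewrite conjcM !group_simp.
have [Sy|nSy] := pselect (S y); last first.
  rewrite [g y^-1%g](Cc_out Cg) ?conjC0 ?mulr0 ?mul0r ?scaler0 //.
  by move/(subV hS); rewrite invgK.
have Sy' := subV hS Sy.
rewrite (DeltaM Sx' Sy) (DeltaV Sy) /GRing.scale /=.
have alg (a d F G : R[i]) : d != 0 -> a * (F * G) = (d^-1 * G) * ((a * d) * F) by move=> d0; field.
exact: (alg _ _ _ _ (Delta_neq0 Sy)).
Qed.

(** The substitution of [z y] for [z] costs [Delta y], which cancels the modular factor in the
    involution. This makes left translations isometric for every form built from [F'^* * F], and
    lets positivity be checked after a translation. *)
Lemma conv_star_lsh y f g : S y -> Cc f -> Cc g ->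
  conv (star (lsh y f)) (lsh y g) = conv (star f) g.
Proof.
move=> Sy Cf Cg; have gc := Cc_cont Cg; apply/funext => x.
have Ci := conv_integrand h x (Cc_star Cf) gc; have Sy' := subV hS Sy.
rewrite /Defs.conv -[RHS](modularE Sy Ci) -(IZ h _ (Cc_rshift h Sy Ci)).
congr I; apply/funext => z; rewrite !fctE /conv_star /lsh !group_simp.
have [Sz|nSz] := pselect (S z); last first.
  rewrite (Cc_out Cf) ?conjC0 ?mulr0 ?mul0r ?scaler0 //.
  by move/(subMl _ hS Sy')/(subVE _ hS).
have Sz' := subV hS Sz.
rewrite (DeltaM Sy' Sz') (DeltaV Sy) /GRing.scale /= -!mulrA.
by rewrite mulVKf // Delta_neq0.
Qed.

Lemma star_lmul k (c : cplx R) f : S k -> Delta k = 1 ->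
  (forall x, f (x * k^-1)%g = f x * c) -> Cc f ->
  forall x, star f (k * x)%g = c^*%R * star f x.
Proof.
move=> Sk k1 fk Cf x; have [Sx|nS] := pselect (S x); last first.
  rewrite !star_out ?mulr0 // => Skx; apply: nS.
  by rewrite -(mulKg k x); apply: (subM hS) => //; exact: (subV hS).
have [Sx' Sk'] := (subV hS Sx, subV hS Sk).
rewrite /conv_star invgM (DeltaM Sx' Sk') (DeltaV Sk) k1 invr1 mulr1 fk conjcM.
by rewrite [(f _)^*%R * _]mulrC mulrCA.
Qed.

Lemma conv_star1_ge0 f : Cc f -> 0 <= conv (star f) f 1%g.
Proof.
move=> Cf; apply: (I_pos h (conv_integrand h 1%g (Cc_star Cf) (Cc_cont Cf))) => y.
 rewrite /conv_star mulg1 -mulrA [_^*%R * _]mulrC.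
have [Sy|nSy] := pselect (S y).
  rewrite mulr_ge0 ?mul_conjC_ge0 // ltW // Delta_gt0 //; exact: (subV hS).
rewrite (Cc_out Cf) ?mul0r ?mulr0 //.
by move/(subVE _ hS).
Qed.

Lemma conv_star1_eq0 f : Cc f -> conv (star f) f 1%g = 0 -> f = 0.
Proof.
move=> Cf e; have Ci := conv_integrand h 1%g (Cc_star Cf) (Cc_cont Cf).
have := I_eq0 h Ci _ e => H.
apply/funext => x; apply: contrapT => fx; have Sx := Cc_in Cf fx.
have := congr1 (fun g => g x^-1%g) (H _) => /=.
rewrite /conv_star mulg1 invgK => H'.
have : Delta x * (f x)^*%R * f x = 0.
  apply: H' => y; rewrite mulg1 -mulrA [_^*%R * _]mulrC.
  have [Sy|nSy] := pselect (S y).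
    rewrite mulr_ge0 ?mul_conjC_ge0 // ltW // Delta_gt0 //; exact: (subV hS).
  by rewrite (Cc_out Cf) ?mul0r ?mulr0 // => /(subVE _ hS).
move/eqP; rewrite -mulrA mulf_eq0 (negPf (Delta_neq0 Sx)) /= mulrC mul_conjC_eq0.
by move/eqP.
Qed.

End Modular.

(** * Representations of C_c *)

Definition mk_linear (K : nzRingType) (V W : lmodType K) (f : V -> W)
    (hf : linear f) : {linear V -> W} := HB.pack f (GRing.isLinear.Build K V W _ f hf).

Section GNS.
Variables (R : realType) (L : topGroupType) (S : set L) (I : (L -> cplx R) -> cplx R).
Variable Delta : L -> cplx R.
Hypothesis h : haar_setting S I.
Hypothesis hD : is_modular_function S I Delta.
Local Notation Cc := (@Cc R L S).
Local Notation conv := (Defs.conv I).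
Local Notation star := (conv_star Delta).
Variables (D : set (L -> cplx R)) (q : (L -> cplx R) -> (L -> cplx R) -> R[i]).
Hypothesis D0 : D 0.
Hypothesis DP : forall (k : R[i]) a b, D a -> D b -> D (k *: a + b).
Hypothesis DCc : forall F, D F -> Cc F.
Hypothesis Dconv : forall f F, Cc f -> D F -> D (conv f F).
Hypothesis Dlsh : forall y F, S y -> D F -> D (lsh y F).
Hypothesis Dinv : forall F, D F -> exists U, [/\ cosub U, U `<=` S & left_inv U F].
Hypothesis qP : forall (k : R[i]) a b c, D a -> D b -> D c ->
  q (k *: a + b) c = k * q a c + q b c.
Hypothesis qC : forall a b, D a -> D b -> q a b = ((q b a)^*)%R.
Hypothesis q_ge0 : forall a, D a -> 0 <= q a a.
Hypothesis q_lsh : forall y F, S y -> D F -> q (lsh y F) (lsh y F) = q F F.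
Hypothesis q_star : forall f F F', Cc f -> D F -> D F' ->
  q (conv f F) F' = q F (conv (star f) F').

(** Common source of the convolution representation on functions and of the induced one. The [L^1]
    bound is geometric: with [F] left [U]-invariant and [f] on a coset [yU], the function [f * F] is
    [I(f) L_y F], and [L_y] is isometric for the form. The bound lets convolution by [f] extend to
    the completion, and the representation laws follow by density. *)
Lemma gns_representation :
  exists (V : hilbert R) (j : (L -> cplx R) -> V)
    (pi : @conv_algebra R L S I Delta -> {linear V -> V}),
  [/\ L1_rep pi, forall F F', D F -> D F' -> hs_dot V (j F) (j F') = q F F'
    & forall f F, Cc f -> D F -> pi f (j F) = j (conv f F)].
Proof.
have [V [j [jP jd jq]]] := hilbert_completion D0 DP qP qC q_ge0.
have jn y F : S y -> D F -> rnorm (j (lsh y F)) = rnorm (j F).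
  move=> Sy DF; have Dl := Dlsh Sy DF.
  apply/eqP; rewrite -(@eqrXn2 _ 2) ?rnorm_ge0 //; apply/eqP/complexI.
  by rewrite -!dot_rnorm !jq // q_lsh.
have jZ (k : R[i]) a : D a -> j (k *: a) = k *: j a.
  move=> Da; have := jP k a 0 Da D0; rewrite addr0 => ->.
  have := jP (-1) 0 0 D0 D0; rewrite scaler0 addr0 scaleN1r addNr => ->.
  by rewrite addr0.
have jD a b : D a -> D b -> j (a + b) = j a + j b.
  by move=> Da Db; have := jP 1 a b Da Db; rewrite !scale1r.
have jL1 f F : Cc f -> D F -> rnorm (j (conv f F)) <= L1norm I f * rnorm (j F).
  move=> Cf DF; have [U [cU US FU]] := Dinv DF; have Fc := Cc_cont (DCc DF).
  have hU : is_subgroup U by case: cU.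
  move: f Cf; apply: (Cc_ind h cU US) => [y f Sy Cf fU|f g Cf Cg fg Hf Hg].
    rewrite (conv_single h Fc FU Cf fU hU) jZ; last exact: Dlsh.
    by rewrite rnormZ jn // ler_wpM2r ?rnorm_ge0 //; exact: (I_norm h Cf).
  have := conv_linl h 1 Cf Cg Fc; rewrite !scale1r => ->.
  rewrite (jD _ _ (Dconv Cf DF) (Dconv Cg DF)) (L1norm_disjoint h Cf Cg fg) mulrDl.
  by apply: le_trans (rnormD _ _) _; exact: lerD.
have DB a b : D a -> D b -> D (a - b).
  by move=> Da Db; rewrite addrC -[- b]scaleN1r; exact: DP.
have jB a b : D a -> D b -> j (a - b) = j a - j b.
  by move=> Da Db; rewrite addrC -[- b]scaleN1r jP // scaleN1r addrC.
have convB f F F' : Cc f -> D F -> D F' -> conv f (F - F') = conv f F - conv f F'.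
  move=> Cf DF DF'; have := conv_linr h (-1) Cf (Cc_cont (DCc DF')) (Cc_cont (DCc DF)).
  by rewrite !scaleN1r addrC => ->; rewrite addrC.
have /choice[P hP] : forall f : L -> cplx R, exists T : {linear V -> V}, Cc f ->
    (forall F, D F -> T (j F) = j (conv f F)) /\
    forall v, rnorm (T v) <= L1norm I f * rnorm v.
  move=> f; have [Cf|nC] := pselect (Cc f); last first.
    have hl : linear (fun _ : V => 0 : V) by move=> k a b; rewrite scaler0 addr0.
    by exists (mk_linear hl).
  have n0 := L1norm_ge0 h Cf.
  have [F F' DF DF'|T [Tj TL]] := @dense_extension R _ D V j jd V (fun F => j (conv f F)) _ n0.
    rewrite -(jB _ _ (Dconv Cf DF) (Dconv Cf DF')) -(jB _ _ DF DF') -(convB _ _ _ Cf DF DF').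
    exact: jL1 Cf (DB _ _ DF DF').
  have Tl : lipschitz_map T by exists (L1norm I f).
  have Tlin : linear T.
    move=> k a b.
    apply: (dense_eq (f := fun a => T (k *: a + b)) (g := fun a => k *: T a + T b) jd) => [||x Dx].
    - by apply: (lip_comp Tl); apply: lipD; [apply: lipZ; exact: lip_id|exact: lip_cst].
    - by apply: lipD; [apply: lipZ|exact: lip_cst].
    apply: (dense_eq (f := fun b => T (k *: j x + b)) (g := fun b => k *: T (j x) + T b) jd) => [||y Dy].
    - by apply: (lip_comp Tl); apply: lipD; [exact: lip_cst|exact: lip_id].
    - by apply: lipD; [exact: lip_cst|].
    rewrite -jP // !Tj //; last exact: DP.
    rewrite (conv_linr h k Cf (Cc_cont (DCc Dx)) (Cc_cont (DCc Dy))) jP //; exact: Dconv.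
  exists (mk_linear Tlin) => _; split=> // v /=.
  by have := TL v 0; rewrite -[T 0]/(mk_linear Tlin 0) linear0 !subr0.
have Pj f F : Cc f -> D F -> P f (j F) = j (conv f F) by move=> Cf; case: (hP f Cf) => + _; apply.
have PL f v : Cc f -> rnorm (P f v) <= L1norm I f * rnorm v by move=> Cf; case: (hP f Cf).
have Plip f : Cc f -> lipschitz_map (P f).
  move=> Cf; exists (L1norm I f); first exact: (L1norm_ge0 h Cf).
  by move=> y y'; rewrite -linearB; exact: PL.
have dotl w : lipschitz_map (fun v : V => hs_dot V v w : cplx R).
  exists (rnorm w) => [|y y']; first exact: rnorm_ge0.
  have -> : hs_dot V y w - hs_dot V y' w = hs_dot V (y - y') w.
    by have := dotP (-1) y' y w; rewrite scaleN1r mulN1r addrC => ->; rewrite addrC.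
  by rewrite mulrC; exact: dot_CS.
have dotr w : lipschitz_map (fun v : V => hs_dot V w v : cplx R).
  rewrite (_ : (fun v => _) = (fun v => (hs_dot V v w)^*%R)); first exact: lip_conj.
  by apply/funext => v; rewrite dotC.
exists V, j, P; split=> //; split; last first.
  move=> f v Cf; rewrite -!rnormE.
  have -> : (fun x => `|f x|) = (fun x => (rnorm (f x))%:C) :> (L -> cplx R).
    by apply/funext => x; rewrite rnormE.
  by rewrite (I_real h (Cc_rnorm h Cf)) -rcM lecR; exact: PL.
split.
- by move=> f Cf; exact: lip_continuous (Plip f Cf).
- move=> k f g v Cf Cg; have Cfg := CcP h k Cf Cg.
  apply: (dense_eq (f := P (k *: f + g)) (g := fun v => k *: P f v + P g v) jd) => [||F DF].
  + exact: Plip.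
  + by apply: lipD; [apply: lipZ; exact: Plip|exact: Plip].
  rewrite !Pj // -jP; [|exact: Dconv|exact: Dconv].
  by rewrite (conv_linl h k Cf Cg (Cc_cont (DCc DF))).
- move=> f g v Cf Cg; have Cfg := Cc_conv h Cf Cg.
  apply: (dense_eq (f := P (conv f g)) (g := fun v => P f (P g v)) jd) => [||F DF].
  + exact: Plip.
  + by apply: lip_comp; exact: Plip.
  rewrite (Pj _ _ Cfg DF) (Pj _ _ Cg DF) (Pj _ _ Cf (Dconv Cg DF)).
  have [U [cU US FU]] := Dinv DF.
  by rewrite (conv_assoc h cU US Cf Cg (DCc DF) FU).
- move=> f v w Cf; have Cs := Cc_star h hD Cf.
  apply: (dense_eq (f := fun v => hs_dot V (P f v) w : cplx R) (g := fun v => hs_dot V v (P (star f) w) : cplx R) jd) => [||F DF].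
  + by apply: (lip_comp (dotl w)); exact: Plip.
  + exact: dotl.
  apply: (dense_eq (f := fun w => hs_dot V (P f (j F)) w : cplx R) (g := fun w => hs_dot V (j F) (P (star f) w) : cplx R) jd) => [||F' DF'].
  + exact: dotr.
  + by apply: (lip_comp (dotr (j F))); exact: Plip.
  rewrite (Pj _ _ Cf DF) (Pj _ _ Cs DF') (jq _ _ (Dconv Cf DF) DF') (jq _ _ DF (Dconv Cs DF')).
  exact: q_star.
Qed.

End GNS.

(** * Existence of the group C*-algebra *)

Section GroupCstar.
Variables (R : realType) (L : topGroupType) (S : set L) (I : (L -> cplx R) -> cplx R).
Variable Delta : L -> cplx R.
Hypothesis h : haar_setting S I.
Hypothesis hD : is_modular_function S I Delta.
Local Notation Cc := (@Cc R L S).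
Local Notation conv := (Defs.conv I).
Local Notation star := (conv_star Delta).
Implicit Types (f g F : L -> cplx R) (U : set L).

(** The support meets finitely many cosets [yU], and [V] lies in all the conjugates [y U y^-1]; then
    [v x = x (x^-1 v x)] with [x^-1 v x] in [U] for [x] in the support. Zeros of [F] are handled by
    applying this to [v^-1]. *)
Lemma right_inv_left_inv U F : cosub U -> Cc F -> (forall x u, U u -> F (x * u)%g = F x) ->
  exists V, [/\ cosub V, V `<=` S & left_inv V F].
Proof.
move=> cU CF FU; have [s sS Fs] := Cc_cover h CF cU.
have hU : is_subgroup U by case: cU.
have [V [cV VS Vs]] : exists V, [/\ cosub V, V `<=` S & forall y, y \in s -> V `<=` conj_by y U].
  elim: s {sS Fs} => [|y s [V [cV VS Vs]]].
    by have [V [cV VS]] := exists_cosub h; exists V.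
  exists (V `&` conj_by y U); split; first by apply: cosubI => //; exact: cosub_conj.
    by move=> x [/VS].
  by move=> z; rewrite inE => /predU1P[-> x []|/Vs Vz x [/Vz]].
exists V; split=> //; have hV : is_subgroup V by case: cV.
have key v x : V v -> F x <> 0 -> F (v * x)%g = F x.
  move=> Vv /Fs[y ys yx]; have := Vs y ys v Vv; rewrite /conj_by /= => vy.
  rewrite -(FU x (x^-1 * v * x)%g) ?group_simp //.
  have -> : (x^-1 * v * x = (y^-1 * x)^-1 * (y^-1 * v * y) * (y^-1 * x))%g by rewrite !group_simp.
  by apply: (subM hU) => //; apply: (subM hU) => //; exact: subV.
move=> v x Vv; have [Fx|/(key v x Vv)//] := pselect (F x = 0).
have [->|Fvx] := pselect (F (v * x)%g = 0); first by rewrite Fx.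
by have := key v^-1%g _ (subV hV Vv) Fvx; rewrite mulKg => <-.
Qed.

Lemma star_conv_swap f g : Cc f -> Cc g -> star (conv (star f) g) = conv (star g) f.
Proof. by move=> Cf Cg; rewrite (star_conv h hD (Cc_star h hD Cf) Cg) (starK h hD Cf). Qed.

(** For a form that depends on [F'^* * F] only, this is the adjointness of convolution by [f] and by
    [star f]. *)
Lemma star_conv_assoc U f F F' : cosub U -> U `<=` S -> left_inv U F ->
  Cc f -> Cc F -> Cc F' -> conv (star F') (conv f F) = conv (star (conv (star f) F')) F.
Proof.
move=> cU US FU Cf CF CF'; rewrite (star_conv_swap Cf CF').
by rewrite (conv_assoc h cU US (Cc_star h hD CF') Cf CF FU).
Qed.

Lemma star_at1 f : star f 1%g = (f 1%g)^*%R.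
Proof. by rewrite /conv_star invg1 (Delta1 h hD) mul1r. Qed.

(* The representation by convolution on right U-invariant functions, with the
   L^2 inner product F'^* * F (1), detects f through f * 1_U; U shrinks to 1. *)
Lemma L1_reps_faithful f : Cc f ->
  (forall (V : hilbert R) (pi : @conv_algebra R L S I Delta -> {linear V -> V}),
    L1_rep pi -> forall v, pi f v = 0) -> f = 0.
Proof.
move=> Cf fpi.
have conv0 U : cosub U -> U `<=` S -> conv f (fun x => \1_U x) = 0.
  move=> cU US; have hU : is_subgroup U by case: cU.
  pose D := [set F | Cc F /\ forall x u, U u -> F (x * u)%g = F x].
  pose q F F' : R[i] := conv (star F') F 1%g.
  have DCc F : D F -> Cc F by case.
  have D0 : D 0 by split=> //; exact: (Cc0 h).
  have DP (k : R[i]) a b : D a -> D b -> D (k *: a + b).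
    move=> [Ca aU] [Cb bU]; split; first exact: (CcP h k Ca Cb).
    by move=> x u Uu; rewrite !fctE aU // bU.
  have Dconv g F : Cc g -> D F -> D (conv g F).
    move=> Cg [CF FU]; split=> [|x u Uu]; first exact: (Cc_conv h Cg CF).
    rewrite (conv_rmul h (k := u) (c := 1) Cg (Cc_cont CF)) ?mulr1 // => y.
    by rewrite FU // mulr1.
  have Dlsh y F : S y -> D F -> D (lsh y F).
    move=> Sy [CF FU]; split; first exact: (Cc_lsh h Sy CF).
    by move=> x u Uu; rewrite /lsh mulgA FU.
  have Dinv F : D F -> exists U', [/\ cosub U', U' `<=` S & left_inv U' F].
    by move=> [CF FU]; exact: right_inv_left_inv cU CF FU.
  have qP (k : R[i]) a b c : D a -> D b -> D c -> q (k *: a + b) c = k * q a c + q b c.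
    move=> Da Db Dc; have := conv_linr h k (Cc_star h hD (DCc c Dc)) (Cc_cont (DCc _ Da)) (Cc_cont (DCc _ Db)).
    by rewrite /q => ->.
  have qC a b : D a -> D b -> q a b = ((q b a)^*)%R.
    by move=> /DCc Ca /DCc Cb; rewrite /q -star_at1 star_conv_swap.
  have q_ge0 a : D a -> 0 <= q a a.
    by move=> /DCc Ca; exact: (conv_star1_ge0 h hD Ca).
  have q_lsh y F : S y -> D F -> q (lsh y F) (lsh y F) = q F F.
    by move=> Sy /DCc CF; rewrite /q (conv_star_lsh h hD Sy CF CF).
  have q_star g F F' : Cc g -> D F -> D F' -> q (conv g F) F' = q F (conv (star g) F').
    move=> Cg DF /DCc CF'; have [V [cV VS FV]] := Dinv F DF.
    by rewrite /q (star_conv_assoc cV VS FV Cg (DCc _ DF) CF').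
  have [V [j [pi [hpi jq pij]]]] :=
    gns_representation h hD D0 DP DCc Dconv Dlsh Dinv qP qC q_ge0 q_lsh q_star.
  have Dc : D (fun x => \1_U x).
    split; first exact: (Cc_cosub_indic h cU US).
    move=> x u Uu; have [Ux|nU] := pselect (U x).
      by rewrite !indicT //; exact: subM.
    by rewrite !indicF // => /(subMr _ hU Uu).
  have := fpi V pi hpi (j (fun x => \1_U x)); rewrite (pij _ _ Cf Dc) => j0.
  have Dcf := Dconv _ _ Cf Dc; apply: (conv_star1_eq0 h hD (DCc _ Dcf)).
  by rewrite -[LHS]/(q _ _) -jq // j0 dot0l.
apply/funext => x; apply: contrapT => fx; have Sx := Cc_in Cf fx.
have n0 : 0 < rnorm (f x).
  by rewrite lt_neqAle rnorm_ge0 andbT eq_sym; apply/eqP => /rnorm0_eq0.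
(* The value of [f * 1_U] at [x] is the integral of [f] over [xU]. If it is 0 while [f] stays within
   [|f x| / 2] of [f x] there, then [|f x| mu(U) <= |f x| mu(U) / 2], which is absurd. *)
have e0 : 0 < rnorm (f x) / 2 by rewrite divr_gt0.
have [U [cU US fU]] := Cc_unif_r h Cf e0; have hU : is_subgroup U by case: cU.
have := congr1 (fun g => g x) (conv0 U cU US); rewrite /Defs.conv /=.
pose A := [set y | U (x^-1 * y)%g].
have CA := Cc_coset_indic h cU US Sx.
have -> : (fun y => f y * \1_U (y^-1 * x)%g) = (fun y => f y * \1_A y) :> (L -> cplx R).
  apply/funext => y; congr (_ * _); have [Ay|nA] := pselect (A y).
    by rewrite !indicT //; exact: (coset_sym hU Ay).
  by rewrite !indicF // => /(coset_sym hU).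
move=> I0'.
have Ci := CcMr h Cf (Cc_cont CA).
have Cz := CcZ h (f x) CA.
have := I_bound h (e := rnorm (f x) / 2) (CcB h Ci Cz) CA.
rewrite (IB h Ci Cz) I0' (IZ h _ CA) (I_indic h CA) sub0r rnormN rnormM.
rewrite rnorm_real ?(haar_mu_ge0 h CA) // (haar_mu_coset h cU US Sx).
have mu0 := haar_mu_gt0 h cU US => H.
have : rnorm (f x) * haar_mu I U <= rnorm (f x) / 2 * haar_mu I U.
  apply: H => y; rewrite !fctE.
    move=> nz; apply: contrapT => nA; apply: nz.
    by rewrite indicF // mulr0 scaler0 subrr.
  have [Ay|nA] := pselect (A y); last first.
    by rewrite indicF // mulr0 scaler0 subrr rnorm0 ltW.
  rewrite indicT // mulr1 -[f x *: _]/(f x * 1) mulr1.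
  by have := fU x _ Ay; rewrite mulVKg.
by rewrite ler_pM2r // ler_pdivlMr // mulr_natr mulr2n -subr_le0 addrK leNgt n0.
Qed.

Lemma conv_algebra_closed : star_closed (@conv_algebra R L S I Delta).
Proof.
split.
- exact: (Cc0 h).
- by move=> k a b; exact: (CcP h).
- by move=> a b; exact: (Cc_conv h).
- by move=> a; exact: (Cc_star h hD).
Qed.

Lemma group_cstar_exists : exists (E : cstarAlg R) (u : (L -> cplx R) -> E),
  @is_group_cstar R L S I Delta E u.
Proof.
have hbd (a : @conv_algebra R L S I Delta) : sa_elt a ->
    exists M, rep_bound (@L1_rep R L S I Delta) a M.
  move=> Ca; exists (L1norm I a) => V pi [_ hpi] v.
  rewrite -lecR rcM !rnormE; apply: le_trans (hpi a v Ca) _.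
  have -> : (fun x => `|a x|) = (fun x => (rnorm (a x))%:C) :> (L -> cplx R).
    by apply/funext => x; rewrite rnormE.
  by rewrite (I_real h (Cc_rnorm h Ca)).
have hrep (V : hilbert R) (pi : @conv_algebra R L S I Delta -> {linear V -> V}) :
    L1_rep pi -> star_rep pi by case.
have [E [u [hu ud ub ul]]] := cstar_completion conv_algebra_closed hrep hbd.
exists E, u; split.
- split; first exact: conv_algebra_closed.
  by split; [exact: closedT|split].
- split=> // a Ca ua; apply: L1_reps_faithful => // V pi hpi v; apply: rnorm0_eq0.
  have := ub a Ca V pi hpi v; rewrite ua rnorm0 mul0r => H.
  by apply/eqP; rewrite eq_le H rnorm_ge0.
- by [].
- by move=> V pi hpi a v Ca; rewrite -!rnormE -rcM lecR; exact: ub.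
- move=> a M Ca M0 hM; have ME : M = (complex.Re M)%:C by rewrite RRe_real // ger0_real.
  rewrite ME -rnormE lecR; apply: ul => //; first by rewrite -ler0c -ME.
  move=> V pi hpi v; rewrite -lecR rcM !rnormE -ME; exact: hM.
Qed.

End GroupCstar.

(** * The Schlichting completion *)

Section HeckeCosets.
Variable G : groupType.
Implicit Types (H K M : set G) (x y g : G).

Lemma conj_setP x H y : conj_set x H y <-> H (x^-1 * y * x)%g.
Proof.
split=> [[k Hk <-]|Hy]; first by rewrite !group_simp.
by exists (x^-1 * y * x)%g => //; rewrite !group_simp.
Qed.

Lemma gsub1 H : is_subgroup H -> H 1%g. Proof. by case. Qed.
Lemma gsubM H x y : is_subgroup H -> H x -> H y -> H (x * y)%g.
Proof. by move=> [_ h _]; exact: h. Qed.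
Lemma gsubV H x : is_subgroup H -> H x -> H x^-1%g.
Proof. by move=> [_ _ h]; exact: h. Qed.

Lemma left_cosetP x H y : left_coset x H y <-> H (x^-1 * y)%g.
Proof.
split=> [[k Hk <-]|Hy]; first by rewrite mulKg.
by exists (x^-1 * y)%g => //; rewrite mulVKg.
Qed.

Lemma left_coset_eq M x y : is_subgroup M -> M (x^-1 * y)%g -> left_coset x M = left_coset y M.
Proof.
move=> hM Mxy; apply/seteqP; split=> z /left_cosetP Mz; apply/left_cosetP.
  have -> : (y^-1 * z = (x^-1 * y)^-1 * (x^-1 * z))%g by rewrite !group_simp.
  by apply: (gsubM hM) => //; exact: (gsubV hM).
have -> : (x^-1 * z = (x^-1 * y) * (y^-1 * z))%g by rewrite !group_simp.
exact: (gsubM hM).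
Qed.

Lemma left_coset_self M x : is_subgroup M -> left_coset x M x.
Proof. by move=> hM; apply/left_cosetP; rewrite mulVg; exact: gsub1. Qed.

Lemma finite_left_cosets K M : is_subgroup K -> is_subgroup M ->
  finite_set (left_cosets K M) -> exists t : seq G,
    (forall k, k \in t -> K k) /\ forall k, K k -> exists2 k', k' \in t & M (k'^-1 * k)%g.
Proof.
move=> hK hM /finite_seqP[s sE].
pose r (c : set G) := xget 1%g [set y | K y /\ c = left_coset y M].
have rK c : K (r c) by rewrite /r; case: xgetP => [y _ []|_] //; exact: gsub1.
exists (map r s); split=> [k /mapP[c _ ->]|k Kk]; first exact: rK.
have : left_cosets K M (left_coset k M) by exists k.
rewrite sE /= => ks; exists (r (left_coset k M)); first exact: map_f.
rewrite /r; case: xgetP => [y _ [Ky e]|/(_ k)]; last by case.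
by have := left_coset_self k hM; rewrite e => /left_cosetP.
Qed.

End HeckeCosets.

Section Schlichting.
Variables (G : groupType) (K : set G) (L : topGroupType) (e : G -> L).
Hypothesis hK : hecke_pair K.
Hypothesis hL : is_schlichting_completion K e.
Implicit Types (x y g : G) (l m : L).

Let K1 : is_subgroup K. Proof. by case: hK. Qed.

Lemma schM x y : e (x * y)%g = (e x * e y)%g. Proof. by case: hL. Qed.
Lemma sch1 : e 1%g = 1%g.
Proof. by apply: (@mulgI _ (e 1%g)); rewrite -schM !mulg1. Qed.
Lemma schV x : e x^-1%g = (e x)^-1%g.
Proof. by apply: (@mulgI _ (e x)); rewrite -schM !mulgV sch1. Qed.

Lemma sch_haus : hausdorff_space L. Proof. by case: hL => _ _ _ _ []. Qed.

Lemma sch_dense l V : nbhs l V -> exists g, V (e g).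
Proof.
rewrite nbhsE => -[W [oW Wl] WV]; have [_ _ _ d _] := hL.
have [x [Wx [g _ gx]]] := d W (ex_intro _ l Wl) oW.
by exists g; apply: WV; rewrite gx.
Qed.

Definition Kbar : set L := closure (e @` K).

Lemma Kbar_subgroup : is_subgroup Kbar.
Proof.
apply: closure_subgroup; split=> [|_ _ [x Kx <-] [y Ky <-]|_ [x Kx <-]].
- by exists 1%g; [exact: gsub1|rewrite sch1].
- by exists (x * y)%g; [exact: gsubM|rewrite schM].
- by exists x^-1%g; [exact: gsubV|rewrite schV].
Qed.

Lemma Kbar_nbhs_e : exists2 V : set L, nbhs (1%g : L) V & forall g, V (e g) -> K g.
Proof.
have [_ _ hn _ _] := hL.
have [|V V1 VK] := (hn 1%g K).1; last by rewrite sch1 in V1; exists V => // g; exact: VK.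
exists [:: 1%g] => y /(_ 1%g (mem_head _ _)) /conj_setP.
by rewrite !group_simp.
Qed.

(** Near 1 every point of the dense subgroup [e(G)] comes from [K], so a whole neighbourhood of 1
    lies in the closure of [e(K)]. *)
Lemma Kbar_nbhs : nbhs (1%g : L) Kbar.
Proof.
have [V] := Kbar_nbhs_e; rewrite {1}nbhsE => -[W [oW W1] WV] VK.
have W1' : nbhs (1%g : L) W by apply: open_nbhs_nbhs.
apply: filterS W1' => l Wl A Al; have [|g [Ag Wg]] := @sch_dense l (A `&` W).
  by apply: filterI => //; apply: open_nbhs_nbhs.
by exists (e g); split=> //; exists g => //; apply: VK; exact: WV.
Qed.

Lemma Kbar_open : open Kbar.
Proof. exact: nbhs1_subgroup_open Kbar_subgroup Kbar_nbhs. Qed.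

Lemma Kbar_e g : Kbar (e g) <-> K g.
Proof.
split=> [Kg|Kg]; last by apply: subset_closure; exists g.
have [V V1 VK] := Kbar_nbhs_e.
have [_ [[k Kk <-]]] := Kg _ (nbhs_coset (e g) V1).
rewrite /= -schV -schM => /VK Kgk.
by have := gsubM K1 Kk (gsubV K1 Kgk); rewrite !group_simp.
Qed.

(** A finite intersection of conjugates of [Kbar]: the extension to [L] of a basic neighbourhood of
    the Hecke topology. *)
Definition Us (s : seq G) : set L :=
  [set l | forall x, x \in s -> Kbar ((e x)^-1 * l * e x)%g].

Lemma Us_cons x s : Us (x :: s) = conj_by (e x) Kbar `&` Us s.
Proof.
apply/seteqP; split=> [l hl|l [hx hs] y].
  by split=> [|y ys]; apply: hl; rewrite inE ?eqxx // ys orbT.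
by rewrite inE => /predU1P[->|/hs].
Qed.

Lemma Us_subgroup s : is_subgroup (Us s).
Proof.
have hKb := Kbar_subgroup; split=> [x _|l m hl hm x xs|l hl x xs].
- by rewrite mulg1 mulVg; exact: sub1.
- have -> : ((e x)^-1 * (l * m) * e x = ((e x)^-1 * l * e x) * ((e x)^-1 * m * e x))%g.
    by rewrite !group_simp.
  by apply: (subM hKb); [exact: hl|exact: hm].
- have -> : ((e x)^-1 * l^-1 * e x = ((e x)^-1 * l * e x)^-1)%g by rewrite !group_simp.
  by apply: (subV hKb); exact: hl.
Qed.

Lemma Us_open s : open (Us s).
Proof.
elim: s => [|x s ih].
  by rewrite (_ : Us [::] = setT); [exact: openT|apply/seteqP; split].
rewrite Us_cons; apply: openI => //.
by apply: open_comp => [l _|]; [exact: conj_bycont|exact: Kbar_open].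
Qed.

Lemma Us_e s g : Us s (e g) <-> forall x, x \in s -> K (x^-1 * g * x)%g.
Proof. by split=> h x xs; move: (h x xs); rewrite -schV -!schM => /Kbar_e. Qed.

(** The hypothesis describes the topology on [e(G)] only. With [A B] inside [V], a point [l] is
    split as [e g] times [(e g)^-1 l], with [e g] in [Us s], hence in [A], and the second factor in
    [B] by density. *)
Lemma Us_basis V : nbhs (1%g : L) V -> exists s, Us s `<=` V.
Proof.
rewrite -{1}(mulg1 1%g) => /mulg_near[[A B] [/= A1 B1] AB].
have [_ _ hn _ _] := hL.
have [|s sA] := (hn 1%g (e @^-1` A)).2; first by exists A; rewrite ?sch1.
exists s => l ls.
have [|g [gB gU]] := @sch_dense l ([set m | B (m^-1 * l)%g] `&` Us s).
  apply: filterI; last by apply: open_nbhs_nbhs; split => //; exact: Us_open.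
  by apply: inv_mul_continuous; rewrite /= mulVg.
rewrite -(mulVKg (e g) l); apply: AB => //; apply: sA => x xs.
by apply/conj_setP; rewrite invg1 mul1g; exact: (Us_e s g).1 gU x xs.
Qed.

(** Finite index in [K] of a finite intersection of conjugates: each new conjugate refines the
    partition by the finitely many cosets of [K] modulo its intersection with that conjugate. *)
Lemma hecke_cover (s : seq G) : exists t : seq G, (forall k, k \in t -> K k) /\
  forall k, K k -> exists2 k', k' \in t & forall x, x \in s -> K (x^-1 * (k'^-1 * k) * x)%g.
Proof.
elim: s => [|x s [t [tK ht]]].
  exists [:: 1%g]; split=> [k|k Kk]; first by rewrite inE => /eqP ->; exact: gsub1.
  by exists 1%g => //; rewrite mem_head.
pose M := K `&` conj_set x K.
have hM : is_subgroup M.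
  split=> [|y z [Ky /conj_setP hy] [Kz /conj_setP hz]|y [Ky /conj_setP hy]].
  - by split; [exact: gsub1|apply/conj_setP; rewrite mulg1 mulVg; exact: gsub1].
  - split; first exact: gsubM.
    by apply/conj_setP; have := gsubM K1 hy hz; rewrite !group_simp.
  - split; first exact: gsubV.
    by apply/conj_setP; have := gsubV K1 hy; rewrite !group_simp.
have [t' [t'K ht']] := finite_left_cosets K1 hM (hK.2 x).
pose P a b := [set z | [/\ K z, M (b^-1 * z)%g &
  forall w, w \in s -> K (w^-1 * (a^-1 * z) * w)%g]].
(* One point for each pair of an old and a new coset; when the two do not meet, the default 1, also
   in [K], is listed instead. *)
exists [seq xget 1%g (P a b) | a <- t, b <- t']; split.
  move=> k /allpairsP[[a b] /= [_ _ ->]]; case: xgetP => [z _ []//|_]; exact: gsub1.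
move=> k Kk; have [a at_ ha] := ht k Kk; have [b bt hb] := ht' k Kk.
have Pk : P a b k by split.
exists (xget 1%g (P a b)); first by apply/allpairsP; exists (a, b).
case: xgetP => [z _ [Kz [_ /conj_setP zb] za]|/(_ k)//] w.
rewrite inE => /predU1P[->|ws].
  case: hb => _ /conj_setP hb; have := gsubM K1 (gsubV K1 zb) hb; by rewrite !group_simp.
by have := gsubM K1 (gsubV K1 (za w ws)) (ha w ws); rewrite !group_simp.
Qed.

Lemma Kbar_cover s : exists t : seq L, forall l, Kbar l ->
  exists2 a, a \in t & Us s (a^-1 * l)%g.
Proof.
have [t [tK ht]] := hecke_cover s; exists (map e t) => l Kl.
have [|g [Ug Kg]] := @sch_dense l ([set m | Us s (m^-1 * l)%g] `&` Kbar).
  apply: filterI; last by apply: open_nbhs_nbhs; split => //; exact: Kbar_open.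
  apply: inv_mul_continuous; rewrite /= mulVg; apply: open_nbhs_nbhs.
  by split; [exact: Us_open|apply: sub1; exact: Us_subgroup].
have [a at_ ha] := ht g ((Kbar_e g).1 Kg).
exists (e a); first exact: map_f.
rewrite -(mulgK (e g) (e a)^-1%g) -mulgA; apply: (subM (Us_subgroup s)) => //.
by rewrite -schV -schM; apply/Us_e.
Qed.

Lemma ultra_finite_union (F : set_system L) (FF : UltraFilter F) (P : L -> set L) (t : seq L) :
  F [set l | exists2 a, a \in t & P a l] -> exists2 a, a \in t & F (P a).
Proof.
elim: t => [|a t ih] Ft.
  by have [l []] := filter_ex Ft.
have [Fa|Fa] := in_ultra_setVsetC (P a) FF; first by exists a; rewrite ?mem_head.
have [|b bt Fb] := ih; last by exists b; rewrite ?inE ?bt ?orbT.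
apply: filterS2 Ft Fa => l [b]; rewrite inE => /predU1P[->|bt] Pb nP //.
by exists b.
Qed.

(* An ultrafilter on Kbar is Cauchy, as finitely many cosets of each basic open
   subgroup cover Kbar. *)
Lemma Kbar_compact : compact Kbar.
Proof.
rewrite compact_ultra => F FF FK; have [_ _ _ _ [_ cpl]] := hL.
have hKb := Kbar_subgroup.
have [V V1|l Fl] := cpl F _.
  have [s sV] := Us_basis V1; have [t ht] := Kbar_cover s; have hU := Us_subgroup s.
  have [|a at_ Fa] := @ultra_finite_union F FF (fun a => [set l | Us s (a^-1 * l)%g]) t.
    by apply: filterS FK => l /ht.
  (* Completeness is for the two-sided uniformity, so the inverses must be small of every order as
     well; the same cover is applied to [l^-1]. *)
  have [|b bt Fb] := @ultra_finite_union F FF (fun a => [set l | Us s (a^-1 * l^-1)%g]) t.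
    by apply: filterS FK => l /(subV hKb)/ht.
  exists ([set l | Us s (a^-1 * l)%g] `&` [set l | Us s (b^-1 * l^-1)%g]); first exact: filterI.
  move=> x y [xa xb] [ya yb]; split; apply: sV.
    by have := subM hU (subV hU xa) ya; rewrite !group_simp.
  by have := subM hU (subV hU xb) yb; rewrite !group_simp.
exists l; split=> //.
suff : closure Kbar l by rewrite -(closure_id _).1 //; exact: closed_closure.
by move=> A Al; have [m [Km Am]] := filter_ex (filterI FK (Fl _ Al)); exists m.
Qed.

End Schlichting.

(** * Closures of subgroups and extension of invariant functions *)

Section Extension.
Variables (G : groupType) (K : set G) (L : topGroupType) (e : G -> L).
Hypothesis hK : hecke_pair K.
Hypothesis hL : is_schlichting_completion K e.
Implicit Types (x y g : G) (l m u : L).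

Local Notation Kb := (Kbar K e).
Let hKb : is_subgroup Kb := Kbar_subgroup hK hL.

Lemma cosub_Kbar : cosub Kb.
Proof. by split; [exact: hKb|exact: (Kbar_open hK hL)|exact: (Kbar_compact hK hL)]. Qed.

Lemma sch_tdlc V : nbhs (1%g : L) V -> exists U, cosub U /\ U `<=` V.
Proof.
move=> V1; have [s sV] := Us_basis hK hL V1; exists (Us K e s `&` Kb); split.
  by rewrite setIC; apply: cosub_open_subgroupI; [exact: cosub_Kbar|exact: (Us_subgroup hK hL)|exact: (Us_open hK hL)].
by move=> l [/sV].
Qed.

Section Closure.
Variable M : set G.
Hypothesis hM : is_subgroup M.
Hypothesis KM : K `<=` M.

(** As [Kbar] is open and [M] contains [K], the closure is [e(M) Kbar]; membership of [l] can
    therefore be tested on any [g] approximating [l] modulo [Kbar]. *)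
Lemma closure_imageP l : closure (e @` M) l <-> exists2 g, M g & Kb ((e g)^-1 * l)%g.
Proof.
split=> [cl|[g Mg gl] A Al].
  have [|_ [[g Mg <-] gl]] := cl [set m | Kb (m^-1 * l)%g].
    by apply: inv_mul_continuous; rewrite /= mulVg; exact: (Kbar_nbhs hL).
  by exists g.
have [|g' [Ag' gg']] := sch_dense hL (l := l) (V := A `&` [set m | Kb ((e g)^-1 * m)%g]).
  apply: filterI => //; apply: open_nbhs_nbhs; split=> //.
  by apply: open_coset => //; exact: (Kbar_open hK hL).
exists (e g'); split=> //; exists g' => //.
move: gg'; rewrite /= -(schV hL) -(schM hL) => /(Kbar_e hK hL)/KM Mgg'.
by rewrite -(mulVKg g g'); exact: gsubM.
Qed.

Lemma clos_e g : closure (e @` M) (e g) <-> M g.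
Proof.
split=> [/closure_imageP[g' Mg']|Mg]; last by apply: subset_closure; exists g.
rewrite -(schV hL) -(schM hL) => /(Kbar_e hK hL)/KM Mgg'.
by rewrite -(mulVKg g' g); exact: gsubM.
Qed.

Lemma clos_subgroup : is_subgroup (closure (e @` M)).
Proof.
apply: closure_subgroup; split=> [|_ _ [x Kx <-] [y Ky <-]|_ [x Kx <-]].
- by exists 1%g; [exact: gsub1|rewrite (sch1 hL)].
- by exists (x * y)%g; [exact: gsubM|rewrite (schM hL)].
- by exists x^-1%g; [exact: gsubV|rewrite (schV hL)].
Qed.

Lemma Kbar_clos : Kb `<=` closure (e @` M).
Proof. by apply: closure_subset => _ [g /KM Mg <-]; exists g. Qed.

Lemma clos_open : open (closure (e @` M)).
Proof.
apply: nbhs1_subgroup_open; first exact: clos_subgroup.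
by apply: filterS (Kbar_nbhs hL); exact: Kbar_clos.
Qed.

Lemma clos_coset g l : Kb ((e g)^-1 * l)%g -> closure (e @` M) l <-> M g.
Proof.
move=> gl; split=> [/closure_imageP[g' Mg' gl']|Mg]; last by apply/closure_imageP; exists g.
have : Kb ((e g')^-1 * e g)%g.
  have -> : ((e g')^-1 * e g = ((e g')^-1 * l) * ((e g)^-1 * l)^-1)%g by rewrite !group_simp.
  by apply: (subM hKb) => //; exact: (subV hKb).
rewrite -(schV hL) -(schM hL) => /(Kbar_e hK hL)/KM Mgg'.
by rewrite -(mulVKg g' g); exact: gsubM.
Qed.

Lemma clos_compact (t : seq G) : (forall g, M g -> exists2 k, k \in t & K (k^-1 * g)%g) ->
  compact (closure (e @` M)).
Proof.
move=> ht; apply: (@subclosed_compact _ _ (cosets Kb (map e t))).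
- exact: closed_closure.
- exact: compact_cosets cosub_Kbar.
move=> l /closure_imageP[g Mg gl]; have [k kt kg] := ht g Mg.
exists (e k); first exact: map_f.
have -> : ((e k)^-1 * l = ((e k)^-1 * e g) * ((e g)^-1 * l))%g by rewrite !group_simp.
apply: (subM hKb) => //; rewrite -(schV hL) -(schM hL); exact/(Kbar_e hK hL).
Qed.

End Closure.

Definition sch_rep l : G := xget 1%g [set g | Kb ((e g)^-1 * l)%g].

Lemma sch_repP l : Kb ((e (sch_rep l))^-1 * l)%g.
Proof.
rewrite /sch_rep; case: xgetP => [g _ //|H].
have [|g gl] := sch_dense hL (l := l) (V := [set m | Kb (m^-1 * l)%g]).
  by apply: inv_mul_continuous; rewrite /= mulVg; exact: (Kbar_nbhs hL).
by have := H g.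
Qed.

Variable R : realType.
Implicit Types (f : G -> cplx R) (F : L -> cplx R).

(* For a right K-invariant f, its unique right Kbar-invariant extension. *)
Definition sch_ext f : L -> cplx R := fun l => f (sch_rep l).

Definition rinv f : Prop := forall x k, K k -> f (x * k)%g = f x.

Lemma sch_extE f g l : rinv f -> Kb ((e g)^-1 * l)%g -> sch_ext f l = f g.
Proof.
move=> fK gl; have rl := @sch_repP l.
have : Kb ((e g)^-1 * e (sch_rep l))%g.
  have -> : ((e g)^-1 * e (sch_rep l) = ((e g)^-1 * l) * ((e (sch_rep l))^-1 * l)^-1)%g.
    by rewrite !group_simp.
  by apply: (subM hKb) => //; exact: (subV hKb).
rewrite -(schV hL) -(schM hL) => /(Kbar_e hK hL) Kg.
by rewrite /sch_ext -(fK g _ Kg) mulVKg.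
Qed.

Lemma sch_ext_e f g : rinv f -> sch_ext f (e g) = f g.
Proof. by move=> fK; apply: sch_extE => //; rewrite mulVg; exact: (sub1 hKb). Qed.

Lemma sch_ext_mulr f l u : rinv f -> Kb u -> sch_ext f (l * u)%g = sch_ext f l.
Proof.
move=> fK Ku; apply: sch_extE => //; rewrite mulgA; apply: (subM hKb) => //.
exact: sch_repP.
Qed.

Lemma Kbar_mulr_continuous F : (forall l u, Kb u -> F (l * u)%g = F l) -> continuous F.
Proof.
move=> FK; apply: continuous_unif_r => d d0; exists Kb; split; first exact: cosub_Kbar.
by move=> l u Ku; rewrite FK // subrr rnorm0 ltW.
Qed.

Lemma sch_ext_continuous f : rinv f -> continuous (sch_ext f).
Proof. by move=> fK; apply: Kbar_mulr_continuous => l u; exact: sch_ext_mulr. Qed.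

Lemma Kbar_ext_unique F : (forall l u, Kb u -> F (l * u)%g = F l) -> F = sch_ext (fun g => F (e g)).
Proof.
move=> FK; apply/funext => l; by rewrite /sch_ext -(FK (e (sch_rep l)) _ (@sch_repP l)) mulVKg.
Qed.

End Extension.

(** * The Hecke algebra as a corner *)

(** The hypotheses of the theorem in one record, except directedness, which is added with the
    induced representations. *)
Record triple_setting (R : realType) (G : groupType) (H : set G) (sigma : G -> cplx R)
    (L : topGroupType) (e : G -> L) (sigma' : L -> cplx R)
    (I : (L -> cplx R) -> cplx R) (Delta : L -> cplx R) : Prop := TripleSetting {
  tsred : reduced_hecke_triple H sigma;
  tsB : is_subgroup (Bset H sigma);
  tsL : is_schlichting_completion (char_ker H sigma) e;
  tss : is_character_extension e H sigma sigma';
  tsI : is_haar (closure (e @` Bset H sigma)) I;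
  tsI1 : I (fun x => \1_(closure (e @` H)) x : R[i]) = 1;
  tsD : is_modular_function (closure (e @` Bset H sigma)) I Delta
}.

Section Triple.
Variables (R : realType) (G : groupType) (H : set G) (sigma : G -> cplx R).
Variables (L : topGroupType) (e : G -> L) (sigma' : L -> cplx R).
Variables (I : (L -> cplx R) -> cplx R) (Delta : L -> cplx R).
Hypothesis ts : triple_setting H sigma e sigma' I Delta.
Local Notation K := (char_ker H sigma).
Local Notation B := (Bset H sigma).
Local Notation Kb := (Kbar K e).
Local Notation Hb := (closure (e @` H)).
Local Notation S := (closure (e @` B)).
Local Notation conv := (Defs.conv I).
Local Notation star := (conv_star Delta).
Local Notation Cc := (@Cc R L S).
Implicit Types (g : G) (l m u : L) (F : L -> cplx R) (f : G -> cplx R).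

Lemma tsH : is_subgroup H. Proof. by case: (tsred ts) => -[[]]. Qed.
Lemma tsK : hecke_pair K. Proof. by case: (tsred ts) => _ []. Qed.
Let hH := tsH.
Let hK := tsK.
Let hL := tsL ts.
Let hB := tsB ts.

Lemma sigma_norm g : H g -> `|sigma g| = 1.
Proof. by case: (tsred ts) => -[_ [+ _ _]] _; apply. Qed.

Lemma sigmaM g k : H g -> H k -> sigma (g * k)%g = sigma g * sigma k.
Proof. by case: (tsred ts) => -[_ [_ + _]] _; apply. Qed.

Lemma sigma_neq0 g : H g -> sigma g != 0.
Proof. by move=> Hg; rewrite -normr_eq0 sigma_norm ?oner_eq0. Qed.

Lemma sigma1 : sigma 1%g = 1.
Proof.
have H1 := gsub1 hH; apply: (mulfI (sigma_neq0 H1)).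
by rewrite -sigmaM // !mulg1 mulr1.
Qed.

Lemma sigma_conjM g : H g -> sigma g * (sigma g)^*%R = 1.
Proof. by move=> Hg; rewrite -normCK sigma_norm // expr1n. Qed.

Lemma sigmaV g : H g -> sigma g^-1%g = (sigma g)^*%R.
Proof.
move=> Hg; apply: (mulfI (sigma_neq0 Hg)).
by rewrite -sigmaM ?mulgV ?sigma1 ?sigma_conjM //; exact: gsubV.
Qed.

Lemma char_ker_sub : K `<=` H. Proof. by move=> x []. Qed.
Let KH := char_ker_sub.

(** The values of [sigma] commute, so conjugation inside [H] leaves them alone. *)
Lemma sub_Bset : H `<=` B.
Proof.
move=> x Hx k Hk _; have Hx' := gsubV hH Hx; have Hk' := gsubM hH Hx' Hk.
by rewrite !sigmaM // sigmaV // mulrAC [_^*%R * _]mulrC sigma_conjM // mul1r.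
Qed.

Let HB := sub_Bset.
Lemma char_ker_Bset : K `<=` B. Proof. by move=> x /KH/HB. Qed.
Let KB := char_ker_Bset.

(** The finite range of [sigma] gives [K] finite index in [H]: one representative for each value.
    This is what makes the closure of [H] compact. *)
Lemma HK_cover : exists t : seq G, forall g, H g -> exists2 k, k \in t & K (k^-1 * g)%g.
Proof.
have [_ [_ _]] := (tsred ts).1 => /finite_seqP[s sE].
exists [seq xget 1%g [set g | H g /\ sigma g = z] | z <- s] => g Hg.
have : (sigma @` H) (sigma g) by exists g.
rewrite sE /= => zs; exists (xget 1%g [set k | H k /\ sigma k = sigma g]); first exact: map_f.
case: xgetP => [k _ [Hk kg]|/(_ g)]; last by case.
have Hk' := gsubV hH Hk.
split; first exact: gsubM.
by rewrite sigmaM // sigmaV // kg mulrC sigma_conjM.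
Qed.

Let hKb : is_subgroup Kb := Kbar_subgroup hK hL.
Let hHb : is_subgroup Hb := clos_subgroup hL hH.
Let hSb : is_subgroup S := clos_subgroup hL hB.

Lemma cosub_Hb : cosub Hb.
Proof.
split; [exact: hHb|exact: (clos_open hL hH KH)|].
by have [t ht] := HK_cover; exact: (clos_compact hK hL hH KH ht).
Qed.

Lemma HbS : Hb `<=` S.
Proof. by apply: closure_subset => _ [g /HB Bg <-]; exists g. Qed.

Lemma KbHb : Kb `<=` Hb. Proof. exact: (@Kbar_clos _ _ _ e _ KH). Qed.

Lemma KbS : Kb `<=` S. Proof. by move=> l /KbHb/HbS. Qed.

Lemma triple_haar : haar_setting S I.
Proof.
have oS := clos_open hL hB KB.
have [_ oH kH] := cosub_Hb; have cH := open_subgroup_closed hHb oH.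
have hs0 : Cc (fun x => \1_Hb x).
  split.
  - exact: continuous_indic.
  - apply: (subclosed_compact _ kH); first exact: closed_closure.
    rewrite [X in _ `<=` X](_ : Hb = closure Hb); last by apply/closure_id.
    by apply: closure_subset => x /= nz; apply: contrapT => nH; move: nz; rewrite indicF ?eqxx.
  - by move=> x nS; rewrite indicF // => /HbS.
split=> //; [exact: (sch_haus hL)|exact: (sch_tdlc hK hL)|exact: (tsI ts)|].
exists (fun x => \1_Hb x); split=> //; rewrite (tsI1 ts); apply/eqP; exact: oner_neq0.
Qed.
Local Notation h := triple_haar.
Let hD := tsD ts.

Lemma mu_Hb : haar_mu I Hb = 1.
Proof. by rewrite /haar_mu (tsI1 ts). Qed.

(** Approximation modulo [Kbar] is not multiplicative by itself. So [y] is chosen before [x], and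
    [x] approximates [l] modulo both [Kbar] and its conjugate by [e y]; then [y^-1 (x^-1 l) y] and
    [y^-1 m] are both in [Kbar]. *)
Lemma sch_approx l m : exists x y,
  [/\ Kb ((e x)^-1 * l)%g, Kb ((e y)^-1 * m)%g & Kb ((e (x * y))^-1 * (l * m))%g].
Proof.
pose y := sch_rep K e m; have ym : Kb ((e y)^-1 * m)%g by exact: (sch_repP hL).
have cK := cosub_Kbar hK hL.
have n1 := cosub_nbhs cK; have n2 := cosub_nbhs (cosub_conj (e y) cK).
have [|x [xl yl]] := sch_dense hL (l := l)
  (V := [set w | Kb (w^-1 * l)%g] `&` [set w | conj_by (e y) Kb (w^-1 * l)%g]).
  by apply: filterI; apply: inv_mul_continuous; rewrite /= mulVg.
exists x, y; split=> //; have := subM hKb yl ym.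
by rewrite (schM hL) !group_simp.
Qed.

Definition proj0 : G -> cplx R := fun g => (\1_H g : R[i]) * sigma g.

Lemma proj0T g : H g -> proj0 g = sigma g. Proof. by move=> Hg; rewrite /proj0 indicT // mul1r. Qed.
Lemma proj0F g : ~ H g -> proj0 g = 0. Proof. by move=> nHg; rewrite /proj0 indicF // mul0r. Qed.

Lemma proj0_rinv : rinv K proj0.
Proof.
move=> x k [Hk k1]; have [Hx|nHx] := pselect (H x).
  by rewrite !proj0T //; [rewrite sigmaM // k1 mulr1|exact: gsubM].
rewrite !proj0F // => Hxk; apply: nHx; rewrite -(mulgK k x).
by apply: gsubM => //; exact: gsubV.
Qed.

Local Notation p := (proj_fun e H sigma').

(** In the open coset of [Kbar] around [l], the dense points [e x] all have [sigma x = sigma g];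
    continuity of [sigma'] carries this value to [l]. *)
Lemma projE : p = sch_ext K e proj0.
Proof.
apply/funext => l; rewrite /proj_fun; have rl := @sch_repP _ _ _ _ hL l.
have Hrl := clos_coset hK hL hH KH rl.
rewrite /sch_ext; set g := sch_rep K e l in rl Hrl *.
have [Hl|nHl] := pselect (Hb l); last first.
  by rewrite indicF // mul0r proj0F // => /Hrl.
have Hg : H g by exact/Hrl.
rewrite indicT // mul1r proj0T //.
have [sc sE] := tss ts.
have oH := clos_open hL hH KH.
have sc' : {in Hb, continuous sigma'} by rewrite -continuous_open_subspace.
apply/esym/eqP; rewrite -subr_eq0; apply/eqP/rnorm_le_eq0 => d d0.
have : sigma' x @[x --> l] --> sigma' l by apply: sc'; rewrite inE.
move=> /cvgrPdist_le/(_ d%:C); rewrite ltcR => /(_ d0) near_l.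
have oK : open Kb by exact: (Kbar_open hK hL).
have nK : nbhs l [set m | Kb ((e g)^-1 * m)%g].
  by apply: open_nbhs_nbhs; split => //; exact: open_coset.
have [x [/= xl xg]] := sch_dense hL (filterI near_l nK).
have Hx : H x by exact/(clos_e hK hL hH KH)/(clos_coset hK hL hH KH xg).
move: xg; rewrite -(schV hL) -(schM hL) => /(Kbar_e hK hL)[Hgx gx1].
have sgx : sigma x = sigma g by rewrite -(mulVKg g x) sigmaM // gx1 mulr1.
by move: xl; rewrite sE // sgx -rnormE lecR rnormBC.
Qed.

Lemma pE g l : Kb ((e g)^-1 * l)%g -> p l = proj0 g.
Proof. by move=> gl; rewrite projE; apply: (sch_extE hK hL proj0_rinv). Qed.

Lemma p_out l : ~ Hb l -> p l = 0.
Proof. by move=> nl; rewrite /proj_fun indicF // mul0r. Qed.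

Lemma pM l m : Hb l -> Hb m -> p (l * m)%g = p l * p m.
Proof.
move=> Hl Hm; have [x [y [xl ym xyl]]] := sch_approx l m.
have Hx := (clos_coset hK hL hH KH xl).1 Hl; have Hy := (clos_coset hK hL hH KH ym).1 Hm.
rewrite (pE xl) (pE ym) (pE xyl) !proj0T //; first exact: sigmaM.
exact: gsubM.
Qed.

Lemma p_conj l : Hb l -> p l * (p l)^*%R = 1.
Proof.
move=> Hl; have rl := @sch_repP _ _ _ _ hL l.
have Hx := (clos_coset hK hL hH KH rl).1 Hl.
by rewrite (pE rl) proj0T // sigma_conjM.
Qed.

Lemma p_neq0 l : Hb l -> p l != 0.
Proof. by move=> /p_conj pl; apply/eqP => p0; move/eqP: pl; rewrite p0 mul0r eq_sym oner_eq0. Qed.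

Lemma p_Kb u : Kb u -> p u = 1.
Proof.
move=> Ku; rewrite (@pE 1%g) ?proj0T ?sigma1 //; first exact: gsub1.
by rewrite (sch1 hL) invg1 mul1g.
Qed.

Lemma p1 : p 1%g = 1. Proof. exact: (p_Kb (sub1 hKb)). Qed.

Lemma pV l : Hb l -> p l^-1%g = (p l)^*%R.
Proof.
move=> Hl; apply: (mulfI (p_neq0 Hl)).
by rewrite -(pM Hl (subV hHb Hl)) mulgV p1 p_conj.
Qed.

Lemma p_continuous : continuous p.
Proof. by rewrite projE; apply: (sch_ext_continuous hK hL proj0_rinv). Qed.

Lemma Cc_p : Cc p.
Proof.
have [_ _ kH] := cosub_Hb.
apply: (Cc_intro h p_continuous kH HbS) => l nz; apply: contrapT => nl.
by apply: nz; exact: p_out.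
Qed.

(** On [C_c] this and the next condition amount to [p * F = F] and [F * p = F]; the pointwise form
    can be compared directly with equivariance on [G]. *)
Definition left_eq F : Prop := forall k l, Hb k -> F (k * l)%g = p k * F l.
Definition right_eq F : Prop := forall k l, Hb k -> F (l * k)%g = F l * p k.

Lemma p_left : left_eq p.
Proof.
move=> k l Hk; have [Hl|nl] := pselect (Hb l); first exact: pM.
by rewrite (p_out nl) mulr0 p_out // => /(subMl _ hHb Hk).
Qed.

Lemma p_right : right_eq p.
Proof.
move=> k l Hk; have [Hl|nl] := pselect (Hb l); first exact: pM.
by rewrite (p_out nl) mul0r p_out // => /(subMr _ hHb Hk).
Qed.

Lemma right_eq_Kb F l u : right_eq F -> Kb u -> F (l * u)%g = F l.
Proof. by move=> Fr Ku; rewrite Fr; [rewrite p_Kb // mulr1|exact: KbHb]. Qed.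

Lemma conv_right F F' : Cc F -> Cc F' -> right_eq F' -> right_eq (conv F F').
Proof.
move=> CF CF' Fr k l Hk.
by apply: (conv_rmul h CF (Cc_cont CF')) => m; exact: Fr.
Qed.

Lemma conv_left F F' : Cc F -> Cc F' -> left_eq F -> left_eq (conv F F').
Proof.
move=> CF CF' Fl k l Hk.
by apply: (conv_lmul h (HbS Hk) CF (Cc_cont CF')) => m; exact: Fl.
Qed.

Lemma star_left F : Cc F -> right_eq F -> left_eq (star F).
Proof.
move=> CF Fr k l Hk; have Hk' := subV hHb Hk.
have k1 := Delta_cosub triple_haar hD cosub_Hb HbS Hk.
rewrite (star_lmul h hD (c := p k^-1%g) (HbS Hk) k1 _ CF); last by move=> x; exact: Fr.
by rewrite pV // conjCK.
Qed.

Lemma star_right F : Cc F -> left_eq F -> right_eq (star F).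
Proof.
move=> CF Fl k l Hk; have Hk' := subV hHb Hk.
have [Sl|nS] := pselect (S l); last first.
  rewrite !(star_out Delta triple_haar CF) ?mul0r // => /(subMr _ hSb (HbS Hk)) //.
rewrite /conv_star invgM Fl // pV // conjcM conjCK.
rewrite (DeltaM h hD (HbS Hk') (subV hSb Sl)) (Delta_cosub triple_haar hD cosub_Hb HbS Hk') mul1r.
have alg (a b c : R[i]) : b * (a * c) = b * c * a by ring.
exact: alg.
Qed.

Lemma conv_pl F : Cc F -> left_eq F -> conv p F = F.
Proof.
move=> CF Fl; apply/funext => x; rewrite /Defs.conv.
have CH := Cc_cosub_indic h cosub_Hb HbS.
have -> : (fun y => p y * F (y^-1 * x)%g) = F x *: (fun y => \1_Hb y : cplx R).
  apply/funext => y; rewrite fctE; have [Hy|ny] := pselect (Hb y); last first.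
    by rewrite p_out // indicF // mul0r scaler0.
  rewrite (Fl _ _ (subV hHb Hy)) pV // mulrA p_conj // mul1r indicT //.
  by rewrite -[RHS]/(F x * 1) mulr1.
by rewrite (IZ h _ CH) (tsI1 ts) mulr1.
Qed.

Lemma conv_pr F : Cc F -> right_eq F -> conv F p = F.
Proof.
move=> CF Fr; apply/funext => x; rewrite /Defs.conv.
have [Fx|Fx] := pselect (F x = 0).
  rewrite Fx (_ : (fun y => _) = 0) ?(I0 h) //; apply/funext => y.
  have [Hy|ny] := pselect (Hb (y^-1 * x)%g); last by rewrite p_out // mulr0.
  by have := Fr (y^-1 * x)%g y Hy; rewrite mulVKg Fx => <-.
have Sx := Cc_in CF Fx.
have CH := Cc_coset_indic h cosub_Hb HbS Sx.
have -> : (fun y => F y * p (y^-1 * x)%g) = F x *: (fun y => \1_[set z | Hb (x^-1 * z)%g] y : cplx R).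
  apply/funext => y; rewrite fctE; have [Hy|ny] := pselect (Hb (x^-1 * y)%g); last first.
    by rewrite p_out ?indicF ?mulr0 ?scaler0 // => /(coset_sym hHb).
  have := Fr _ y (coset_sym hHb Hy); rewrite mulVKg => <-.
  by rewrite indicT // -[RHS]/(F x * 1) mulr1.
by rewrite (IZ h _ CH) (I_indic h CH) (haar_mu_coset h cosub_Hb HbS Sx) mu_Hb mulr1.
Qed.

Lemma star_p : star p = p.
Proof.
apply/funext => x; have [Hx|nx] := pselect (Hb x).
  rewrite /conv_star (Delta_cosub h hD cosub_Hb HbS (subV hHb Hx)) mul1r.
  by rewrite pV // conjCK.
rewrite /conv_star !p_out ?conjC0 ?mulr0 // => /(subVE _ hHb) //.
Qed.

End Triple.

(** * Hecke product and involution compared with convolution *)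

Section HeckeCorner.
Variables (R : realType) (G : groupType) (H : set G) (sigma : G -> cplx R).
Variables (L : topGroupType) (e : G -> L) (sigma' : L -> cplx R).
Variables (I : (L -> cplx R) -> cplx R) (Delta : L -> cplx R).
Hypothesis ts : triple_setting H sigma e sigma' I Delta.
Local Notation K := (char_ker H sigma).
Local Notation B := (Bset H sigma).
Local Notation Kb := (Kbar K e).
Local Notation Hb := (closure (e @` H)).
Local Notation S := (closure (e @` B)).
Local Notation conv := (Defs.conv I).
Local Notation star := (conv_star Delta).
Local Notation Cc := (@Cc R L S).
Local Notation p := (proj_fun e H sigma').
Local Notation left_eq := (@left_eq R G H L e sigma').
Local Notation right_eq := (@right_eq R G H L e sigma').
Implicit Types (g : G) (l m u : L) (F : L -> cplx R) (f : G -> cplx R).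

Let hH := tsH ts.
Let hK := tsK ts.
Let hL := tsL ts.
Let hB := tsB ts.
Let h := triple_haar ts.
Let hD := tsD ts.
Let hKb : is_subgroup Kb := Kbar_subgroup hK hL.
Let hHb : is_subgroup Hb := clos_subgroup hL hH.
Let hSb : is_subgroup S := clos_subgroup hL hB.
Let KH : K `<=` H := @char_ker_sub R G H sigma.
Let HB : H `<=` B := sub_Bset ts.
Let KB : K `<=` B := char_ker_Bset ts.

Lemma I_sum (T : Type) (r : seq T) (k : T -> cplx R) (chi : T -> L -> cplx R) :
  (forall c, Cc (chi c)) ->
  Cc (\sum_(c <- r) k c *: chi c) /\ I (\sum_(c <- r) k c *: chi c) = \sum_(c <- r) k c * I (chi c).
Proof.
move=> Cchi; elim: r => [|c r [ih1 ih2]].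
  by rewrite !big_nil; split; [exact: (Cc0 h)|exact: (I0 h)].
by rewrite !big_cons; split; [exact: (CcP h)|rewrite (I_lin h) // ih2].
Qed.

(** Passage from integrals on [L] to sums over cosets in [G]: an integrand of a convolution gives
    the Hecke product, an indicator gives a subgroup index. Any [S''] that contains the points of
    [G] where [phi] is nonzero will do, which covers sums over [G/H] and over [B/H] alike. *)
Lemma coset_sum (U : set L) (phi : L -> cplx R) (S'' : set G) :
  cosub U -> U `<=` S -> Cc phi -> (forall l u, U u -> phi (l * u)%g = phi l) ->
  (forall g, phi (e g) != 0 -> S'' g) ->
  I phi = (haar_mu I U)%:C *
    \sum_(c \in left_cosets S'' [set g | U (e g)]) phi (e (xget 1%g c)).
Proof.
move=> cU US Cphi phiU phiS; have hU : is_subgroup U by case: cU.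
set M := [set g | U (e g)].
have hM : is_subgroup M.
  split=> [|x y|x]; rewrite /M /=; first by rewrite (sch1 hL); exact: sub1.
    by rewrite (schM hL); exact: subM.
  by rewrite (schV hL); exact: subV.
have Me x y : M (x^-1 * y)%g <-> U ((e x)^-1 * e y)%g by rewrite /M /= (schM hL) (schV hL).
have phi_eq l m : U (l^-1 * m)%g -> phi m = phi l.
  by move=> lm; rewrite -(phiU l _ lm) mulVKg.
have [t ht] : exists t : seq G, forall l, phi l <> 0 -> exists2 b, b \in t & U ((e b)^-1 * l)%g.
  have [s _ phis] := Cc_cover h Cphi cU.
  have /choice[b hb] : forall l, exists g, U (l^-1 * e g)%g.
    move=> l; have [|g] := sch_dense hL (l := l) (V := [set m | U (l^-1 * m)%g]); last by exists g.
    exact: nbhs_coset (cosub_nbhs cU).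
  exists (map b s) => l /phis[y ys yl]; exists (b y); first exact: map_f.
  by apply: (coset_trans hU (y := y)) => //; exact: (coset_sym hU (hb y)).
pose r := undup [seq left_coset b M | b <- t & phi (e b) != 0].
have xgetM b : M (b^-1 * xget 1%g (left_coset b M))%g.
  apply/left_cosetP; case: xgetP => [y _ //|/(_ b)]; case; exact: left_coset_self.
have phix b : phi (e (xget 1%g (left_coset b M))) = phi (e b).
  by apply: phi_eq; apply/Me; exact: xgetM.
have in_r b : b \in t -> phi (e b) != 0 -> left_coset b M \in r.
  by move=> bt pb; rewrite mem_undup; apply: map_f; rewrite mem_filter pb.
rewrite (fsbigE r) ?undup_uniq //; last 2 first.
- move=> c /=; rewrite mem_undup => /mapP[b]; rewrite mem_filter => /andP[/phiS Sb _] ->.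
  by exists b.
- move=> c [y _ <-] /negP nr; apply: contrapT; rewrite phix => py; apply: nr.
  have [b bt /Me by_] := ht _ py; rewrite -(left_coset_eq hM by_); apply: in_r => //.
  by rewrite -(phi_eq (e b) (e y)) //; [exact/eqP|exact/Me].
rewrite big_seq_cond (eq_bigl (fun c => c \in r)); last first.
  move=> c; case: (boolP (c \in r)) => //=.
  rewrite mem_undup => /mapP[b]; rewrite mem_filter => /andP[/phiS Sb _] ->.
  by apply: mem_set; exists b.
rewrite -big_seq.
pose chi (c : set G) l : cplx R := \1_[set m | U ((e (xget 1%g c))^-1 * m)%g] l.
(* Cosets not based in [S] get 0, so that every term is in [C_c] and the sum can be integrated
   without side conditions. *)
pose chi' (c : set G) : L -> cplx R := if `[< S (e (xget 1%g c)) >] then chi c else 0.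
have Cchi c : Cc (chi' c).
  rewrite /chi'; case: asboolP => Sc; last exact: (Cc0 h).
  exact: (Cc_coset_indic h cU US Sc).
have chiE b : b \in t -> phi (e b) != 0 -> chi' (left_coset b M) = chi (left_coset b M).
  move=> bt pb; rewrite /chi'; case: asboolP => // nS; exfalso; apply: nS.
  by apply: (Cc_in Cphi); rewrite phix; exact/eqP.
have phiE : phi = \sum_(c <- r) phi (e (xget 1%g c)) *: chi' c.
  apply/funext => l; rewrite fct_sumE.
  have rP c : c \in r -> exists b, [/\ b \in t, phi (e b) != 0 & c = left_coset b M].
    by rewrite mem_undup => /mapP[b]; rewrite mem_filter => /andP[pb bt] ->; exists b.
  have [pl|pl] := pselect (phi l = 0).
    rewrite big1_seq // => c /= /rP[b [bt pb ->]]; rewrite chiE // fctE /chi phix.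
    have [bl|nbl] := pselect (U ((e (xget 1%g (left_coset b M)))^-1 * l)%g); last first.
      by rewrite indicF // scaler0.
    by have := phi_eq _ _ bl; rewrite pl phix => <-; rewrite scale0r.
  have [b bt bl] := ht l pl; have pb : phi (e b) != 0 by rewrite -(phi_eq _ _ bl); exact/eqP.
  rewrite (bigD1_seq (left_coset b M)) ?undup_uniq ?in_r //= big1_seq ?addr0; last first.
    move=> c /andP[cb /rP[b' [bt' pb' cE]]]; rewrite cE in cb *.
    rewrite chiE // fctE /chi indicF ?scaler0 // => /= b'l; move/eqP: cb; apply.
    apply: left_coset_eq => //; apply/Me.
    apply: (coset_trans hU (y := e (xget 1%g (left_coset b' M)))); first exact/Me.
    by apply: (coset_trans hU b'l); exact: coset_sym.
  rewrite chiE // fctE /chi phix indicT /=; first by rewrite -[_ *: 1]/(_ * 1) mulr1 (phi_eq _ _ bl).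
  by apply: (coset_trans hU _ bl); apply: (coset_sym hU); exact/Me.
rewrite {1}phiE; have [_ ->] := I_sum r (fun c => phi (e (xget 1%g c))) Cchi.
rewrite mulr_sumr; apply: eq_big_seq => c; rewrite mem_undup => /mapP[b].
rewrite mem_filter => /andP[pb bt] ->; rewrite chiE // mulrC; congr (_ * _).
have Sc : S (e (xget 1%g (left_coset b M))).
  by apply: (Cc_in Cphi); rewrite phix; exact/eqP.
rewrite /chi (I_indic h (Cc_coset_indic h cU US Sc)); congr (_%:C).
exact: (haar_mu_coset h cU US Sc).
Qed.

Lemma mu_index (U V : set L) (A M : set G) : cosub U -> U `<=` S -> cosub V -> V `<=` U ->
  (forall g, U (e g) <-> A g) -> (forall g, V (e g) <-> M g) -> finite_set (left_cosets A M) ->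
  haar_mu I U = (subgroup_index A M)%:R * haar_mu I V.
Proof.
move=> cU US cV VU UA VM fin; have hU : is_subgroup U by case: cU.
have CU := Cc_cosub_indic h cU US; have VS : V `<=` S by move=> x /VU/US.
have hM : M = [set g | V (e g)] by apply/seteqP; split=> g /VM.
have hV : is_subgroup V by case: cV.
apply: complexI; rewrite -(I_indic h CU) (@coset_sum V _ A) //; last 2 first.
- move=> l u /VU Uu; have [Ul|nU] := pselect (U l); first by rewrite !indicT //; exact: subM.
  by rewrite !indicF // => /(subMr _ hU Uu).
- by move=> g; have [Ug _|nU] := pselect (U (e g)); [exact/UA|rewrite indicF ?eqxx].
rewrite -hM rcM mulrC; congr (_ * _); rewrite fsbig_finite //.
rewrite big_seq (eq_bigr (fun=> 1)); last first.
  move=> c; rewrite in_fset_set // inE => -[y Ay <-]; rewrite indicT //.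
  have yx : M (y^-1 * xget 1%g (left_coset y M))%g.
    apply/left_cosetP; case: xgetP => [z _ //|/(_ y)]; case; apply/left_cosetP.
    by rewrite mulVg; apply/VM; rewrite (sch1 hL); exact: sub1.
  rewrite -(mulVKg y (xget _ _)) (schM hL); apply: (subM hU); first exact/UA.
  by apply: VU; exact/VM.
rewrite -big_seq big_const_seq count_predT iter_addr_0.
exact: (esym (rmorph_nat (real_complex R) _)).
Qed.

(** With [V g] the intersection of [Kbar] and its conjugate by [e g], the measure of [Kbar] is an
    index times that of [V g], and likewise for [g^-1]. Conjugation by [e g] maps [V g^-1] onto
    [V g], and [Delta] measures the change of volume. *)
Lemma Delta_hecke g : B g -> hecke_Delta H sigma g = Delta (e g).
Proof.
move=> Bg.
have Sg : S (e g) by apply/(clos_e hK hL hB KB).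
have Sg' := subV hSb Sg; have Bg' := gsubV hB Bg.
have cK := cosub_Kbar hK hL; have KS : Kb `<=` S := KbS ts.
pose V y := Kb `&` conj_by (e y) Kb.
have cV y : cosub (V y) by apply: cosubI => //; exact: cosub_conj.
have VK y : V y `<=` Kb by move=> l [].
have VS y : V y `<=` S by move=> l /VK/KS.
have idx y : haar_mu I Kb = (subgroup_index K (K `&` conj_set y K))%:R * haar_mu I (V y).
  apply: mu_index => //; [by move=> z; exact: Kbar_e| |exact: hK.2].
  move=> z; rewrite /V /conj_by; split=> -[] /=.
    rewrite -(schV hL) -!(schM hL) => /(Kbar_e hK hL) Kz /(Kbar_e hK hL) Kyz.
    by split=> //; apply/conj_setP.
  move=> Kz /conj_setP Kyz; split; first exact/(Kbar_e hK hL).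
  by rewrite /= -(schV hL) -!(schM hL); exact/(Kbar_e hK hL).
have CV := Cc_cosub_indic h (cV g) (VS g).
have := modularE hD Sg' CV.
have CV' := Cc_rshift h Sg' CV; rewrite -(I_left h Sg CV').
have -> : (fun l => \1_(V g) (e g * l * (e g)^-1)%g) = (fun l => \1_(V g^-1%g) l) :> (L -> cplx R).
  apply/funext => l; have [Vl|nV] := pselect (V g^-1%g l).
    rewrite !indicT //; move: Vl => [Kl]; rewrite /conj_by /= (schV hL) invgK => Kl'.
    by split=> //; rewrite /conj_by /= !group_simp.
  rewrite !indicF // => -[Kl]; rewrite /conj_by /= !group_simp => Kl'; apply: nV.
  by split=> //; rewrite /conj_by /= (schV hL) invgK.
have muV y := haar_mu_gt0 h (cV y) (VS y).
rewrite (I_indic h (Cc_cosub_indic h (cV _) (VS _))) (I_indic h CV) (DeltaV h hD Sg).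
have := idx g; rewrite (idx g^-1%g).
have n0 : (subgroup_index K (K `&` conj_set g^-1%g K))%:R != 0 :> R.
  apply/eqP => n0; have := haar_mu_gt0 h cK KS.
  by rewrite (idx g^-1%g) n0 mul0r ltxx.
rewrite /hecke_Delta; move: (subgroup_index _ _) (subgroup_index _ _) n0 => m n n0.
have m1 := muV g; have m2 := muV g^-1%g; have d0 := Delta_neq0 hD Sg.
move: (Delta _) (haar_mu I (V g)) (haar_mu I (V g^-1%g)) d0 m1 m2 => d a b d0 a0 b0 e1 e2.
have nR k : k%:R = (k%:R : R)%:C :> R[i] by exact: (esym (rmorph_nat (real_complex R) k)).
rewrite !nR; have n0' : (n%:R : R)%:C != 0 :> R[i] by rewrite -(inj_eq (@complexI R)) in n0.
apply: (mulIf n0'); rewrite mulfVK //.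
have b0' : b%:C != 0 :> R[i] by rewrite gt_eqF // ltcR.
apply: (mulIf b0'); rewrite -[RHS]mulrA -[_%:C * b%:C in RHS]rcM e1 rcM -e2.
by rewrite [_ * (d^-1 * _)]mulrCA [RHS]mulrA mulfV // mul1r.
Qed.

Definition hecke_corner F : Prop := [/\ Cc F, left_eq F & right_eq F].
Local Notation HP := hecke_corner.
Definition resG F : G -> cplx R := fun g => F (e g).

Lemma sch_e_p g : H g -> p (e g) = sigma g.
Proof.
move=> Hg; rewrite (pE ts (g := g)) ?proj0T //.
by rewrite mulVg; exact: (sub1 hKb).
Qed.

Lemma Hb_e g : H g -> Hb (e g). Proof. by move=> Hg; apply: subset_closure; exists g. Qed.

Lemma hecke_corner_p : HP p.
Proof. by split; [exact: (Cc_p ts)|exact: (p_left ts)|exact: (p_right ts)]. Qed.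

Lemma hecke_corner_lin (k : R[i]) F F' : HP F -> HP F' -> HP (k *: F + F').
Proof.
move=> [CF Fl Fr] [CF' Fl' Fr']; split; first exact: (CcP h k CF CF').
- move=> m l Hm; rewrite !fctE (Fl _ _ Hm) (Fl' _ _ Hm) mulrDr; congr (_ + _).
  exact: mulrCA.
- move=> m l Hm; rewrite !fctE (Fr _ _ Hm) (Fr' _ _ Hm) mulrDl; congr (_ + _).
  exact: mulrA.
Qed.

Lemma hecke_corner0 : HP 0.
Proof.
split; first exact: (Cc0 h).
- by move=> m l Hm; rewrite mulr0.
- by move=> m l Hm; rewrite mul0r.
Qed.

Lemma hecke_corner_conv F F' : HP F -> HP F' -> HP (conv F F').
Proof.
move=> [CF Fl Fr] [CF' Fl' Fr']; split; first exact: (Cc_conv h CF CF').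
  exact: (conv_left ts CF CF' Fl).
exact: (conv_right ts CF CF' Fr').
Qed.

Lemma hecke_corner_star F : HP F -> HP (star F).
Proof.
move=> [CF Fl Fr]; split; first exact: (Cc_star h hD CF).
  exact: (star_left ts CF Fr).
exact: (star_right ts CF Fl).
Qed.

Lemma hecke_corner_pFp F : Cc F -> HP (conv (conv p F) p).
Proof.
move=> CF; have [Cp pl pr] := hecke_corner_p; have CpF := Cc_conv h Cp CF; split.
- exact: (Cc_conv h CpF Cp).
- exact: (conv_left ts CpF Cp (conv_left ts Cp CF pl)).
- exact: (conv_right ts CpF Cp pr).
Qed.

Lemma hecke_corner_pp F : HP F -> conv (conv p F) p = F.
Proof. by move=> [CF Fl Fr]; rewrite (conv_pl ts CF Fl) (conv_pr ts CF Fr). Qed.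

Lemma hecke_corner_ext F : HP F -> F = sch_ext K e (resG F).
Proof.
move=> [CF Fl Fr]; apply: (Kbar_ext_unique hL) => l u Ku; exact: (right_eq_Kb ts _ Fr Ku).
Qed.

Lemma left_invariant F : Cc F -> right_eq F -> exists V, [/\ cosub V, V `<=` S & left_inv V F].
Proof.
move=> CF Fr; apply: (right_inv_left_inv h (cosub_Kbar hK hL) CF) => x u Ku.
exact: (right_eq_Kb ts _ Fr Ku).
Qed.

Variable S' : set G.
Hypothesis BS' : B `<=` S'.
Local Notation helt := (@hecke_elt R G S' H sigma).

(** For [k] in [H] with [x^-1 k x] in [H], the value at [k x = x (x^-1 k x)] can be computed from
    either side: [sigma k * f x = f x * sigma (x^-1 k x)]. This is why [G] and [B] have the same
    Hecke algebra. *)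
Lemma hecke_supp f x : helt f -> f x <> 0 -> B x.
Proof.
move=> [_ fe _] fx k Hk /conj_setP Hk'.
have := fe 1%g x (x^-1 * k * x)%g (gsub1 hH) Hk'.
have := fe k x 1%g Hk (gsub1 hH); rewrite (sigma1 ts) !mul1r !mulr1 !mul1g !mulg1 !mulgA mulgV mul1g.
move=> -> e1; have fx' : f x != 0 by exact/eqP.
by apply: (mulIf fx'); rewrite e1 mulrC.
Qed.

Lemma hecke_rinv f : helt f -> rinv K f.
Proof.
move=> [_ fe _] x k [Hk k1]; have := fe 1%g x k (gsub1 hH) Hk.
by rewrite (sigma1 ts) mul1g mul1r k1 mulr1.
Qed.

(** A double coset is a finite union of left cosets: [a x0 H] depends only on the class of [a] in
    [H] modulo [H] intersected with its conjugate by [x0], and that index is finite. *)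
Lemma hecke_cosets f : helt f ->
  exists t : seq G, forall x, f x <> 0 -> exists2 k, k \in t & H (k^-1 * x)%g.
Proof.
move=> [_ fe]; set A := [set _ | _ in _] => /finite_seqP[s sE].
have dc y x : double_coset H y x -> double_coset H y = double_coset H x.
  move=> [a Ha [b Hb_ <-]]; apply/seteqP; split=> _ [c Hc [d Hd <-]].
    exists (c * a^-1)%g; first by apply: (gsubM hH) => //; exact: (gsubV hH).
    exists (b^-1 * d)%g; first by apply: (gsubM hH) => //; exact: (gsubV hH).
    by rewrite !group_simp.
  exists (c * a)%g; first exact: gsubM.
  by exists (b * d)%g; [exact: gsubM|rewrite !group_simp].
have dcs x : double_coset H x x.
  by exists 1%g; [exact: gsub1|exists 1%g; [exact: gsub1|rewrite mul1g mulg1]].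
have [T hT] : exists T : set G -> seq G, forall c x, c = double_coset H x ->
    exists2 k, k \in T c & H (k^-1 * x)%g.
  suff /choice[T hT] : forall c, exists T : seq G, forall x, c = double_coset H x ->
    exists2 k, k \in T & H (k^-1 * x)%g by exists T.
  move=> c; have [[x0 cE]|nc] := pselect (exists x, c = double_coset H x); last first.
    by exists [::] => x cE; case: nc; exists x.
  pose M := H `&` conj_set x0 H.
  have hM : is_subgroup M.
    split=> [|y z [Ky /conj_setP hy] [Kz /conj_setP hz]|y [Ky /conj_setP hy]].
    - by split; [exact: gsub1|apply/conj_setP; rewrite mulg1 mulVg; exact: gsub1].
    - split; first exact: gsubM.
      by apply/conj_setP; have := gsubM hH hy hz; rewrite !group_simp.
    - split; first exact: gsubV.
      by apply/conj_setP; have := gsubV hH hy; rewrite !group_simp.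
  have hecke : hecke_pair H by case: (tsred ts) => -[].
  have [t [_ ht]] := finite_left_cosets hH hM (hecke.2 x0).
  exists [seq (k * x0)%g | k <- t] => x cx.
  have := dcs x; rewrite -cx cE => -[a Ha [b Hb_ <-]].
  have [k kt [_ /conj_setP Hk]] := ht a Ha.
  exists (k * x0)%g; first by apply/mapP; exists k.
  by have := gsubM hH Hk Hb_; rewrite !group_simp.
exists (flatten [seq T c | c <- s]) => x /eqP fx.
have : A (double_coset H x) by exists x.
rewrite sE /= => cs; have [k kT kx] := hT _ x erefl; exists k => //.
by apply/flatten_mapP; exists (double_coset H x).
Qed.

Lemma hecke_ext f : helt f -> HP (sch_ext K e f).
Proof.
move=> hf; have fr := hecke_rinv hf; have [_ fe _] := hf.
have [cH1 cH2 cH3] := cosub_Hb ts.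
split.
- have [t ht] := hecke_cosets hf.
  (* Only representatives in [B] are kept, so that the compact set they define lies in [S];
     [hecke_supp] shows that nothing of the support is lost. *)
  pose t' := [seq k <- t | `[< B k >]].
  have cont := sch_ext_continuous hK hL fr.
  have kt : compact (cosets Hb (map e t')) := @compact_cosets _ _ (map e t') (cosub_Hb ts).
  have tS : cosets Hb (map e t') `<=` S.
    apply: (sub_cosets h (HbS ts)) => y /mapP[k]; rewrite mem_filter => /andP[/asboolP Bk _] ->.
    exact/(clos_e hK hL hB KB).
  apply: (Cc_intro h cont kt tS) => l; set g := sch_rep K e l => fl; have gl : Kb ((e g)^-1 * l)%g := @sch_repP _ _ _ _ hL l.
  have [k kt' Hkg] := ht g fl; have Bg := hecke_supp hf fl.
  have Bk : B k.
    rewrite -(invgK k) -(mulgK g k^-1%g) invgM invgK; apply: (gsubM hB) => //.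
    by apply: (gsubV hB); exact: HB.
  exists (e k); first by apply: map_f; rewrite mem_filter kt' andbT; exact/asboolP.
  have -> : ((e k)^-1 * l = ((e k)^-1 * e g) * ((e g)^-1 * l))%g by rewrite !group_simp.
  apply: (subM hHb); last exact: (KbHb gl).
  by rewrite -(schV hL) -(schM hL); exact: Hb_e.
- move=> k l Hk; have [x [y [xk yl xyl]]] := sch_approx ts k l.
  have Hx := (clos_coset hK hL hH KH xk).1 Hk.
  rewrite (sch_extE hK hL fr xyl) (sch_extE hK hL fr yl) (pE ts xk) proj0T //.
  by have := fe x y 1%g Hx (gsub1 hH); rewrite mulg1 (sigma1 ts) mulr1.
- move=> k l Hk; have [x [y [xl yk xyl]]] := sch_approx ts l k.
  have Hy := (clos_coset hK hL hH KH yk).1 Hk.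
  rewrite (sch_extE hK hL fr xyl) (sch_extE hK hL fr xl) (pE ts yk) proj0T //.
  by have := fe 1%g x y (gsub1 hH) Hy; rewrite mul1g (sigma1 ts) mul1r.
Qed.

Lemma res_ext f : helt f -> resG (sch_ext K e f) = f.
Proof.
by move=> hf; apply/funext => g; rewrite /resG (sch_ext_e hK hL _ (hecke_rinv hf)).
Qed.

Lemma res_hecke F : HP F -> helt (resG F).
Proof.
move=> [CF Fl Fr]; split.
- move=> x nS; apply: (Cc_out CF) => /(clos_e hK hL hB KB)/BS'; exact: nS.
- move=> a x b Ha Hb_; rewrite /resG !(schM hL) (Fr _ _ (Hb_e Hb_)) (Fl _ _ (Hb_e Ha)).
  by rewrite !sch_e_p.
- have [s _ Fs] := Cc_cover h CF (cosub_Hb ts).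
  pose r (l : L) := double_coset H (xget 1%g [set g | Hb (l^-1 * e g)%g]).
  apply: (@sub_finite_set _ _ [set` map r s]); last exact: finite_seq.
  move=> _ [x /eqP Fx <-]; have [l ls lx] := Fs _ Fx; apply/mapP; exists l => //.
  rewrite /r; case: xgetP => [g _ /= lg|/(_ x) //].
  have : Hb ((e x)^-1 * e g)%g by apply: (coset_trans hHb _ lg); exact: (coset_sym hHb lx).
  rewrite -(schV hL) -(schM hL) => /(clos_e hK hL hH KH) Hxg.
  apply/seteqP; split=> _ [a Ha [b Hb_ <-]]; exists a => //.
    exists ((x^-1 * g)^-1 * b)%g; last by rewrite !group_simp.
    by apply: (gsubM hH) => //; exact: (gsubV hH).
  by exists (x^-1 * g * b)%g; [exact: (gsubM hH)|rewrite !group_simp].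
Qed.

Lemma res_conv F F' : HP F -> HP F' -> resG (conv F F') = hecke_mul S' H (resG F) (resG F').
Proof.
move=> [CF Fl Fr] [CF' Fl' Fr']; apply/funext => x; rewrite /resG /Defs.conv.
have Ci := conv_integrand h (e x) CF (Cc_cont CF').
rewrite (@coset_sum Hb _ S' (cosub_Hb ts) (HbS ts) Ci); last 2 first.
- move=> l u Hu; have Hu' := subV hHb Hu.
  rewrite (Fr _ _ Hu) invgM -mulgA (Fl' _ _ Hu') (pV ts Hu).
  have alg (a b c d : R[i]) : b * c = 1 -> a * b * (c * d) = a * d by move=> bc; rewrite mulrA -(mulrA a) bc mulr1.
  exact: alg (p_conj ts Hu).
- move=> g nz; apply: BS'; apply/(clos_e hK hL hB KB); apply: (Cc_in CF) => F0.
  by move: nz; rewrite F0 mul0r eqxx.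
rewrite (mu_Hb ts) mul1r /hecke_mul.
have -> : [set g | Hb (e g)] = H by apply/seteqP; split=> g /(clos_e hK hL hH KH).
by apply: eq_fsbigr => c _; rewrite -(schV hL) -(schM hL).
Qed.

Lemma res_star F : HP F -> resG (star F) = hecke_star H sigma (resG F).
Proof.
move=> [CF Fl Fr]; apply/funext => x; rewrite /resG /conv_star /hecke_star -(schV hL).
have [Bx|nB] := pselect (B x^-1%g); first by rewrite Delta_hecke.
by rewrite (Cc_out CF) ?conjC0 ?mulr0 // => /(clos_e hK hL hB KB).
Qed.

Lemma resG_lin (k : R[i]) F F' : resG (k *: F + F') = k *: resG F + resG F'.
Proof. by []. Qed.

End HeckeCorner.

(** * Induced representations *)

Section Induction.
Variables (R : realType) (G : groupType) (H : set G) (sigma : G -> cplx R).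
Variables (L : topGroupType) (e : G -> L) (sigma' : L -> cplx R).
Variables (I : (L -> cplx R) -> cplx R) (Delta : L -> cplx R).
Hypothesis ts : triple_setting H sigma e sigma' I Delta.
Local Notation K := (char_ker H sigma).
Local Notation B := (Bset H sigma).
Local Notation Kb := (Kbar K e).
Local Notation Hb := (closure (e @` H)).
Local Notation S := (closure (e @` B)).
Local Notation conv := (Defs.conv I).
Local Notation star := (conv_star Delta).
Local Notation Cc := (@Cc R L S).
Local Notation p := (proj_fun e H sigma').
Local Notation left_eq := (@left_eq R G H L e sigma').
Local Notation right_eq := (@right_eq R G H L e sigma').
Local Notation HP := (@hecke_corner R G H sigma L e sigma').
Local Notation ext := (@sch_ext G K L e R).
Local Notation resG := (@resG R G L e).
Implicit Types (g : G) (l m u : L) (F : L -> cplx R) (f : G -> cplx R).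

Let hH := tsH ts.
Let hK := tsK ts.
Let hL := tsL ts.
Let hB := tsB ts.
Let h := triple_haar ts.
Let hD := tsD ts.
Let hHb : is_subgroup Hb := clos_subgroup hL hH.
Let hSb : is_subgroup S := clos_subgroup hL hB.
Let KH : K `<=` H := @char_ker_sub R G H sigma.
Let HB : H `<=` B := sub_Bset ts.
Let KB : K `<=` B := char_ker_Bset ts.

Variable S' : set G.
Hypothesis BS' : B `<=` S'.
Local Notation helt := (@hecke_elt R G S' H sigma).
Local Notation hecke := (@hecke_algebra R G S' H sigma).

Lemma hecke_closed : star_closed hecke.
Proof.
have extP f : helt f -> HP (ext f) := fun hf => hecke_ext ts hf.
have resE f : helt f -> resG (ext f) = f := fun hf => res_ext ts hf.
split.
- by have := res_hecke ts BS' (hecke_corner0 ts).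
- move=> k f g /= hf hg; rewrite -(resE _ hf) -(resE _ hg).
  exact: (res_hecke ts BS' (hecke_corner_lin ts k (extP _ hf) (extP _ hg))).
- move=> f g /= hf hg; rewrite -(resE _ hf) -(resE _ hg) -(res_conv ts BS') //; try exact: extP.
  exact: (res_hecke ts BS' (hecke_corner_conv ts (extP _ hf) (extP _ hg))).
- move=> f /= hf; rewrite -(resE _ hf) -(res_star ts); last exact: extP.
  exact: (res_hecke ts BS' (hecke_corner_star ts (extP _ hf))).
Qed.

Hypothesis hdir : directed_pair H B.

Lemma positive_partM x y : positive_part H B x -> positive_part H B y -> positive_part H B (x * y)%g.
Proof.
move=> [Bx Hx] [By Hy]; split; first exact: (gsubM hB).
move=> k Hk; apply/conj_setP; have /conj_setP Hk' := Hx k Hk.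
by have /conj_setP := Hy _ Hk'; rewrite !group_simp.
Qed.

(* Iterated Ore condition. *)
Lemma common_positive_multiplier (t : seq G) : (forall b, b \in t -> B b) ->
  exists y, positive_part H B y /\ forall b, b \in t -> positive_part H B (y * b)%g.
Proof.
elim: t => [|b t ih] tB.
  exists 1%g; split=> //; split; first exact: (gsub1 hB).
  by move=> k Hk; apply/conj_setP; rewrite !group_simp.
have [|y [yp yt]] := ih; first by move=> b' bt; apply: tB; rewrite inE bt orbT.
have : B (y * b)%g by apply: (gsubM hB); [case: yp|apply: tB; rewrite mem_head].
rewrite {1}hdir => -[a ap [c cp ac]]; exists (a * y)%g; split; first exact: positive_partM.
move=> b'; rewrite inE => /predU1P[->|/yt bt]; rewrite -mulgA; last exact: positive_partM.
by rewrite -ac mulVKg.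
Qed.

(** Write a point of the support of [L_y F] as [l' = w z] with [w = y b] in [B^+] and [z] in the
    closure of [H]. Then [k l' = l' z^-1 (w^-1 k w) z], where [w^-1 k w] is again in the closure of
    [H] and has the same [p] as [k]; right equivariance of [F] pulls out [p k]. *)
Lemma shift_left_eq F : Cc F -> right_eq F -> exists y, B y /\ left_eq (lsh (e y) F).
Proof.
move=> CF Fr; have [s sS Fs] := Cc_cover h CF (cosub_Hb ts).
have [t tB Ft] : exists2 t : seq G, (forall b, b \in t -> B b) &
    forall l, F l <> 0 -> exists2 b, b \in t & Hb ((e b)^-1 * l)%g.
  have cH := cosub_Hb ts; have [_ oH _] := cH.
  have /choice[b hb] : forall l, exists g, Hb (l^-1 * e g)%g.
    move=> l; have [|g] := sch_dense hL (l := l) (V := [set m | Hb (l^-1 * m)%g]); last by exists g.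
    exact: nbhs_coset (cosub_nbhs cH).
  exists (map b s) => [_ /mapP[l ls ->]|l /Fs[y ys yl]].
    apply/(clos_e hK hL hB KB); rewrite -(mulVKg l (e _)).
    by apply: (subM hSb); [exact: sS|exact: (HbS ts)].
  by exists (b y); [exact: map_f|apply: (coset_trans hHb _ yl); exact: (coset_sym hHb (hb y))].
have [y [[By Hy] yt]] := common_positive_multiplier tB.
exists y; split=> // k l Hk; rewrite /lsh.
have key k' l' : Hb k' -> F ((e y)^-1 * l')%g <> 0 ->
    F ((e y)^-1 * (k' * l'))%g = p k' * F ((e y)^-1 * l')%g.
  move=> Hk' /Ft[b bt]; set w := (y * b)%g.
  have -> : ((e b)^-1 * ((e y)^-1 * l') = (e w)^-1 * l')%g by rewrite (schM hL) !group_simp.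
  move=> wl; have [Bw Hw] : positive_part H B w := yt b bt.
  clearbody w.
  have cK := cosub_Kbar hK hL.
  have n1 := cosub_nbhs cK; have n2 := cosub_nbhs (cosub_conj (e w) cK).
  (* Positivity and membership in [B] concern [H] only. They reach its closure through an [x] in [H]
     approximating [k'] both directly and after conjugation by [w]. *)
  have [|x [xk wx]] := sch_dense hL (l := k')
    (V := [set z | Kb (z^-1 * k')%g] `&` [set z | conj_by (e w) Kb (z^-1 * k')%g]).
    by apply: filterI; apply: inv_mul_continuous; rewrite /= mulVg; [exact: n1|exact: n2].
  have Hx := (clos_coset hK hL hH KH xk).1 Hk'.
  have /conj_setP Hwx := Hw x Hx.
  have swx : sigma x = sigma (w^-1 * x * w)%g := Bw x Hx (Hw x Hx).
  set k2 := ((e w)^-1 * k' * e w)%g.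
  have wk2 : Kb ((e (w^-1 * x * w))^-1 * k2)%g.
    by rewrite !(schM hL) (schV hL) /k2; move: wx; rewrite /conj_by /= !group_simp.
  have Hk2 : Hb k2 by apply/(clos_coset hK hL hH KH wk2).
  have pk2 : p k2 = p k' by rewrite (pE ts wk2) (pE ts xk) !proj0T.
  set z := ((e w)^-1 * l')%g in wl *.
  have -> : ((e y)^-1 * (k' * l') = (e y)^-1 * l' * (z^-1 * k2 * z))%g.
    by rewrite /z /k2 !group_simp.
  have Hzk : Hb (z^-1 * k2)%g by apply: (subM hHb) => //; exact: (subV hHb).
  rewrite (Fr _ _ (subM hHb Hzk wl)) (pM ts Hzk wl) (pM ts (subV hHb wl) Hk2) (pV ts wl) pk2.
  have alg (a b' c d : R[i]) : b' * d = 1 -> a * (d * c * b') = c * a.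
    by move=> bd; transitivity ((b' * d) * (c * a)); [ring|rewrite bd mul1r].
  exact: alg (p_conj ts wl).
(* A zero at [l] forces a zero at [k l]: otherwise [key] for [k^-1] at [k l] contradicts [p] being
   nonzero. *)
have [F0|F0] := pselect (F ((e y)^-1 * l)%g = 0); last exact: key.
rewrite F0 mulr0; apply: contrapT => F1.
by have := key _ _ (subV hHb Hk) F1; rewrite mulKg F0 => /esym/eqP; rewrite mulf_eq0 => /orP[/eqP|/eqP//];
  apply/eqP; exact: (p_neq0 ts (subV hHb Hk)).
Qed.

Variables (V : hilbert R) (rho : hecke -> {linear V -> V}).
Hypothesis hrho : star_rep rho.

Lemma star_rep_adj f v w : helt f -> hs_dot V (rho (hecke_star H sigma f) v) w = hs_dot V v (rho f w).
Proof.
by move=> hf; have [_ _ _ hS] := hrho; rewrite dotC -hS // -dotC.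
Qed.

Lemma induced_representation (v : V) :
  exists (W : hilbert R) (j : (L -> cplx R) -> W)
    (pi : @conv_algebra R L S I Delta -> {linear W -> W}),
  [/\ L1_rep pi,
      forall F, Cc F -> HP F -> rnorm (j F) = rnorm (rho (resG F) v)
    & forall F, HP F -> pi F (j p) = j F].
Proof.
have [rc rP rM rS] := hrho.
pose D := [set F | Cc F /\ right_eq F].
pose q F F' := hs_dot V (rho (resG (conv (star F') F)) v) v.
have DCc F : D F -> Cc F by case.
have HPq F F' : D F -> D F' -> HP (conv (star F') F).
  move=> [CF Fr] [CF' Fr']; have CsF' := Cc_star h hD CF'; split.
  - exact: (Cc_conv h CsF' CF).
  - exact: (conv_left ts CsF' CF (star_left ts CF' Fr')).
  - exact: (conv_right ts CsF' CF Fr).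
have hP F : HP F -> helt (resG F) := fun hF => res_hecke ts BS' hF.
have qHP F : HP F -> q F F = (rnorm (rho (resG F) v) ^+ 2)%:C.
  move=> hF; rewrite /q (res_conv ts BS' (hecke_corner_star ts hF) hF) (res_star ts hF).
  have hs : helt (hecke_star H sigma (resG F)) by rewrite -(res_star ts hF); exact: hP (hecke_corner_star ts hF).
  by rewrite (rM _ _ v hs (hP _ hF)) (star_rep_adj _ _ (hP _ hF)) dot_rnorm.
have D0 : D 0 by split; [exact: (Cc0 h)|move=> m l _; rewrite mul0r].
have DP (k : R[i]) a b : D a -> D b -> D (k *: a + b).
  move=> [Ca ar] [Cb br]; split; first exact: (CcP h k Ca Cb).
  move=> m l Hm; rewrite !fctE (ar _ _ Hm) (br _ _ Hm) mulrDl; congr (_ + _).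
  exact: mulrA.
have Dconv (g F : L -> cplx R) : Cc g -> D F -> D (conv g F).
  by move=> Cg [CF Fr]; split; [exact: (Cc_conv h Cg CF)|exact: (conv_right ts Cg CF Fr)].
have Dlsh y F : S y -> D F -> D (lsh y F).
  move=> Sy [CF Fr]; split; first exact: (Cc_lsh h Sy CF).
  by move=> m l Hm; rewrite /lsh mulgA Fr.
have Dinv F : D F -> exists U, [/\ cosub U, U `<=` S & left_inv U F].
  by move=> [CF Fr]; exact: (left_invariant ts CF Fr).
have qP (k : R[i]) a b c : D a -> D b -> D c -> q (k *: a + b) c = k * q a c + q b c.
  move=> Da Db Dc; rewrite /q (conv_linr h k (Cc_star h hD (DCc _ Dc)) (Cc_cont (DCc _ Da)) (Cc_cont (DCc _ Db))).
  by rewrite resG_lin (rP k _ _ v (hP _ (HPq _ _ Da Dc)) (hP _ (HPq _ _ Db Dc))) dotP.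
have qC a b : D a -> D b -> q a b = ((q b a)^*)%R.
  move=> Da Db; rewrite /q -(star_conv_swap h hD (DCc _ Da) (DCc _ Db)).
  by rewrite (res_star ts (HPq _ _ Db Da)) (star_rep_adj _ _ (hP _ (HPq _ _ Db Da))) dotC.
have q_lsh y F : S y -> D F -> q (lsh y F) (lsh y F) = q F F.
  by move=> Sy /DCc CF; rewrite /q (conv_star_lsh h hD Sy CF CF).
have q_ge0 a : D a -> 0 <= q a a.
  move=> Da; have [y [By yl]] := shift_left_eq (DCc _ Da) Da.2.
  have Sy : S (e y) by apply/(clos_e hK hL hB KB).
  have [Cl lr] := Dlsh _ _ Sy Da.
  by rewrite -(q_lsh _ _ Sy Da) qHP ?ler0c ?sqr_ge0 //; split.
have q_star (g F F' : L -> cplx R) : Cc g -> D F -> D F' -> q (conv g F) F' = q F (conv (star g) F').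
  move=> Cg DF /DCc CF'; have [U [cU US FU]] := Dinv F DF.
  by rewrite /q (star_conv_assoc h hD cU US FU Cg (DCc _ DF) CF').
have [W [j [pi [hpi jq pij]]]] :=
  gns_representation h hD D0 DP DCc Dconv Dlsh Dinv qP qC q_ge0 q_lsh q_star.
exists W, j, pi; split=> // [F CF hF|F hF].
  have DF : D F by split=> //; case: hF.
  apply/eqP; rewrite -(@eqrXn2 _ 2) ?rnorm_ge0 //; apply/eqP/complexI.
  by rewrite -dot_rnorm (jq _ _ DF DF) qHP.
have [CF Fl Fr] := hF.
have Dp : D p by split; [exact: (Cc_p ts)|exact: (p_right ts)].
by rewrite (pij _ _ CF Dp) (conv_pr ts CF Fr).
Qed.

(** With [F = ext f], the chain is [||rho(f) v|| = ||j F|| = ||pi(F) j(p)|| <= N(F) ||j(p)||] and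
    [||j(p)|| = ||rho(p) v|| <= ||v||]. [N] will be the norm of the group C*-algebra. *)
Lemma hecke_rep_bound (N : (L -> cplx R) -> R) :
  (forall (W : hilbert R) (pi : @conv_algebra R L S I Delta -> {linear W -> W}), L1_rep pi ->
    forall F w, Cc F -> rnorm (pi F w) <= N F * rnorm w) ->
  (forall F, 0 <= N F) -> forall f v, helt f -> rnorm (rho f v) <= N (ext f) * rnorm v.
Proof.
move=> hN hN0 f v hf; have [W [j [pi [hpi jn pij]]]] := induced_representation v.
have hF := hecke_ext ts hf; have [CF _ _] := hF; have hp := hecke_corner_p ts; have [Cp _ _] := hp.
have := hN W pi hpi (ext f) (j p) CF; rewrite (pij _ hF) (jn _ CF hF) (jn _ Cp hp).
rewrite (res_ext ts hf) => H1.
have [rc rP rM rS] := hrho.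
have hrp := res_hecke ts BS' hp.
(* [rho(p)] is a self-adjoint idempotent, so [||rho(p) v||^2 = <v, rho(p) v>] and Cauchy-Schwarz
   applies. *)
have pv : rnorm (rho (resG p) v) <= rnorm v.
  have [->|n0] := eqVneq (rnorm (rho (resG p) v)) 0; first exact: rnorm_ge0.
  have np : 0 < rnorm (rho (resG p) v) by rewrite lt_neqAle rnorm_ge0 eq_sym n0.
  rewrite -(ler_pM2r np) -expr2 -[leLHS]rnorm_real ?sqr_ge0 // -dot_rnorm.
  rewrite -(star_rep_adj _ _ hrp) -(res_star ts hp) (star_p ts).
  have [_ pl _] := hp; have pp : sa_mul (resG p : hecke) (resG p) = resG p.
    by apply: etrans (esym (res_conv ts BS' hp hp)) _; rewrite (conv_pl ts Cp pl).
  rewrite -(rM _ _ _ hrp hrp) pp mulrC; exact: dot_CS.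
by apply: le_trans H1 _; apply: ler_wpM2l => //; exact: hN0.
Qed.

End Induction.

(** * Corners of a C*-algebra *)

Section Corner.
Variables (R : realType) (E : cstarAlg R) (q : E).
Hypotheses (qq : cs_mul q q = q) (qs : cs_star q = q).

Definition compress (a : E) : E := cs_mul (cs_mul q a) q.

Lemma cs_mul_rnorm (a b : E) : rnorm (cs_mul a b) <= rnorm a * rnorm b.
Proof. by rewrite -lecR rcM !rnormE cs_normM. Qed.

Lemma cs_mulBl (a b c : E) : cs_mul (a - b) c = cs_mul a c - cs_mul b c.
Proof. by rewrite addrC -scaleN1r cs_mulPl scaleN1r addrC. Qed.

Lemma cs_mulBr (a b c : E) : cs_mul a (b - c) = cs_mul a b - cs_mul a c.
Proof. by rewrite addrC -scaleN1r cs_mulPr scaleN1r addrC. Qed.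

Lemma compress_continuous : continuous compress.
Proof.
apply: lip_continuous; exists (rnorm q * rnorm q).
  by rewrite mulr_ge0 ?rnorm_ge0.
move=> a b; rewrite /compress -cs_mulBl -cs_mulBr.
apply: le_trans (cs_mul_rnorm _ _) _; rewrite mulrAC ler_wpM2r ?rnorm_ge0 //.
exact: cs_mul_rnorm.
Qed.

Lemma compressK a : compress (compress a) = compress a.
Proof. by rewrite /compress !cs_mulA qq -!cs_mulA qq. Qed.

Lemma cornerP a : cstar_corner q a <-> compress a = a.
Proof.
split=> [[b _ <-]|<-]; [exact: compressK|by exists a].
Qed.

(** The corner is the fixed-point set of the continuous map [compress]. *)
Lemma corner_closed : closed (cstar_corner q).
Proof.
move=> a /= ac; apply/cornerP/eqP; rewrite -subr_eq0; apply/eqP.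
pose f b := compress b - b.
have cf : continuous f by move=> b; apply: cvgB; [exact: compress_continuous|exact: cvg_id].
apply: contrapT => /eqP fa.
have c0 : closed [set (0 : E)] by exact: (@accessible_closed_set1 _ (hausdorff_accessible (@norm_hausdorff _ E)) 0).
have nf : nbhs (f a) (~` [set 0]).
  by apply: open_nbhs_nbhs; split; [exact: closed_openC|exact/eqP].
have [b [/cornerP bq]] := ac _ (cf a _ nf).
by rewrite /= /f bq subrr.
Qed.

Lemma corner_subalgebra : cstar_subalgebra (cstar_corner q).
Proof.
split; first exact: corner_closed.
split=> /=.
- by apply/cornerP; rewrite /compress -{1}(subrr q) cs_mulBr subrr -{1}(subrr q) cs_mulBl subrr.
- move=> k a b /cornerP aq /cornerP bq; apply/cornerP.
  by rewrite /compress cs_mulPr cs_mulPl -!/(compress _) aq bq.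
- move=> a b /cornerP aq /cornerP bq; apply/cornerP.
  rewrite -aq -bq /compress; move: a b {aq bq} => a b.
  by rewrite !cs_mulA qq -!cs_mulA qq.
- move=> a /cornerP aq; apply/cornerP.
  by rewrite -{2}aq /compress !cs_starM qs cs_mulA.
Qed.

End Corner.

(** * The enveloping C*-algebra as a corner *)

Section Envelope.
Variables (R : realType) (G : groupType) (H : set G) (sigma : G -> cplx R).
Variables (L : topGroupType) (e : G -> L) (sigma' : L -> cplx R).
Variables (I : (L -> cplx R) -> cplx R) (Delta : L -> cplx R).
Hypothesis ts : triple_setting H sigma e sigma' I Delta.
Local Notation K := (char_ker H sigma).
Local Notation B := (Bset H sigma).
Local Notation S := (closure (e @` B)).
Local Notation conv := (Defs.conv I).
Local Notation star := (conv_star Delta).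
Local Notation Cc := (@Cc R L S).
Local Notation p := (proj_fun e H sigma').
Local Notation ext := (@sch_ext G K L e R).
Local Notation resG := (@resG R G L e).
Implicit Types (F : L -> cplx R) (f : G -> cplx R).

Let h := triple_haar ts.

Variable S' : set G.
Hypothesis BS' : B `<=` S'.
Local Notation helt := (@hecke_elt R G S' H sigma).
Local Notation hecke := (@hecke_algebra R G S' H sigma).

Hypothesis hdir : directed_pair H B.

Lemma ext_mul (f g : hecke) : helt f -> helt g -> ext (sa_mul f g) = conv (ext f) (ext g).
Proof.
move=> hf hg; have hF := hecke_ext ts hf; have hF' := hecke_ext ts hg.
have E := res_conv ts BS' hF hF'; rewrite !(res_ext ts hf, res_ext ts hg) in E.
by rewrite (hecke_corner_ext ts (hecke_corner_conv ts hF hF')) E.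
Qed.

Lemma ext_star (f : hecke) : helt f -> ext (sa_star f) = star (ext f).
Proof.
move=> hf; have hF := hecke_ext ts hf.
have E := res_star ts hF; rewrite (res_ext ts hf) in E.
by rewrite (hecke_corner_ext ts (hecke_corner_star ts hF)) E.
Qed.

Variables (E : cstarAlg R) (u : (L -> cplx R) -> E).
Hypothesis hE : @is_group_cstar R L S I Delta E u.

(** The embedding is [f |-> u (ext f)], so the norm to be identified is the one restricted from the
    group C*-algebra. Representations of the Hecke algebra are bounded by it through induction; it
    is the least such bound by restricting representations of [C_c]. *)
Lemma envelope_corner : envelope_is_corner e H sigma B I p S' u.
Proof.
have [_ [[uP uM uS] uinj] udense ubound ulub] := hE.
have extCc f : helt f -> Cc (ext f) by move=> hf; have [] := hecke_ext ts hf.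
have Cp := Cc_p ts.
have pp : conv p p = p by apply: (conv_pl ts Cp); have [] := hecke_corner_p ts.
have qq : cs_mul (u p) (u p) = u p by rewrite -(uM _ _ Cp Cp) /= pp.
have qs : cs_star (u p) = u p by rewrite -(uS _ Cp) /= (star_p ts).
have cF F : Cc F -> compress (u p) (u F) = u (conv (conv p F) p).
  by move=> CF; rewrite (uM _ _ (Cc_conv h Cp CF) Cp) (uM _ _ Cp CF).
have cext f : helt f -> compress (u p) (u (ext f)) = u (ext f).
  by move=> hf; rewrite (cF _ (extCc _ hf)) (hecke_corner_pp ts (hecke_ext ts hf)).
exists (fun f => u (ext f)); split.
  move=> f hf; exists (ext f); rewrite (hecke_corner_pp ts (hecke_ext ts hf)); split=> //.
    exact: extCc.
  move=> x; rewrite -/(resG (ext f) x) (res_ext ts hf).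
  have [Bx|nB] := pselect (B x); first by rewrite indicT // mul1r.
  rewrite indicF // mul0r; apply: contrapT => /(hecke_supp ts hf); exact: nB.
split.
- by split; [exact: (hecke_closed ts BS')|exact: corner_subalgebra].
- split; last first.
    move=> f hf uf; rewrite -(res_ext ts hf) (uinj _ (extCc _ hf) uf).
    exact: erefl.
  split=> [k f g hf hg|f g hf hg|f hf].
  + exact: (uP k _ _ (extCc _ hf) (extCc _ hg)).
  + by rewrite (ext_mul hf hg); exact: (uM _ _ (extCc _ hf) (extCc _ hg)).
  + by rewrite (ext_star hf); exact: (uS _ (extCc _ hf)).
- apply/seteqP; split=> a.
    move=> /(cornerP qq) aq V Va.
    have Va' : nbhs (compress (u p) a) V by rewrite aq.
    have : closure (u @` Cc) a by rewrite -udense.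
    move=> /(_ _ (@compress_continuous _ _ (u p) a _ Va'))[_ [[F CF <-] /= VF]].
    (* Compression sends the dense image [u(C_c)] into the image of the Hecke algebra, and by
       continuity it keeps the approximation of [a], which it fixes. *)
    have hF := hecke_corner_pFp ts CF.
    exists (compress (u p) (u F)); split=> //.
    exists (resG (conv (conv p F) p)); first exact: (res_hecke ts BS' hF).
    by rewrite -(hecke_corner_ext ts hF) (cF _ CF).
  move=> ac; apply: (corner_closed qq); apply: closureS ac => _ [f hf <-].
  by apply/(cornerP qq); exact: cext.
- move=> V pi hpi f v hf; rewrite -!rnormE -rcM lecR.
  apply: (hecke_rep_bound ts BS' hdir hpi (N := fun F => rnorm (u F))) => // [W tau htau F w CF|F].
    by have := ubound W tau htau F w CF; rewrite -!rnormE -rcM lecR.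
  exact: rnorm_ge0.
- move=> f M hf M0 bound; apply: (ulub (ext f) M (extCc _ hf) M0) => V pi [[pc pP pM pS] pL] v.
  (* Composition with [ext] turns an [L^1]-bounded representation of [C_c] into one of the Hecke
     algebra, to which the assumed bound applies. *)
  apply: (bound V (fun f => pi (ext f))); split=> [g hg|k g g' w hg hg'|g g' w hg hg'|g w w' hg].
  + exact: (pc _ (extCc _ hg)).
  + exact: (pP k _ _ w (extCc _ hg) (extCc _ hg')).
  + by rewrite (ext_mul hg hg'); exact: (pM _ _ w (extCc _ hg) (extCc _ hg')).
  + by rewrite (ext_star hg); exact: (pS _ w w' (extCc _ hg)).
Qed.

End Envelope.

Theorem proposition7p2 (R : realType) (G : groupType) (H : set G)
  (sigma : G -> cplx R)
  (hred : reduced_hecke_triple H sigma)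
  (hB : is_subgroup (Bset H sigma))
  (hdir : directed_pair H (Bset H sigma))
  (L : topGroupType) (e : G -> L)
  (hL : is_schlichting_completion (char_ker H sigma) e)
  (sigma' : L -> cplx R)
  (hsigma' : is_character_extension e H sigma sigma')
  (I : (L -> cplx R) -> cplx R)
  (hI : is_haar (closure (e @` Bset H sigma)) I)
  (hI1 : I (fun x => \1_(closure (e @` H)) x : R[i]) = 1)
  (Delta : L -> cplx R)
  (hDelta : is_modular_function (closure (e @` Bset H sigma)) I Delta) :
  (exists (E : cstarAlg R) (u : (L -> cplx R) -> E),
     @is_group_cstar R L (closure (e @` Bset H sigma)) I Delta E u) /\
  (forall (E : cstarAlg R) (u : (L -> cplx R) -> E),
     @is_group_cstar R L (closure (e @` Bset H sigma)) I Delta E u ->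
     envelope_is_corner e H sigma (Bset H sigma) I
       (proj_fun e H sigma') setT u /\
     envelope_is_corner e H sigma (Bset H sigma) I
       (proj_fun e H sigma') (Bset H sigma) u).
Proof.
have ts := TripleSetting hred hB hL hsigma' hI hI1 hDelta.
split; first exact: (group_cstar_exists (triple_haar ts) hDelta).
move=> E u hE; split.
  exact: (envelope_corner ts (@subsetT _ _) hdir hE).
exact: (envelope_corner ts (@subset_refl _ _) hdir hE).
Qed.
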